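(* Let $n\ge 1$ and let $\lambda=(\lambda_1\ge\cdots\ge\lambda_n\ge0)$ be a partition. Let $X=C$ (resp. $X=B$) and let $\mathcal T$ be the set of reverse King (resp. reverse Sundaram) tableaux of shape $\lambda$. Then the map $\mathbf{key}\colon\mathcal T\to W$ defined in the context is a right key map; that is, $\mathcal T=\bigsqcup_{w\in W}\{T\in\mathcal T\mid\mathbf{key}(T)=w\}$ and for every $w\in W$ $$A_w(\mathbf z,\lambda)=\sum_{\substack{T\in\mathcal T\\ \mathbf{key}(T)=w}}\mathbf z^{\mathrm{wt}(T)},$$ where $A_w(\mathbf z,\lambda)$ is the type $X_n$ Demazure atom.
   Context: **Weyl group and atoms.** $W$ is the group of signed permutations: permutations $w$ of $\{1,\dots,n,\bar n,\dots,\bar1\}$ with $w(\bar\imath)=\overline{w(i)}$ ($\bar{\bar\imath}=i$), with composition as product. For $i<n$, $s_i$ swaps $i\leftrightarrow i+1$ (and $\bar\imath\leftrightarrow\overline{i+1}$); $s_n$ swaps $n\leftrightarrow\bar n$. $s_i\mathbf z$ ($i<n$) interchanges $z_i,z_{i+1}$ in $\mathbf z=(z_1,\dots,z_n)$; $s_n\mathbf z$ replaces $z_n$ by $z_n^{-1}$. Put $\overline\pi_if=\frac{f(\mathbf z)-f(s_i\mathbf z)}{z_iz_{i+1}^{-1}-1}$ ($i<n$), $\overline\pi_nf=\frac{f(\mathbf z)-f(s_n\mathbf z)}{z_n-1}$ (type $B$), $\overline\pi_nf=\frac{f(\mathbf z)-f(s_n\mathbf z)}{z_n^2-1}$ (type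 $C$). For a reduced word $w=s_{i_1}\cdots s_{i_k}$, $A_w(\mathbf z,\lambda)=\overline\pi_{i_1}\cdots\overline\pi_{i_k}\mathbf z^\lambda$. **Tableaux.** Use the alphabet $1<\bar1<2<\bar2<\cdots<n<\bar n$. A reverse King tableau of shape $\lambda$ is a filling of the Young diagram of $\lambda$ (English convention) with weakly decreasing rows, strictly decreasing columns, and all entries of row $r$ at most $\overline{n+1-r}$. A reverse Sundaram tableau of shape $\lambda$ is a filling obtained from a reverse King tableau by choosing a (possibly empty) set of rows $r$ whose leftmost entry equals $\overline{n+1-r}$ and replacing that leftmost entry by the symbol $\infty$. In both cases $\mathbf z^{\mathrm{wt}(T)}=\prod_{i=1}^nz_i^{m_i-m_{\bar\imath}}$, where $m_k$ is the number of entries equal to $k$ ($\infty$ is ignored). **From a tableau to vertical edges.** Let $T$ be a reverse King tableau. For $i=1,\dots,n$ let $(a_{i,i},a_{i,i+1},\dots,a_{i,n})$ be the shape of the subtableau of entries $\ge i$ and $(b_{i,i},\dots,b_{i,n})$ the shape of the subtableau of entries $\ge\bar\imath$ (each with $n-i+1$ parts, zeros allowed). If $T$ is a reverse Sundaram tableau, first replace each $\infty$ in row $r$ by $\overline{n+1-r}$. **Lattice model.** Colors: $c_1>c_2>\cdots>c_n>\overline c_n>\cdots>\overline c_1$, with bar an involution and $c_{\bar k}:=\overline c_k$. Spins are colors or $0$. The grid has rows $1,\dots,2n$ from top to bottom and $m\ge\lambda_1+n$ columns numbered $0,1,\dots,m-1$ from right to left; odd rows are $\Gamma$ rows, even rows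 are $\Delta$ rows; the right ends of rows $2i-1$ and $2i$ are joined by a U-turn with a top spin and a bottom spin. Allowed local configurations, vertices written (left, top, right, bottom), for colors $c>c'$ and any color $d$: $\Gamma$: $(0,0,0,0)$, $(c',c,c,c')$, $(c,c',c,c')$, $(d,d,d,d)$, $(d,0,d,0)$, $(0,d,d,0)$, $(d,0,0,d)$. $\Delta$: $(0,0,0,0)$, $(c',c',c,c)$, $(c',c,c',c)$, $(d,d,d,d)$, $(d,0,d,0)$, $(d,d,0,0)$, $(0,0,d,d)$. U-turns (top, bottom): $(0,0)$, $(u,\overline u)$, $(\overline u,\overline u)$ for $u\in\{c_1,\dots,c_n\}$. For $w\in W$, an admissible state of $\overline{\mathfrak S}_{\lambda,w}$ is an assignment of spins to all edges, with all local configurations allowed, such that: bottom edges are $0$; left edges of $\Gamma$ rows are $0$; the left edge of row $2i$ is $\overline{c_{w^{-1}(i)}}$; the top edge of column $\lambda_i+n-i$ is $c_i$, and the other top edges are $0$. **The key map.** For $T\in\mathcal T$ there is a unique $w\in W$ for which there is a (necessarily unique) admissible state of $\overline{\mathfrak S}_{\lambda,w}$ whose colored (nonzero) vertical edges are exactly: for each $i=1,\dots,n$, just above row $2i-1$, the edges in columns $a_{i,j}+n-j$ ($i\le j\le n$); and between rows $2i-1$ and $2i$, the edges in columns $b_{i,j}+n-j-1$ ($i\le j\le n$), omitting $j=n$ when $b_{i,n}=0$. Set $\mathbf{key}(T):=w$. *)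

(* Defs.v *)
From HB Require Import structures.
From mathcomp Require Import all_boot all_order all_algebra all_fingroup.
From mathcomp Require Import generic_quotient fraction mpoly.

Set Implicit Arguments.
Unset Strict Implicit.
Unset Printing Implicit Defensive.

Import Order.TTheory GRing.Theory Num.Theory.
Local Open Scope ring_scope.

(* Indices are 0-based throughout: [i : 'I_n] stands for the number i + 1.    *)

(* (i, false) stands for i + 1 and (i, true) for its barred version.  The     *)
(* same type serves as the set permuted by W, as the alphabet of tableaux     *)
(* and, via k |-> c_k, as the set of colors.                                  *)
Definition letter (n : nat) : finType := ('I_n * bool)%type.

Definition bar n (x : letter n) : letter n := (x.1, ~~ x.2).

Section Weyl.

Variable n : nat.

Definition W : {set {perm letter n}} :=
  [set w : {perm letter n} | [forall x, w (bar x) == bar (w x)]].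

(* [ordS i] is i + 1 whenever i.+1 < n; the remaining case is i = n - 1.      *)
Definition refl (i : 'I_n) : {perm letter n} :=
  if (i.+1 < n)%N
  then (tperm (i, false) (ordS i, false) * tperm (i, true) (ordS i, true))%g
  else tperm (i, false) (i, true).

(* The composition s_{i_1} o ... o s_{i_k}: in mathcomp, (u * v)%g applies u *)
(* first, whence the reversed order of the factors.                           *)
Definition word_perm (s : seq 'I_n) : {perm letter n} :=
  foldr (fun i u => u * refl i)%g 1%g s.

Definition reduced_word (w : {perm letter n}) (s : seq 'I_n) : Prop :=
  word_perm s = w /\
  forall s', word_perm s' = w -> (size s <= size s')%N.

End Weyl.

Inductive cartan_type := TypeB | TypeC.

Section Atoms.

Variable n : nat.

Definition ratfun : fieldType := {fraction {mpoly int[n]}}.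

Definition zvar (i : 'I_n) : ratfun := FracField.tofrac 'X_i.

(* Substitution f(v_1, ..., v_n).  The result does not depend on the chosen   *)
(* representative p / q of f as soon as v is algebraically independent, which *)
(* is the case for v = s_i z.                                                 *)
Definition subst (v : 'I_n -> ratfun) (f : ratfun) : ratfun :=
  mmap intr v (\n_(repr f)) / mmap intr v (\d_(repr f)).

Definition refl_vars (i : 'I_n) : 'I_n -> ratfun :=
  if (i.+1 < n)%N then fun j => zvar (tperm i (ordS i) j)
  else fun j => if j == i then (zvar j)^-1 else zvar j.

Definition atom_op (X : cartan_type) (i : 'I_n) (f : ratfun) : ratfun :=
  (f - subst (refl_vars i) f) /
  (if (i.+1 < n)%N then zvar i * (zvar (ordS i))^-1 - 1
   else match X with
        | TypeB => zvar i - 1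
        | TypeC => zvar i ^+ 2 - 1
        end).

Definition atom (X : cartan_type) (lam : n.-tuple nat) (s : seq 'I_n) : ratfun :=
  foldr (atom_op X) (\prod_(i < n) zvar i ^+ tnth lam i) s.

End Atoms.

Section Tableaux.

Variables (n : nat) (lam : n.-tuple nat).

(* 1 < bar 1 < 2 < bar 2 < ... < n < bar n                                    *)
Definition letter_rank (x : letter n) : nat := (x.1.*2 + x.2)%N.

(* A cell is (row, column); columns are bounded by the first part of lam.     *)
Definition cell : finType :=
  {c : 'I_n * 'I_(head 0%N lam) | (c.2 < tnth lam c.1)%N}.

Definition rowc (c : cell) : 'I_n := (val c).1.
Definition colc (c : cell) : nat := (val c).2.

(* The letter bar(n + 1 - r), for r the 1-based number of the row.            *)
Definition row_bound (r : 'I_n) : letter n := (rev_ord r, true).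

Definition reverse_king (U : {ffun cell -> letter n}) : bool :=
  [&& [forall c, forall d, (rowc c == rowc d) && (colc c < colc d)%N ==>
         (letter_rank (U d) <= letter_rank (U c))%N],
      [forall c, forall d, (colc c == colc d) && (rowc c < rowc d)%N ==>
         (letter_rank (U d) < letter_rank (U c))%N]
    & [forall c, (letter_rank (U c) <= letter_rank (row_bound (rowc c)))%N]].

(* None is the symbol infinity.                                               *)
Definition filling : finType := {ffun cell -> option (letter n)}.

Definition with_infty (U : {ffun cell -> letter n}) (R : {set 'I_n}) : filling :=
  [ffun c => if (rowc c \in R) && (colc c == 0%N) then None else Some (U c)].

Definition infty_rows (U : {ffun cell -> letter n}) (R : {set 'I_n}) : bool :=
  [forall r in R,
     [exists c, [&& rowc c == r, colc c == 0%N & U c == row_bound r]]].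

Definition tableaux (X : cartan_type) : {set filling} :=
  match X with
  | TypeC => [set T | [exists U, reverse_king U && (T == with_infty U set0)]]
  | TypeB => [set T | [exists U, exists R,
                [&& reverse_king U, infty_rows U R & T == with_infty U R]]]
  end.

Definition mult (T : filling) (x : letter n) : nat :=
  #|[set c | T c == Some x]|.

Definition zwt (T : filling) : ratfun n :=
  \prod_(i < n) zvar i ^ ((mult T (i, false))%:Z - (mult T (i, true))%:Z).

Definition fill_infty (T : filling) : {ffun cell -> letter n} :=
  [ffun c => odflt (row_bound (rowc c)) (T c)].

(* For i <= j, [subshape U x i j] with x = (i, false) (resp. (i, true)) is    *)
(* a_{i,j} (resp. b_{i,j}): the number of entries >= x in the (j - i)-th row, *)
(* rows being counted from 0.                                                 *)
Definition subshape (U : {ffun cell -> letter n}) (x : letter n) (i j : 'I_n) :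
    nat :=
  #|[set c | (rowc c == j - i :> nat)%N &&
             (letter_rank x <= letter_rank (U c))%N]|.

(* Columns of the colored edges just above the Gamma row i.                   *)
Definition cols_above (U : {ffun cell -> letter n}) (i : 'I_n) (c : nat) : bool :=
  [exists j : 'I_n, (i <= j)%N &&
     (c == subshape U (i, false) i j + (n - j.+1))%N].

(* Columns of the colored edges between the Gamma row i and the Delta row i.  *)
Definition cols_between (U : {ffun cell -> letter n}) (i : 'I_n) (c : nat) :
    bool :=
  [exists j : 'I_n,
     [&& (i <= j)%N,
         ~~ ((j.+1 == n) && (subshape U (i, true) i j == 0%N))
       & (c == subshape U (i, true) i j + (n - j.+1) - 1)%N]].

End Tableaux.

Section Lattice.

Variables n m : nat.

(* None is the spin 0.                                                        *)
Definition spin : finType := option (letter n).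

(* c_1 > ... > c_n > bar c_n > ... > bar c_1                                  *)
Definition color_pos (c : letter n) : nat :=
  if c.2 then (n.*2 - c.1.+1)%N else c.1.
Definition color_gt (c c' : letter n) : bool := (color_pos c < color_pos c')%N.

(* Vertices are (left, top, right, bottom).                                   *)
Definition gamma_ok (v : spin * spin * spin * spin) : bool :=
  [|| v == (None, None, None, None),
      [exists c, exists c', color_gt c c' &&
         (v \in [:: (Some c', Some c, Some c, Some c');
                    (Some c, Some c', Some c, Some c')])]
    | [exists d,
         v \in [:: (Some d, Some d, Some d, Some d);
                   (Some d, None, Some d, None);
                   (None, Some d, Some d, None);
                   (Some d, None, None, Some d)]]].

Definition delta_ok (v : spin * spin * spin * spin) : bool :=
  [|| v == (None, None, None, None),
      [exists c, exists c', color_gt c c' &&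
         (v \in [:: (Some c', Some c', Some c, Some c);
                    (Some c', Some c, Some c', Some c)])]
    | [exists d,
         v \in [:: (Some d, Some d, Some d, Some d);
                   (Some d, None, Some d, None);
                   (Some d, Some d, None, None);
                   (None, None, Some d, Some d)]]].

(* U-turns are (top, bottom).                                                 *)
Definition uturn_ok (v : spin * spin) : bool :=
  (v == (None, None)) ||
  [exists k : 'I_n, v \in [:: (Some (k, false), Some (k, true));
                              (Some (k, true), Some (k, true))]].

(* Row 2i - 1 (Gamma) and row 2i (Delta) of the grid are both indexed by i.   *)
(* The four components are the spins of                                       *)
(* - the vertical edges above the Gamma row i (for i = n: the bottom edges);  *)
(* - the vertical edges between the Gamma row i and the Delta row i;          *)
(* - the horizontal edges of the Gamma row i;                                 *)
(* - the horizontal edges of the Delta row i.                                 *)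
(* Columns are numbered from right to left, so the vertex in column c lies    *)
(* between the horizontal edges c + 1 (left) and c (right).                   *)
Definition state : finType :=
  ({ffun 'I_n.+1 * 'I_m -> spin} * {ffun 'I_n * 'I_m -> spin} *
   {ffun 'I_n * 'I_m.+1 -> spin} * {ffun 'I_n * 'I_m.+1 -> spin})%type.

Definition vabove (s : state) (i : 'I_n.+1) (c : 'I_m) : spin := s.1.1.1 (i, c).
Definition vbetween (s : state) (i : 'I_n) (c : 'I_m) : spin := s.1.1.2 (i, c).
Definition hgamma (s : state) (i : 'I_n) (c : 'I_m.+1) : spin := s.1.2 (i, c).
Definition hdelta (s : state) (i : 'I_n) (c : 'I_m.+1) : spin := s.2 (i, c).

Definition here k (i : 'I_k) : 'I_k.+1 := widen_ord (leqnSn k) i.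
Definition next k (i : 'I_k) : 'I_k.+1 := lift ord0 i.

Definition local_ok (s : state) : bool :=
  [forall i : 'I_n,
     [&& [forall c : 'I_m,
            gamma_ok (hgamma s i (next c), vabove s (here i) c,
                      hgamma s i (here c), vbetween s i c)],
         [forall c : 'I_m,
            delta_ok (hdelta s i (next c), vbetween s i c,
                      hdelta s i (here c), vabove s (next i) c)]
       & uturn_ok (hgamma s i ord0, hdelta s i ord0)]].

Definition boundary_ok (lam : n.-tuple nat) (w : {perm letter n}) (s : state) :
    bool :=
  [&& [forall c, vabove s ord_max c == None],
      [forall i, hgamma s i ord_max == None],
      [forall i, hdelta s i ord_max == Some (bar ((w^-1)%g (i, false)))],
      [forall i : 'I_n, forall c : 'I_m,
         (c == tnth lam i + (n - i.+1) :> nat)%N ==>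
         (vabove s ord0 c == Some (i, false))]
    & [forall c : 'I_m,
         [forall i : 'I_n, (c != tnth lam i + (n - i.+1) :> nat)%N] ==>
         (vabove s ord0 c == None)]].

Definition admissible (lam : n.-tuple nat) (w : {perm letter n}) (s : state) :
    bool :=
  local_ok s && boundary_ok lam w s.

Definition same_vertical_edges (lam : n.-tuple nat)
    (U : {ffun cell lam -> letter n}) (s : state) : bool :=
  [forall i : 'I_n, forall c : 'I_m,
     ((vabove s (here i) c != None) == cols_above U i c) &&
     ((vbetween s i c != None) == cols_between U i c)].

End Lattice.

Section Key.

Variables (n : nat) (lam : n.-tuple nat) (m : nat).

Definition is_key (T : filling lam) (w : {perm letter n}) : bool :=
  (w \in W n) &&
  [exists s : state n m,
     admissible lam w s && same_vertical_edges (fill_infty T) s].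

(* The default value 1 is irrelevant when exactly one w satisfies [is_key T]. *)
Definition key (T : filling lam) : {perm letter n} :=
  odflt 1%g [pick w | is_key T w].

Definition right_key_map (X : cartan_type)
    (k : filling lam -> {perm letter n}) : Prop :=
  let fiber w := [set T in tableaux lam X | k T == w] in
  [/\ tableaux lam X = \bigcup_(w in W n) fiber w,
      {in W n &, forall w w', w != w' -> [disjoint fiber w & fiber w']}
    & forall w, w \in W n -> forall s, reduced_word w s ->
        atom X lam s = \sum_(T in fiber w) zwt T].

End Key.

(* Main.v *)
From HB Require Import structures.
From mathcomp Require Import all_boot all_order all_algebra all_fingroup.
From mathcomp Require Import generic_quotient fraction mpoly.
From mathcomp Require Import ring zify.
Require Import Defs.

(** Each state of the lattice model is the same thing as a reverse King tableau
    of the same weight, and the weighted number of states satisfies the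
    recursion that defines Demazure atoms.

    Weights. In the [i]-th pair of rows, a Gamma vertex [(d, 0, d, 0)] has
    weight [z_i], a Delta vertex whose right spin is empty has weight
    [z_i^-1], and an empty U-turn has weight [1 + c z_i], where [c = 0] in type
    C and [c = 1] in type B; everything else has weight 1. Spins are replaced
    by numbers, 0 for the empty spin and larger numbers for larger colors, so
    that a vertex sorts two numbers and the U-turn is [a |-> min (a, 2n + 1 - a)].
    The weights of all states with exits [x_1, ..., x_n] at the left ends of
    the Delta rows add up to an entry of a product of matrices
    [M_{x_1}(z_1) ... M_{x_n}(z_n)], indexed by the configurations of the
    vertical edges; for [x_i = bar (w^-1 i)] call it [Z_w].

    The recursion. Yang-Baxter equations ([yang_baxter_gg], [yang_baxter_dd],
    [yang_baxter_dg]) exchange two Gamma rows, two Delta rows, and a Delta row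
    with a Gamma row below it. Given two pairs of rows, move the second Gamma
    row above the first Delta row, then exchange the Gamma rows and the Delta
    rows. What is left is an identity between the coefficients at the two
    U-turns ([uturn_pair_exchange]), and the result is [double_row_exchange]:
    [M_x(z_1) M_y(z_2) - M_x(z_2) M_y(z_1) = (z_1 / z_2 - 1) M_y(z_1) M_x(z_2)]
    for [x < y]. This says that the operator of [s_i] sends [Z_u] to
    [Z_{s_i u}]. For [s_n] the bottom pair of rows is evaluated in closed form
    ([bottom_double_row]). By the exchange condition the required order of the
    exits holds all along a reduced word ([reduced_cons]), and for the identity
    there is a single state, of weight [z^lambda] ([ground_unique]). Hence
    [Z_w] is the atom ([atom_partition_function]).

    The bijection. Vertices conserve the number of particles, and particle
    counts of consecutive rows of vertical edges interlace; on the side of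
    tableaux the same inequalities say that rows weakly decrease and columns
    strictly decrease ([state_king], [evolvedP]). Once the occupied edges are
    known, a Gamma row can be filled in from left to right and a Delta row from
    right to left, in one way ([state_unique]). Vertices conserve colors and
    U-turns conserve them up to bar, so the exits form a signed permutation
    ([exits_perm]). Finally the exponent of [z_i] is a difference of total
    displacements of the particles, which counts letters [i] and [bar i]
    ([state_weightE]), and a row of the tableau may start with an infinity
    exactly when the corresponding U-turn is empty, whence the factor
    [1 + z_i] in type B ([tableau_weight_sum]). *)

Set Implicit Arguments.
Unset Strict Implicit.
Unset Printing Implicit Defensive.
Import GRing.Theory.
Local Open Scope ring_scope.

(** * Vertex weights and the Yang-Baxter equations *)

Section Vertex.
Variable K : fieldType.
Implicit Types (z w : K) (l t r b : nat).

(** Spins are numbers here: 0 for an empty edge, larger numbers for larger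
    colors. Two colors that meet are sorted; the only choice is left to a color
    that enters horizontally with nothing above it. *)
Definition gamma_wt z l t r b : K :=
  if l == 0%N then ((r == t) && (b == 0%N))%:R
  else if t == 0%N then z * ((r == l) && (b == 0%N))%:R + ((r == 0%N) && (b == l))%:R
  else ((r == maxn l t) && (b == minn l t))%:R.

Definition delta_wt w l t r b : K :=
  if r == 0%N then w * ((l == t) && (b == 0%N))%:R
  else if t == 0%N then ((l == r) && (b == 0%N))%:R + ((l == 0%N) && (b == r))%:R
  else ((l == minn r t) && (b == maxn r t))%:R.

(** The sums of [gamma_wt l t r b * F b] over [b] and, for [gamma_out], of
    [gamma_wt l t r b * F r b] over [r] and [b], in closed form: with these the
    Yang-Baxter equations can be checked by comparing finitely many numbers. *)
Definition gamma_below z l t r (F : nat -> K) : K :=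
  if l == 0%N then (r == t)%:R * F 0%N
  else if t == 0%N then z * (r == l)%:R * F 0%N + (r == 0%N)%:R * F l
  else (r == maxn l t)%:R * F (minn l t).

Definition delta_below w l t r (F : nat -> K) : K :=
  if r == 0%N then w * (l == t)%:R * F 0%N
  else if t == 0%N then (l == r)%:R * F 0%N + (l == 0%N)%:R * F r
  else (l == minn r t)%:R * F (maxn r t).

Definition gamma_out z l t (F : nat -> nat -> K) : K :=
  if l == 0%N then F t 0%N
  else if t == 0%N then z * F l 0%N + F 0%N l
  else F (maxn l t) (minn l t).

Definition delta_out w t r (F : nat -> nat -> K) : K :=
  if r == 0%N then w * F t 0%N
  else if t == 0%N then F r 0%N + F 0%N r
  else F (minn r t) (maxn r t).

(** Entries of the R-matrices. The one for two rows of the same kind sends a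
    pair of horizontal spins [(a, b)] to itself ([_stay]) or to [(b, a)]
    ([_swap]). The one for a Delta row above a Gamma row sends [(a, b)] to
    [(b, a)] if [a != b] ([dg_cross]), and [(a, a)] to any [(c, c)]
    ([dg_turn]). *)
Definition gg_stay z1 z2 a b : K := if (0 < a < b)%N then z2 else z1.
Definition gg_swap z1 z2 a b : K :=
  if (a < b)%N then (if a == 0%N then z1 else 1) * (z1 - z2) else 0.
Definition dd_stay w1 w2 a b : K :=
  if (b < a)%N || (a == b) && (a == 0%N) then w2 else w1.
Definition dd_swap w1 w2 a b : K :=
  if (a != 0%N) && ((b == 0%N) || (a < b)%N) then w1 - w2 else 0.
Definition dg_cross z2 a b : K :=
  if a == 0%N then 1 else if b == 0%N then z2 else (b < a)%:R.
Definition dg_turn w1 z2 a c : K :=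
  if c == 0%N then (if a == 0%N then w1 - z2 else w1) else (a <= c)%:R.

Ltac cmp := repeat (match goal with
  | |- context [?x == ?y :> nat] => case: (ltngtP x y) => ?
  | |- context [leq (S ?x) ?y] => case: (ltngtP x y) => ?
  | |- context [leq ?x ?y] => case: (leqP x y) => ?
  end; try subst; rewrite /= ?mulr0 ?mul0r ?mulr1 ?mul1r ?addr0 ?add0r;
  try (by []); try (exfalso; lia)).

(** Both sides depend only on the relative order of the spins and on which of
    them are empty, and in each case they are polynomials in the parameters. *)
Lemma yang_baxter_gg z1 z2 r1 r2 t s1 s2 b :
  gg_stay z1 z2 r1 r2 * gamma_below z1 r1 t s1 (fun v => gamma_wt z2 r2 v s2 b) +
  gg_swap z1 z2 r1 r2 * gamma_below z1 r2 t s1 (fun v => gamma_wt z2 r1 v s2 b) =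
  gg_stay z1 z2 s1 s2 * gamma_below z2 r1 t s1 (fun v => gamma_wt z1 r2 v s2 b) +
  gg_swap z1 z2 s2 s1 * gamma_below z2 r1 t s2 (fun v => gamma_wt z1 r2 v s1 b).
Proof.
rewrite /gamma_below /gamma_wt /gg_stay /gg_swap.
case: (posnP r1) => H1; case: (posnP r2) => H2; case: (posnP t) => H3; subst => /=;
  cmp; try ring.
all: try ring.
Qed.

Lemma yang_baxter_dd w1 w2 r1 r2 t s1 s2 b :
  dd_stay w1 w2 r1 r2 * delta_below w1 r1 t s1 (fun v => delta_wt w2 r2 v s2 b) +
  dd_swap w1 w2 r1 r2 * delta_below w1 r2 t s1 (fun v => delta_wt w2 r1 v s2 b) =
  dd_stay w1 w2 s1 s2 * delta_below w2 r1 t s1 (fun v => delta_wt w1 r2 v s2 b) +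
  dd_swap w1 w2 s2 s1 * delta_below w2 r1 t s2 (fun v => delta_wt w1 r2 v s1 b).
Proof.
rewrite /delta_below /delta_wt /dd_stay /dd_swap.
(case: (posnP s1) => H1; case: (posnP s2) => H2; case: (posnP t) => H3; subst => /=;
  cmp; try ring).
all: try ring.
Qed.

Lemma yang_baxter_dg w1 z2 r1 r2 t s1 s2 b :
  delta_out w1 t s1 (fun p v => if r1 == r2 then dg_turn w1 z2 r1 p * gamma_wt z2 p v s2 b
     else (p == r2)%:R * dg_cross z2 r1 r2 * gamma_wt z2 r1 v s2 b) =
  gamma_out z2 r1 t (fun p v => if s1 == s2 then dg_turn w1 z2 p s1 * delta_wt w1 r2 v p b
     else (p == s2)%:R * dg_cross z2 s2 s1 * delta_wt w1 r2 v s1 b).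
Proof.
rewrite /delta_out /gamma_out /delta_wt /gamma_wt /dg_cross /dg_turn.
(case: (posnP r1) => H1; case: (posnP s1) => H2; case: (posnP t) => H3; subst => /=;
  cmp; try ring).
all: try ring.
Qed.

(** The U-turn on codes: a color and its bar have codes [a] and [N + 1 - a],
    the smaller one belonging to the bar. *)
Definition fold_code N a := minn a (N.+1 - a).
Definition uturn_wt (e : K) g : K := if g == 0%N then e else 1.

(** The coefficient acquired by two pairs of rows when the second Gamma row is
    moved above the first Delta row, as a function of the spins at the right
    ends of the Gamma rows ([g], [p]) and of the Delta rows ([q], [d]). *)
Definition uturn_pair N c z1 z2 g p q d : K :=
  if p == q then (fold_code N g == d)%:R * (uturn_wt (1 + c * z1) g * uturn_wt (1 + c * z2) g) * dg_turn z1^-1 z2 p (fold_code N g)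
  else (fold_code N p == d)%:R * (q == fold_code N g)%:R * (uturn_wt (1 + c * z1) g * uturn_wt (1 + c * z2) p) * dg_cross z2 p q.

Lemma fold_codeP N a : (a <= N)%N ->
  (fold_code N a = a /\ (a <= N.+1 - a)%N) \/ ((fold_code N a = N.+1 - a) /\ (N.+1 - a < a))%N.
Proof. rewrite /fold_code; lia. Qed.

Lemma fold_code0 N : fold_code N 0 = 0%N. Proof. by rewrite /fold_code min0n. Qed.

(** What remains of the exchange of two pairs of rows once the Gamma rows and
    the Delta rows have been exchanged among themselves concerns the right ends
    only. *)
Lemma uturn_pair_exchange N c z1 z2 g p q d :
  z1 != 0 -> z2 != 0 -> (g <= N)%N -> (p <= N)%N ->
  let w1 := z1^-1 in let w2 := z2^-1 in
  gg_stay z1 z2 g p * (dd_stay w1 w2 q d * uturn_pair N c z1 z2 g p q d +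
                   dd_swap w1 w2 q d * uturn_pair N c z1 z2 g p d q) +
  gg_swap z1 z2 g p * (dd_stay w1 w2 q d * uturn_pair N c z1 z2 p g q d +
                   dd_swap w1 w2 q d * uturn_pair N c z1 z2 p g d q) =
  uturn_pair N c z2 z1 g p q d.
Proof.
move=> Z1 Z2 Hg Hp w1 w2; have f0 := fold_code0 N.
rewrite /uturn_pair /dg_cross /dg_turn /gg_stay /gg_swap /dd_stay /dd_swap /uturn_wt.
case: (posnP g) => H1; case: (posnP p) => H2; subst => /=;
case: (fold_codeP Hg) => [[eg Hg']|[eg Hg']]; case: (fold_codeP Hp) => [[ep Hp']|[ep Hp']];
rewrite ?fold_code0 ?eg ?ep; clear eg ep; try (exfalso; lia); cmp.
all: rewrite /w1 /w2; try ring.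
all: by field; rewrite ?Z1 ?Z2.
Qed.
End Vertex.

(** * Row partition functions as products of matrices *)

Section PathSums.
Variables (K : fieldType).

HB.instance Definition _ (k : nat) := Monoid.isLaw.Build 'M[K]_k 1%:M
  (@mulmx K k k k) (@mulmxA K k k k k) (@mul1mx K k k) (@mulmx1 K k k).

Section Kernel.
Variable T : finType.
Definition kernel_mx (F : T -> T -> K) : 'M[K]_#|T| :=
  \matrix_(i, j) F (enum_val i) (enum_val j).
Definition entry (M : 'M[K]_#|T|) (a b : T) : K := M (enum_rank a) (enum_rank b).

Lemma entry_kernel F a b : entry (kernel_mx F) a b = F a b.
Proof. by rewrite /entry mxE !enum_rankK. Qed.

Lemma entry_inj M N : (forall a b, entry M a b = entry N a b) -> M = N.
Proof.
move=> e; apply/matrixP=> i j.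
by rewrite -(enum_valK i) -(enum_valK j); apply: e.
Qed.

Lemma entry_mul M N a b : entry (M *m N) a b = \sum_x entry M a x * entry N x b.
Proof.
rewrite /entry mxE (reindex_onto (@enum_rank T) (@enum_val T predT)) /=; last first.
  by move=> i _; rewrite enum_valK.
by apply: eq_big => [x|x _ //]; rewrite enum_rankK eqxx.
Qed.

Lemma entry_sumZ (I : finType) (c : I -> K) (M : I -> 'M[K]_#|T|) a b :
  entry (\sum_i c i *: M i) a b = \sum_i c i * entry (M i) a b.
Proof. by rewrite /entry summxE; apply: eq_bigr => i _; rewrite mxE. Qed.

Lemma entry1 a b : entry 1%:M a b = (a == b)%:R.
Proof. by rewrite /entry mxE (inj_eq enum_rank_inj). Qed.

Definition path_sum n (F : 'I_n -> T -> T -> K) (a b : T) : K :=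
  \sum_(p : {ffun 'I_n.+1 -> T} | (p ord0 == a) && (p ord_max == b))
    \prod_i F i (p (here i)) (p (next i)).

(** The transfer matrix method. *)
Lemma path_sumE n (F : 'I_n -> T -> T -> K) a b :
  path_sum F a b = entry (\big[mulmx/1%:M]_(i < n) kernel_mx (F i)) a b.
Proof.
elim: n F a b => [|n IH] F a b.
  rewrite big_ord0 entry1 /path_sum.
  have -> : ord_max = ord0 :> 'I_1 by apply/val_inj.
  case: eqP => [<-|ne].
    rewrite (big_pred1 [ffun=> a]) ?big_ord0 // => p /=.
    rewrite andbb; apply/eqP/eqP => [<-|->]; last by rewrite ffunE.
    by apply/ffunP=> i; rewrite ffunE (ord1 i).
  by rewrite big1 // => p /andP [/eqP e1 /eqP e2]; case: ne; rewrite -e1 -e2.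
rewrite big_ord_recl entry_mul.
under eq_bigr do rewrite entry_kernel -IH /path_sum big_distrr /=.
pose glue (q : {ffun 'I_n.+1 -> T}) : {ffun 'I_n.+2 -> T} :=
  [ffun i => oapp q a (unlift ord0 i)].
pose tl (p : {ffun 'I_n.+2 -> T}) : {ffun 'I_n.+1 -> T} :=
  [ffun i => p (lift ord0 i)].
have tlK q : tl (glue q) = q.
  by apply/ffunP=> i; rewrite !ffunE liftK.
have nextE (k : nat) (i : 'I_k) : next i = lift ord0 i by [].
have maxE k : ord_max = lift ord0 (ord_max : 'I_k.+1) :> 'I_k.+2 by apply/val_inj.
rewrite (exchange_big_dep (fun q : {ffun 'I_n.+1 -> T} => q ord_max == b)) /=; last first.
  by move=> x q _ /andP [].
rewrite /path_sum (reindex_onto glue tl) /=; last first.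
  move=> p /andP [/eqP p0 _]; apply/ffunP=> i; rewrite !ffunE.
  by case: unliftP => [j ->|->] /=; rewrite ?ffunE ?p0.
apply: eq_big => [q|q].
  rewrite tlK eqxx andbT maxE !ffunE unlift_none liftK /= eqxx.
  by congr (_ == _).
case/andP=> /andP [_ qb] _.
have {}qb : q ord_max == b by move: qb; rewrite maxE !ffunE liftK.
rewrite (big_pred1 (q ord0)) => [|x /=]; last first.
  by rewrite qb andbT eq_sym.
rewrite big_ord_recl; congr (_ * _).
  rewrite !ffunE /= (_ : here ord0 = ord0) ?unlift_none /=; last exact/val_inj.
  by rewrite nextE liftK.
apply: eq_bigr => i _; rewrite !ffunE nextE !liftK /=.
have -> : here (lift ord0 i) = lift ord0 (here i) by apply/val_inj.
by rewrite liftK.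
Qed.
End Kernel.

Section Rows.
Variables (S : finType) (m : nat).
Definition config : finType := {ffun 'I_m -> S}.
Implicit Types (k : S -> S -> S -> S -> K) (l r : S) (al be : config).

(** Columns are numbered from the right, so the path of horizontal spins starts
    with the right end [r]. *)
Definition row_kernel k l r al be : K :=
  path_sum (fun c x y => k y (al c) x (be c)) r l.
Definition row_transfer k l r : 'M[K]_#|config| := kernel_mx (row_kernel k l r).

Definition column_wt k1 k2 (rho : S * S) t (sig : S * S) b : K :=
  \sum_v k1 rho.1 t sig.1 v * k2 rho.2 v sig.2 b.

(** Two rows are one row whose horizontal spins are pairs, the vertical spins
    between the rows being summed column by column. *)
Lemma two_rows k1 k2 (rho sig : S * S) al be :
  entry (row_transfer k1 rho.1 sig.1 *m row_transfer k2 rho.2 sig.2) al be =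
  path_sum (fun c x y => column_wt k1 k2 y (al c) x (be c)) sig rho.
Proof.
rewrite entry_mul; under eq_bigr do rewrite !entry_kernel /row_kernel /path_sum big_distrlr /=.
rewrite /path_sum /column_wt.
under [RHS]eq_bigr do rewrite bigA_distr_bigA /=.
pose pr (p : {ffun 'I_m.+1 -> S} * {ffun 'I_m.+1 -> S}) : {ffun 'I_m.+1 -> S * S} :=
  [ffun i => (p.1 i, p.2 i)].
pose unpr (p : {ffun 'I_m.+1 -> S * S}) : {ffun 'I_m.+1 -> S} * {ffun 'I_m.+1 -> S} :=
  ([ffun i => (p i).1], [ffun i => (p i).2]).
have prK p : unpr (pr p) = p.
  case: p => p q; rewrite /unpr /=.
  have -> : [ffun i => (pr (p, q) i).1] = p by apply/ffunP=> i; rewrite !ffunE.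
  by have -> : [ffun i => (pr (p, q) i).2] = q by apply/ffunP=> i; rewrite !ffunE.
rewrite [RHS]exchange_big /=; apply: eq_bigr => ga _.
rewrite pair_big_dep /= [RHS](reindex_onto pr unpr) /=; last first.
  by move=> p _; apply/ffunP=> i; rewrite !ffunE; case: (p i).
apply: eq_big => [[p q]|[p q] _] /=.
  rewrite prK eqxx andbT !ffunE /=.
  case: rho sig => [a b] [a' b'] /=; rewrite !xpair_eqE.
  by rewrite andbACA.
by rewrite -big_split /=; apply: eq_bigr => i _; rewrite !ffunE.
Qed.

(** The train argument: what can be slid through a column can be slid through
    a row. *)
Lemma row_exchange k1 k2 k1' k2' (R : S * S -> S * S -> K) :
  (forall rho t sig b,
    \sum_rho' R rho rho' * column_wt k1 k2 rho' t sig b =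
    \sum_sig' R sig' sig * column_wt k1' k2' rho t sig' b) ->
  forall rho sig,
    \sum_rho' R rho rho' *: (row_transfer k1 rho'.1 sig.1 *m row_transfer k2 rho'.2 sig.2) =
    \sum_sig' R sig' sig *: (row_transfer k1' rho.1 sig'.1 *m row_transfer k2' rho.2 sig'.2).
Proof.
move=> YB rho sig; apply: entry_inj => al be.
rewrite !entry_sumZ.
under eq_bigr => x _ do rewrite (two_rows k1 k2 x sig al be) path_sumE.
under [RHS]eq_bigr => x _ do rewrite (two_rows k1' k2' rho x al be) path_sumE.
set C := fun c => kernel_mx (fun x y => column_wt k1 k2 y (al c) x (be c)).
set C' := fun c => kernel_mx (fun x y => column_wt k1' k2' y (al c) x (be c)).
pose X := kernel_mx (fun x y => R y x).
have com : \big[mulmx/1%:M]_(c < m) C c *m X = X *m \big[mulmx/1%:M]_(c < m) C' c.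
  elim/big_rec2: _ => [|c M N _ e]; first by rewrite mul1mx mulmx1.
  rewrite -mulmxA e !mulmxA; congr (_ *m _).
  apply: entry_inj => s r; rewrite !entry_mul.
  under eq_bigr do rewrite !entry_kernel mulrC.
  under [RHS]eq_bigr do rewrite !entry_kernel.
  exact: YB.
have e := congr1 (fun M => entry M sig rho) com; rewrite !entry_mul in e.
transitivity (\sum_x entry (\big[mulmx/1%:M]_(c < m) C c) sig x * entry X x rho).
  by apply: eq_bigr => x _; rewrite entry_kernel mulrC.
by rewrite e; apply: eq_bigr => x _; rewrite entry_kernel.
Qed.
End Rows.
End PathSums.

(** * Exchange of two double rows *)

(** The spins are the elements of [S], with codes [cd]; [o] is the empty spin
    and [f] is the U-turn. *)
Section DoubleRows.
Variables (K : fieldType) (S : finType) (m N : nat).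
Variables (cd : S -> nat) (o : S) (f : S -> S).
Hypothesis cd_inj : injective cd.
Hypothesis cd0 : cd o = 0%N.
Hypothesis cd_le : forall a, (cd a <= N)%N.
Hypothesis cdf : forall a, cd (f a) = fold_code N (cd a).
Implicit Types (l t r b a x y : S).

Definition gamma_spin_wt z l t r b : K := gamma_wt z (cd l) (cd t) (cd r) (cd b).
Definition delta_spin_wt w l t r b : K := delta_wt w (cd l) (cd t) (cd r) (cd b).

Lemma cd_eq0 a : (cd a == 0%N) = (a == o).
Proof. by rewrite -cd0 (inj_eq cd_inj). Qed.
Lemma cd_eq a b : (cd a == cd b) = (a == b).
Proof. exact: inj_eq. Qed.

Definition smin a b := if (cd a <= cd b)%N then a else b.
Definition smax a b := if (cd a <= cd b)%N then b else a.
Lemma cd_min a b : cd (smin a b) = minn (cd a) (cd b).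
Proof. by rewrite /smin; case: leqP. Qed.
Lemma cd_max a b : cd (smax a b) = maxn (cd a) (cd b).
Proof. by rewrite /smax; case: leqP. Qed.

Lemma sum_at a (F : S -> K) : \sum_v (cd v == cd a)%:R * F v = F a.
Proof.
rewrite (bigD1 a) //= eqxx mul1r big1 ?addr0 // => v /negPf va.
by rewrite cd_eq va mul0r.
Qed.

Lemma sum_at0 (F : S -> K) : \sum_v (cd v == 0%N)%:R * F v = F o.
Proof. by rewrite -[RHS]sum_at cd0. Qed.

Lemma natr_andb (b1 b2 : bool) : (b1 && b2)%:R = b1%:R * b2%:R :> K.
Proof. by case: b1; rewrite ?mul1r ?mul0r. Qed.

Lemma gamma_belowE z l t r (F : nat -> K) :
  \sum_v gamma_spin_wt z l t r v * F (cd v) = gamma_below z (cd l) (cd t) (cd r) F.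
Proof.
rewrite /gamma_spin_wt /gamma_wt /gamma_below.
case: ifP => _.
  under eq_bigr do rewrite natr_andb -mulrA.
  by rewrite -big_distrr /= sum_at0 cd0.
case: ifP => _.
  under eq_bigr do rewrite !natr_andb mulrDl -!mulrA.
  by rewrite big_split /= -!big_distrr /= sum_at0 sum_at cd0 !mulrA.
under eq_bigr do rewrite natr_andb -mulrA.
by rewrite -big_distrr /= -cd_min sum_at.
Qed.

Lemma delta_belowE w l t r (F : nat -> K) :
  \sum_v delta_spin_wt w l t r v * F (cd v) = delta_below w (cd l) (cd t) (cd r) F.
Proof.
rewrite /delta_spin_wt /delta_wt /delta_below.
case: ifP => _.
  under eq_bigr do rewrite natr_andb -!mulrA.
  by rewrite -!big_distrr /= sum_at0 cd0 !mulrA.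
case: ifP => _.
  under eq_bigr do rewrite !natr_andb mulrDl -!mulrA.
  by rewrite big_split /= -!big_distrr /= sum_at0 sum_at cd0.
under eq_bigr do rewrite natr_andb -mulrA.
by rewrite -big_distrr /= -cd_max sum_at.
Qed.

Lemma gamma_outE z l t (F : nat -> nat -> K) :
  \sum_r \sum_v gamma_spin_wt z l t r v * F (cd r) (cd v) = gamma_out z (cd l) (cd t) F.
Proof.
under eq_bigr => r _ do rewrite (gamma_belowE z l t r (F (cd r))).
rewrite /gamma_below /gamma_out; case: ifP => _; first by rewrite sum_at.
case: ifP => _; last by rewrite -cd_max sum_at.
under eq_bigr do rewrite -mulrA.
by rewrite big_split /= -big_distrr /= sum_at0 sum_at cd0.
Qed.

Lemma delta_outE w t r (F : nat -> nat -> K) :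
  \sum_l \sum_v delta_spin_wt w l t r v * F (cd l) (cd v) = delta_out w (cd t) (cd r) F.
Proof.
under eq_bigr => l _ do rewrite (delta_belowE w l t r (F (cd l))).
rewrite /delta_below /delta_out; case: ifP => _.
  by under eq_bigr do rewrite -mulrA; rewrite -big_distrr /= sum_at.
case: ifP => _; last by rewrite -cd_min sum_at.
by rewrite big_split /= sum_at sum_at0 cd0.
Qed.

(** The R-matrix of two rows of the same kind. *)
Definition swapR (p q : nat -> nat -> K) (rho rho' : S * S) : K :=
  (rho' == rho)%:R * p (cd rho.1) (cd rho.2) +
  (rho' == (rho.2, rho.1))%:R * q (cd rho.1) (cd rho.2).

Lemma sum_pair_at (V : lmodType K) (s : S * S) (c : S * S -> K) (F : S * S -> V) :
  \sum_p ((p == s)%:R * c p) *: F p = c s *: F s.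
Proof.
rewrite (bigD1 s) //= eqxx mul1r big1 ?addr0 // => v /negPf ->.
by rewrite mul0r scale0r.
Qed.

Lemma swapR_l (V : lmodType K) p q rho (F : S * S -> V) :
  \sum_rho' swapR p q rho rho' *: F rho' =
  p (cd rho.1) (cd rho.2) *: F rho + q (cd rho.1) (cd rho.2) *: F (rho.2, rho.1).
Proof.
under eq_bigr do rewrite scalerDl; rewrite big_split /=.
by rewrite (sum_pair_at rho (fun=> _)) (sum_pair_at _ (fun=> _)).
Qed.

Lemma swapR_r (V : lmodType K) p q sig (F : S * S -> V) :
  \sum_sig' swapR p q sig' sig *: F sig' =
  p (cd sig.1) (cd sig.2) *: F sig + q (cd sig.2) (cd sig.1) *: F (sig.2, sig.1).
Proof.
rewrite /swapR; under eq_bigr do rewrite scalerDl; rewrite big_split /=.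
rewrite -(sum_pair_at sig (fun s => p (cd s.1) (cd s.2))).
rewrite -(sum_pair_at (sig.2, sig.1) (fun s => q (cd s.1) (cd s.2))).
congr (_ + _); apply: eq_bigr => -[a b] _; congr (_ *: _); congr (_%:R * _).
  by rewrite eq_sym.
by case: sig => c d; rewrite !xpair_eqE (eq_sym c) (eq_sym d) andbC.
Qed.

Lemma swapR_lK p q rho (F : S * S -> K) :
  \sum_rho' swapR p q rho rho' * F rho' =
  p (cd rho.1) (cd rho.2) * F rho + q (cd rho.1) (cd rho.2) * F (rho.2, rho.1).
Proof. exact: (@swapR_l K^o). Qed.

Lemma swapR_rK p q sig (F : S * S -> K) :
  \sum_sig' swapR p q sig' sig * F sig' =
  p (cd sig.1) (cd sig.2) * F sig + q (cd sig.2) (cd sig.1) * F (sig.2, sig.1).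
Proof. exact: (@swapR_r K^o). Qed.

Definition gamma_row z l r : 'M[K]_#|config S m| := row_transfer m (gamma_spin_wt z) l r.
Definition delta_row w l r : 'M[K]_#|config S m| := row_transfer m (delta_spin_wt w) l r.

Lemma column_wt_gg z1 z2 rho t sig b : column_wt (gamma_spin_wt z1) (gamma_spin_wt z2) rho t sig b =
  gamma_below z1 (cd rho.1) (cd t) (cd sig.1) (fun v => gamma_wt z2 (cd rho.2) v (cd sig.2) (cd b)).
Proof. exact: gamma_belowE. Qed.

Lemma column_wt_dd w1 w2 rho t sig b : column_wt (delta_spin_wt w1) (delta_spin_wt w2) rho t sig b =
  delta_below w1 (cd rho.1) (cd t) (cd sig.1) (fun v => delta_wt w2 (cd rho.2) v (cd sig.2) (cd b)).
Proof. exact: delta_belowE. Qed.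

(** Gamma rows are empty at their left ends, where the R-matrix acts by the
    scalar [z1]. *)
Lemma gamma_row_exchange z1 z2 a b :
  z1 *: (gamma_row z1 o a *m gamma_row z2 o b) =
  gg_stay z1 z2 (cd a) (cd b) *: (gamma_row z2 o a *m gamma_row z1 o b) +
  gg_swap z1 z2 (cd b) (cd a) *: (gamma_row z2 o b *m gamma_row z1 o a).
Proof.
have := @row_exchange K S m (gamma_spin_wt z1) (gamma_spin_wt z2) (gamma_spin_wt z2) (gamma_spin_wt z1)
  (swapR (gg_stay z1 z2) (gg_swap z1 z2)) _ (o, o) (a, b).
rewrite swapR_l swapR_r /= cd0 {1}/gg_stay /= {1}/gg_swap /= scale0r addr0; apply.
move=> rho t sig c; rewrite swapR_lK swapR_rK !column_wt_gg; apply: yang_baxter_gg.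
Qed.

Lemma delta_row_exchange w1 w2 x y a b :
  dd_stay w1 w2 (cd x) (cd y) *: (delta_row w1 x a *m delta_row w2 y b) +
  dd_swap w1 w2 (cd x) (cd y) *: (delta_row w1 y a *m delta_row w2 x b) =
  dd_stay w1 w2 (cd a) (cd b) *: (delta_row w2 x a *m delta_row w1 y b) +
  dd_swap w1 w2 (cd b) (cd a) *: (delta_row w2 x b *m delta_row w1 y a).
Proof.
have := @row_exchange K S m (delta_spin_wt w1) (delta_spin_wt w2) (delta_spin_wt w2) (delta_spin_wt w1)
  (swapR (dd_stay w1 w2) (dd_swap w1 w2)) _ (x, y) (a, b).
rewrite swapR_l swapR_r /=; apply.
move=> rho t sig c; rewrite swapR_lK swapR_rK !column_wt_dd; apply: yang_baxter_dd.
Qed.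

(** The R-matrix of a Delta row and a Gamma row below it. *)
Definition crossR w1 z2 (rho rho' : S * S) : K :=
  if rho.1 == rho.2 then (rho'.1 == rho'.2)%:R * dg_turn w1 z2 (cd rho.1) (cd rho'.1)
  else (rho' == (rho.2, rho.1))%:R * dg_cross z2 (cd rho.1) (cd rho.2).

Lemma crossR_l (V : lmodType K) w1 z2 rho (F : S * S -> V) :
  \sum_rho' crossR w1 z2 rho rho' *: F rho' =
  if rho.1 == rho.2 then \sum_c dg_turn w1 z2 (cd rho.1) (cd c) *: F (c, c)
  else dg_cross z2 (cd rho.1) (cd rho.2) *: F (rho.2, rho.1).
Proof.
rewrite /crossR; case: ifP => _; last by rewrite (sum_pair_at _ (fun=> _)).
transitivity (\sum_a \sum_b ((a == b)%:R * dg_turn w1 z2 (cd rho.1) (cd a)) *: F (a, b)).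
  by rewrite pair_bigA; apply: eq_bigr => -[].
apply: eq_bigr => a _; rewrite (bigD1 a) //= eqxx mul1r big1 ?addr0 // => b.
by rewrite eq_sym => /negPf ->; rewrite mul0r scale0r.
Qed.

Lemma crossR_r (V : lmodType K) w1 z2 sig (F : S * S -> V) :
  \sum_sig' crossR w1 z2 sig' sig *: F sig' =
  if sig.1 == sig.2 then \sum_c dg_turn w1 z2 (cd c) (cd sig.1) *: F (c, c)
  else dg_cross z2 (cd sig.2) (cd sig.1) *: F (sig.2, sig.1).
Proof.
rewrite /crossR.
transitivity (\sum_a \sum_b (if a == b then (sig.1 == sig.2)%:R * dg_turn w1 z2 (cd a) (cd sig.1)
  else (sig == (b, a))%:R * dg_cross z2 (cd a) (cd b)) *: F (a, b)).
  by rewrite pair_bigA; apply: eq_bigr => -[].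
case: sig => s1 s2 /=; case: (altP (s1 =P s2)) => [<-|ne].
  apply: eq_bigr => a _; rewrite (bigD1 a) //= eqxx mul1r big1 ?addr0 // => b ba.
  rewrite eq_sym (negPf ba) xpair_eqE.
  case: (s1 =P b) => [e1|]; case: (s1 =P a) => [e2|] //=; rewrite ?mul0r ?scale0r //.
  by rewrite -e1 -e2 eqxx in ba.
rewrite (bigD1 s2) //= (bigD1 s1) //= eq_sym (negPf ne) eqxx mul1r.
rewrite big1 ?addr0 => [|b bs1]; last first.
  by case: ifP => _; rewrite ?xpair_eqE ?(eq_sym s1) ?(negPf bs1) /= mul0r scale0r.
rewrite big1 ?addr0 // => a as2; rewrite big1 // => b _.
case: ifP => _; rewrite ?mul0r ?scale0r // xpair_eqE (eq_sym s2) (negPf as2) andbF.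
by rewrite mul0r scale0r.
Qed.

(** At the left ends, where the Gamma row is empty and the Delta row is not,
    the only nonzero entry of the R-matrix is 1. *)
Lemma delta_gamma_exchange w1 z2 x a b : x != o ->
  delta_row w1 x a *m gamma_row z2 o b =
  if a == b then \sum_c dg_turn w1 z2 (cd c) (cd a) *: (gamma_row z2 o c *m delta_row w1 x c)
  else dg_cross z2 (cd b) (cd a) *: (gamma_row z2 o b *m delta_row w1 x a).
Proof.
move=> xo.
have := @row_exchange K S m (delta_spin_wt w1) (gamma_spin_wt z2) (gamma_spin_wt z2) (delta_spin_wt w1)
  (crossR w1 z2) _ (o, x) (a, b).
rewrite crossR_l crossR_r /= eq_sym (negPf xo) {1}/dg_cross cd0 /= scale1r; apply.
move=> rho t sig c.
rewrite (@crossR_l K^o) (@crossR_r K^o).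
have := yang_baxter_dg w1 z2 (cd rho.1) (cd rho.2) (cd t) (cd sig.1) (cd sig.2) (cd c).
rewrite -delta_outE -gamma_outE !cd_eq /column_wt => e.
transitivity (\sum_l \sum_v delta_spin_wt w1 l t sig.1 v *
  (if rho.1 == rho.2 then dg_turn w1 z2 (cd rho.1) (cd l) * gamma_wt z2 (cd l) (cd v) (cd sig.2) (cd c)
   else (cd l == cd rho.2)%:R * dg_cross z2 (cd rho.1) (cd rho.2) * gamma_wt z2 (cd rho.1) (cd v) (cd sig.2) (cd c))).
  case: ifP => _ /=.
    apply: eq_bigr => l _; rewrite [LHS]big_distrr /=; apply: eq_bigr => v _.
    by rewrite mulrCA.
  rewrite [RHS](bigD1 rho.2) //= [X in _ = _ + X]big1 ?addr0 => [|l /negPf ne]; last first.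
    by rewrite big1 // => v _; rewrite cd_eq ne !(mul0r, mulr0).
  rewrite [LHS]big_distrr /=; apply: eq_bigr => v _.
  by rewrite eqxx mul1r mulrCA.
rewrite e; case: ifP => _ /=.
  apply: eq_bigr => l _; rewrite [RHS]big_distrr /=; apply: eq_bigr => v _.
  by rewrite mulrCA.
rewrite [LHS](bigD1 sig.2) //= [X in _ + X = _]big1 ?addr0 => [|l /negPf ne]; last first.
  by rewrite big1 // => v _; rewrite cd_eq ne !(mul0r, mulr0).
rewrite [RHS]big_distrr /=; apply: eq_bigr => v _.
by rewrite eqxx mul1r mulrCA.
Qed.

Lemma f_eq0 g : (f g == o) = (g == o).
Proof.
rewrite -!cd_eq0 cdf /fold_code; have := cd_le g; case: (cd g) => [|k] h; rewrite ?min0n //.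
by apply/negbTE; lia.
Qed.

Lemma ffE g : f (f g) = f g.
Proof. by apply: cd_inj; rewrite !cdf /fold_code; have := cd_le g; lia. Qed.

Definition double_row c z x : 'M[K]_#|config S m| :=
  \sum_g uturn_wt (1 + c * z) (cd g) *: (gamma_row z o g *m delta_row z^-1 x (f g)).

Lemma sum_if_eq (V : nmodType) (a : S) (A : V) (B : S -> V) :
  \sum_g (if a == g then A else B g) = A + \sum_(g | g != a) B g.
Proof.
rewrite (bigD1 a) //= eqxx; congr (_ + _).
by apply: eq_bigr => g; rewrite eq_sym => /negPf ->.
Qed.

(** Moving the second Gamma row above the first Delta row. *)
Lemma double_row_mulE c z1 z2 x y : x != o ->
  double_row c z1 x *m double_row c z2 y = \sum_g \sum_p \sum_q \sum_d
    uturn_pair N c z1 z2 (cd g) (cd p) (cd q) (cd d) *: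
      ((gamma_row z1 o g *m gamma_row z2 o p) *m (delta_row z1^-1 x q *m delta_row z2^-1 y d)).
Proof.
move=> xo; rewrite /double_row mulmx_suml; apply: eq_bigr => g _.
rewrite mulmx_sumr.
pose e1 := uturn_wt (1 + c * z1) (cd g).
pose A p := (e1 * uturn_wt (1 + c * z2) (cd g) * dg_turn z1^-1 z2 (cd p) (cd (f g))) *:
  ((gamma_row z1 o g *m gamma_row z2 o p) *m (delta_row z1^-1 x p *m delta_row z2^-1 y (f g))).
pose B p := (e1 * uturn_wt (1 + c * z2) (cd p) * dg_cross z2 (cd p) (cd (f g))) *:
  ((gamma_row z1 o g *m gamma_row z2 o p) *m (delta_row z1^-1 x (f g) *m delta_row z2^-1 y (f p))).
transitivity (\sum_p A p + \sum_(p | p != f g) B p).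
  rewrite -sum_if_eq; apply: eq_bigr => p _.
  rewrite -scalemxAl -scalemxAr scalerA mulmxA -[_ *m _ *m gamma_row _ _ _]mulmxA delta_gamma_exchange //.
  case: (f g =P p) => [<-|_].
    rewrite ffE mulmx_sumr mulmx_suml scaler_sumr; apply: eq_bigr => q _.
    rewrite -scalemxAr -scalemxAl scalerA /A !mulmxA; congr (_ * _ * _ *: _).
    by rewrite /uturn_wt !cd_eq0 f_eq0.
  by rewrite -scalemxAr -scalemxAl scalerA /B !mulmxA.
rewrite [X in _ + X]big_mkcond -big_split; apply: eq_bigr => p _ /=.
rewrite (bigD1 p) //=; congr (_ + _).
  rewrite /uturn_pair eqxx (bigD1 (f g)) //= cdf eqxx mul1r big1 ?addr0 => [|d dg].
    by rewrite /A cdf.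
  by rewrite -cdf cd_eq eq_sym (negPf dg) !mul0r scale0r.
case: ifPn => [pfg|/negPn /eqP e].
  rewrite (bigD1 (f g)) 1?eq_sym //= [X in _ = _ + X]big1 ?addr0 => [|q /andP [qp qg]].
    rewrite (bigD1 (f p)) //= [X in _ = _ + X]big1 ?addr0 => [|d dp].
      by rewrite /uturn_pair cd_eq (negPf pfg) -!cdf !eqxx !mul1r.
    by rewrite /uturn_pair cd_eq (negPf pfg) -!cdf !cd_eq (eq_sym (f p)) (negPf dp) !mul0r scale0r.
  rewrite big1 // => d _.
  by rewrite /uturn_pair cd_eq (eq_sym p) (negPf qp) -!cdf !cd_eq (negPf qg) mulr0 !mul0r scale0r.
rewrite big1 // => q qp; rewrite big1 // => d _.
by rewrite /uturn_pair cd_eq (eq_sym p) (negPf qp) -!cdf !cd_eq -e (negPf qp) mulr0 !mul0r scale0r.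
Qed.

(** Transposition of an R-matrix: its action on vectors [X] becomes an action
    on their coefficients [F]. *)
Lemma swap_sum (V : lmodType K) (pp qq : nat -> nat -> K) (F : S -> S -> K) (X : S -> S -> V) :
  \sum_a \sum_b F a b *: (pp (cd a) (cd b) *: X a b + qq (cd b) (cd a) *: X b a) =
  \sum_a \sum_b (pp (cd a) (cd b) * F a b + qq (cd a) (cd b) * F b a) *: X a b.
Proof.
transitivity (\sum_a \sum_b (pp (cd a) (cd b) * F a b) *: X a b +
              \sum_a \sum_b (qq (cd b) (cd a) * F a b) *: X b a).
  rewrite -big_split; apply: eq_bigr => a _; rewrite -big_split; apply: eq_bigr => b _ /=.
  by rewrite scalerDr !scalerA mulrC (mulrC (F a b)).
rewrite [X in _ + X]exchange_big -big_split; apply: eq_bigr => a _.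
by rewrite -big_split; apply: eq_bigr => b _ /=; rewrite scalerDl.
Qed.

(** The Gamma rows contribute the scalar [z1]; the Delta rows, whose left ends
    carry two distinct colors, contribute both orders of [x] and [y], whence the
    two terms with parameters [z1], [z2] in this order. *)
Theorem double_row_exchange c z1 z2 x y : z1 != 0 -> z2 != 0 ->
  x != o -> (cd x < cd y)%N ->
  double_row c z1 x *m double_row c z2 y - double_row c z2 x *m double_row c z1 y =
  (z1 / z2 - 1) *: (double_row c z1 y *m double_row c z2 x).
Proof.
move=> Z1 Z2 xo xy.
have yo : y != o by rewrite -cd_eq0; lia.
have x0 : (0 < cd x)%N by rewrite lt0n cd_eq0.
pose w1 := z1^-1; pose w2 := z2^-1.
suff e : z1 *: (w1 *: (double_row c z1 x *m double_row c z2 y) + (w1 - w2) *: (double_row c z1 y *m double_row c z2 x)) =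
         double_row c z2 x *m double_row c z1 y.
  rewrite -e scalerDr !scalerA /w1 divff // scale1r opprD addrA subrr sub0r -scaleNr.
  by congr (_ *: _); rewrite /w2; field; rewrite Z1 Z2.
rewrite !double_row_mulE //.
pose X a b := gamma_row z2 o a *m gamma_row z1 o b; pose Y a b := delta_row w2 x a *m delta_row w1 y b.
pose F g p q d := uturn_pair N c z1 z2 (cd g) (cd p) (cd q) (cd d).
transitivity (\sum_g \sum_p \sum_q \sum_d
  F g p q d *: ((z1 *: (gamma_row z1 o g *m gamma_row z2 o p)) *m
   (w1 *: (delta_row w1 x q *m delta_row w2 y d) + (w1 - w2) *: (delta_row w1 y q *m delta_row w2 x d)))).
  rewrite !scaler_sumr -big_split scaler_sumr; apply: eq_bigr => g _.
  rewrite !scaler_sumr -big_split scaler_sumr; apply: eq_bigr => p _.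
  rewrite !scaler_sumr -big_split scaler_sumr; apply: eq_bigr => q _.
  rewrite !scaler_sumr -big_split scaler_sumr; apply: eq_bigr => d _ /=.
  rewrite -scalemxAl mulmxDr -!scalemxAr /F.
  by rewrite !scalerDr !scalerA; congr (_ *: _ + _ *: _); ring.
have dx : dd_stay w1 w2 (cd x) (cd y) = w1.
  by rewrite /dd_stay ltnNge (ltnW xy) /= ltn_eqF.
have dq : dd_swap w1 w2 (cd x) (cd y) = w1 - w2.
  by rewrite /dd_swap -lt0n x0 xy orbT.
transitivity (\sum_g \sum_p \sum_q \sum_d F g p q d *:
   ((gg_stay z1 z2 (cd g) (cd p) *: X g p + gg_swap z1 z2 (cd p) (cd g) *: X p g) *m
    (dd_stay w1 w2 (cd q) (cd d) *: Y q d + dd_swap w1 w2 (cd d) (cd q) *: Y d q))).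
  apply: eq_bigr => g _; apply: eq_bigr => p _; apply: eq_bigr => q _; apply: eq_bigr => d _.
  by rewrite -gamma_row_exchange -delta_row_exchange dx dq.
pose H g p q d := dd_stay w1 w2 (cd q) (cd d) * F g p q d + dd_swap w1 w2 (cd q) (cd d) * F g p d q.
transitivity (\sum_q \sum_d \sum_g \sum_p H g p q d *:
   ((gg_stay z1 z2 (cd g) (cd p) *: X g p + gg_swap z1 z2 (cd p) (cd g) *: X p g) *m Y q d)).
  transitivity (\sum_g \sum_p \sum_q \sum_d H g p q d *:
   ((gg_stay z1 z2 (cd g) (cd p) *: X g p + gg_swap z1 z2 (cd p) (cd g) *: X p g) *m Y q d)).
    apply: eq_bigr => g _; apply: eq_bigr => p _.
    set M := _ + _.
    rewrite -(swap_sum (dd_stay w1 w2) (dd_swap w1 w2) (F g p) (fun a b => M *m Y a b)).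
    apply: eq_bigr => q _; apply: eq_bigr => d _.
    by rewrite mulmxDr -!scalemxAr.
  transitivity (\sum_g \sum_q \sum_p \sum_d H g p q d *:
   ((gg_stay z1 z2 (cd g) (cd p) *: X g p + gg_swap z1 z2 (cd p) (cd g) *: X p g) *m Y q d)).
    by apply: eq_bigr => g _; rewrite exchange_big.
  rewrite exchange_big; apply: eq_bigr => q _ /=.
  under eq_bigr => g _ do rewrite exchange_big /=.
  by rewrite exchange_big.
transitivity (\sum_q \sum_d \sum_g \sum_p
   (gg_stay z1 z2 (cd g) (cd p) * H g p q d + gg_swap z1 z2 (cd g) (cd p) * H p g q d) *: (X g p *m Y q d)).
  apply: eq_bigr => q _; apply: eq_bigr => d _.
  rewrite -(swap_sum (gg_stay z1 z2) (gg_swap z1 z2) (fun g p => H g p q d) (fun a b => X a b *m Y q d)).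
  apply: eq_bigr => g _; apply: eq_bigr => p _.
  by rewrite mulmxDl -!scalemxAl.
under eq_bigr => q _ do rewrite exchange_big /=.
rewrite exchange_big /=; apply: eq_bigr => g _.
under eq_bigr => q _ do rewrite exchange_big /=.
rewrite exchange_big /=; apply: eq_bigr => p _.
apply: eq_bigr => q _; apply: eq_bigr => d _.
by congr (_ *: _); rewrite /H /F uturn_pair_exchange.
Qed.
End DoubleRows.

(** * The bottom double row *)

Section LastRow.
Variables (K : fieldType) (S : finType) (m N : nat).
Variables (cd : S -> nat) (o : S) (f : S -> S).
Hypothesis cd_inj : injective cd.
Hypothesis cd0 : cd o = 0%N.
Hypothesis cd_le : forall a, (cd a <= N)%N.
Hypothesis cdf : forall a, cd (f a) = fold_code N (cd a).
Variable c : K.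

(** This is [(1 + c z) (z^k - z^-k) / (z^2 - 1)], see [refl_sumE]. *)
Fixpoint refl_sum (z : K) k : K :=
  if k is k'.+1 then z * refl_sum z k' + z^-1 * (z^-1 ^+ k' * (1 + c * z)) else 0.

(** The weight of the bottom pair of rows when a single particle, of code [a],
    enters it from above, with [k] columns to its right: it either passes the
    U-turn, or drops to the Delta row in one of the [k] columns and exits
    unchanged, leaving the U-turn empty. *)
Definition last_wt z k a x : K :=
  (x == fold_code N a)%:R * z ^+ k + (x == a)%:R * refl_sum z k.

Definition last_step z t (q : nat -> nat -> K) l1 l2 : K :=
  gamma_out z l1 t (fun r v => (l2 == v)%:R * z^-1 * q r 0%N + ((v == 0%N) && (l2 != 0%N))%:R * q r l2).

(** The weights [q a b] of the [k] rightmost columns, with codes [a] and [b] on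
    the left edges. The index [st] records the particles above these columns:
    [Some None] if there is none, [Some (Some (k0, a0))] if there is one, of
    code [a0] and with [k0] columns to its right, and [None] if there are more;
    then nothing contributes, as a single particle can leave. *)
Definition last_inv z (st : option (option (nat * nat))) k (q : nat -> nat -> K) : Prop :=
  match st with
  | None => forall a b, (a <= N)%N -> q a b = 0
  | Some None => forall a b, (a <= N)%N ->
      q a b = if a == 0%N then (if b == 0%N then z^-1 ^+ k * (1 + c * z) else 0)
              else (if b == 0%N then 0 else last_wt z k a b)
  | Some (Some (k0, a0)) => forall a b, (a <= N)%N -> q a b =
      if (a == 0%N) && (b != 0%N) then last_wt z k0 a0 b else 0
  end.

Definition last_next (st : option (option (nat * nat))) k t :=
  if t == 0%N then st else match st with
  | None => None
  | Some None => Some (Some (k, t))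
  | Some (Some _) => None
  end.

Lemma last_stepP z st k t q : (t <= N)%N -> last_inv z st k q ->
  last_inv z (last_next st k t) k.+1 (last_step z t q).
Proof.
rewrite /last_next /last_step /gamma_out => tN.
have mx a : (a <= N)%N -> (maxn a t <= N)%N by rewrite geq_max tN => ->.
case: st => [[[k0 a0]|]|] /= I; case: t tN mx => [|t] tN mx [|a] [|b] aN.
all: rewrite /= ?I.
all: match goal with |- is_true _ => first [by [] | exact: (mx _ aN)] | |- _ => rewrite /= ?exprS end.
all: rewrite ?maxnSS ?minnSS /last_wt /=; try ring.
by rewrite exprS; ring.
Qed.

Lemma last_inner w l v (h : nat -> K) :
  \sum_r delta_spin_wt cd w l v r o * h (cd r) =
  (cd l == cd v)%:R * w * h 0%N + ((cd v == 0%N) && (cd l != 0%N))%:R * h (cd l).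
Proof.
rewrite (bigD1 o) //= {1}/delta_spin_wt {1}/delta_wt cd0 eqxx andbT mulrC [w * _]mulrC mulrC; congr (_ + _).
transitivity (\sum_(r | r != o) ((cd v == 0%N) && (cd l == cd r))%:R * h (cd r)).
  apply: eq_bigr => r; rewrite -(cd_eq0 cd_inj cd0) => ro; rewrite /delta_spin_wt /delta_wt (negPf ro) cd0 andbT.
  case: (cd v =P 0%N) => [_|/eqP v0] /=; first by rewrite (eq_sym 0%N) (negPf ro) andbF addr0.
  by rewrite (_ : _ == maxn _ _ = false) ?andbF //; apply/negbTE; lia.
case: (cd v =P 0%N) => [_|_] /=; last by rewrite mul0r big1 // => r _; rewrite mul0r.
rewrite (cd_eq0 cd_inj cd0); case: (altP (l =P o)) => [->|lo] /=.
  rewrite mul0r big1 // => r ro.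
  by rewrite (inj_eq cd_inj) eq_sym (negPf ro) mul0r.
rewrite (bigD1 l) //= eqxx big1 ?addr0 // => r /andP [_ rl].
by rewrite (inj_eq cd_inj) eq_sym (negPf rl) mul0r.
Qed.

Lemma last_stepE z (q : nat -> nat -> K) t rho :
  \sum_tau q (cd tau.1) (cd tau.2) * column_wt (gamma_spin_wt cd z) (delta_spin_wt cd z^-1) rho t tau o =
  last_step z (cd t) q (cd rho.1) (cd rho.2).
Proof.
rewrite /last_step -(gamma_outE cd_inj cd0).
rewrite -(pair_bigA _ (fun a b => q (cd a) (cd b) * column_wt (gamma_spin_wt cd z) (delta_spin_wt cd z^-1) rho t (a, b) o)) /=.
apply: eq_bigr => a _; rewrite /column_wt /=.
under eq_bigr do rewrite big_distrr /=.
rewrite exchange_big /=; apply: eq_bigr => v _.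
rewrite -(last_inner z^-1 rho.2 v (q (cd a))) big_distrr /=.
by apply: eq_bigr => b _; ring.
Qed.

(** The index [st] does not depend on [z], which makes it possible to compare
    the parameters [z] and [z^-1]. *)
Lemma last_colsP n (t : 'I_n -> S) : exists st k, forall z, exists q,
  last_inv z st k q /\ forall rho,
  \sum_g uturn_wt (1 + c * z) (cd g) *
    entry (\big[mulmx/1%:M]_(i < n) kernel_mx (fun x y => column_wt (gamma_spin_wt cd z) (delta_spin_wt cd z^-1) y (t i) x o))
      (g, f g) rho = q (cd rho.1) (cd rho.2).
Proof.
elim: n t => [|n IH] t.
  exists (Some None), 0%N => z.
  exists (fun a b => (b == fold_code N a)%:R * uturn_wt (1 + c * z) a); split.
    move=> a b aN; rewrite /uturn_wt /last_wt expr0 /=; case: (posnP a) => [->|a0].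
      by rewrite fold_code0; case: (b == 0%N); rewrite ?mul0r ?mul1r.
    case: (b =P 0%N) => [->|_]; last by rewrite expr0 mulr0 addr0.
    by rewrite (_ : _ == _ = false) ?mul0r //; apply/negbTE; rewrite /fold_code; lia.
  move=> [a b] /=; rewrite big_ord0 (bigD1 a) //= entry1 xpair_eqE eqxx /= big1 ?addr0.
    by rewrite mulrC -cdf (inj_eq cd_inj) eq_sym.
  by move=> g /negPf ga; rewrite entry1 xpair_eqE ga mulr0.
have [st [k IHn]] := IH (fun i => t (widen_ord (leqnSn n) i)).
exists (last_next st k (cd (t ord_max))), k.+1 => z.
have [q [Iq Eq]] := IHn z.
exists (last_step z (cd (t ord_max)) q); split; first exact: last_stepP.
move=> rho; rewrite big_ord_recr /=.
rewrite -last_stepE; under [RHS]eq_bigr do rewrite -Eq big_distrl /=.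
rewrite exchange_big /=; apply: eq_bigr => g _.
rewrite entry_mul big_distrr /=; apply: eq_bigr => tau _.
by rewrite entry_kernel mulrA; case: tau.
Qed.

Lemma bottom_double_row (al : config S m) : exists st, forall z x, x != o ->
  entry (double_row m cd o f c z x) al [ffun=> o] =
  if st is Some (k0, a0) then last_wt z k0 a0 (cd x) else 0.
Proof.
have [st [k H]] := last_colsP al.
exists (if st is Some s then s else None) => z x xo.
have [q [Iq Eq]] := H z.
rewrite /double_row entry_sumZ; transitivity (q 0%N (cd x)).
  rewrite -[in RHS]cd0 -(Eq (o, x)); apply: eq_bigr => g _; congr (_ * _).
  rewrite (two_rows _ _ (o, x) (g, f g)) path_sumE; congr entry.
  apply: eq_bigr => i _.
  by apply: entry_inj => x1 x2; rewrite !entry_kernel ffunE.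
have x0 : (cd x == 0%N) = false by rewrite (cd_eq0 cd_inj cd0) (negPf xo).
by case: st Iq {H} => [[[k0 a0]|]|] /= Iq; rewrite (Iq _ _ (leq0n N)) /= ?x0.
Qed.

Lemma refl_sumE z k : z != 0 -> (z ^+ 2 - 1) * refl_sum z k = (1 + c * z) * (z ^+ k - z^-1 ^+ k).
Proof.
move=> z0; elim: k => [|k IH] /=; first by rewrite subrr !mulr0.
rewrite mulrDr mulrCA IH !exprS; field.
exact: z0.
Qed.

(** The code [x] belongs to a barred color and [N.+1 - x] to the same color
    without bar; [D] is the denominator of the operator of [s_n], that is
    [z - 1] for [c = 1] and [z^2 - 1] for [c = 0]. *)
Lemma last_wt_reflect z k a x D : z != 0 -> z ^+ 2 - 1 != 0 -> D * (1 + c * z) = z ^+ 2 - 1 ->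
  (0 < x)%N -> (x.*2 <= N)%N ->
  last_wt z k a x - last_wt z^-1 k a x = D * last_wt z k a (N.+1 - x)%N.
Proof.
move=> z0 z21 HD x0 xN; rewrite /last_wt.
have S1 : refl_sum z k = (1 + c * z) * (z ^+ k - z^-1 ^+ k) / (z ^+ 2 - 1).
  by rewrite -refl_sumE // mulrC mulKf.
have zi21 : z^-1 ^+ 2 - 1 = - (z ^+ 2 - 1) / z ^+ 2 by field.
have S2 : refl_sum z^-1 k = (z ^+ 2 + c * z) * (z ^+ k - z^-1 ^+ k) / (z ^+ 2 - 1).
  apply: (mulfI (_ : z^-1 ^+ 2 - 1 != 0)).
    by rewrite zi21 mulf_neq0 ?oppr_eq0 ?invr_eq0 ?expf_neq0.
  by rewrite refl_sumE ?invr_eq0 // zi21 invrK; field; rewrite z0 z21.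
case: (a =P x) => [->|ax].
  rewrite (_ : fold_code N x = x) ?eqxx; last by rewrite /fold_code; lia.
  rewrite (_ : (N.+1 - x == x)%N = false) ?mul0r; last by apply/negbTE; lia.
  by rewrite !mul1r S1 S2 ?mul0r ?addr0 ?mulr0; field.
rewrite (_ : (x == a) = false) ?mul0r ?addr0; last by apply/negbTE; lia.
case: (a =P N.+1 - x)%N => [->|ax'].
  rewrite (_ : fold_code N _ = x); last by rewrite /fold_code; lia.
  rewrite eqxx (_ : (N.+1 - x == x)%N = false) ?mul0r; last by apply/negbTE; lia.
  rewrite ?eqxx !mul1r ?mul0r ?addr0 ?add0r S1 [RHS]mulrA [D * _]mulrA HD; field.
  exact: z21.
rewrite (_ : (x == fold_code N a) = false); last by apply/negbTE; rewrite /fold_code; lia.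
rewrite (_ : (_ == fold_code N a) = false); last by apply/negbTE; rewrite /fold_code; lia.
rewrite (_ : (_ == a) = false); last by apply/negbTE; lia.
by rewrite !mul0r subrr addr0 mulr0.
Qed.
End LastRow.

Section Products.
Variables (K : fieldType).

Lemma prod_at2 N n (A : 'I_n -> 'M[K]_N) (i : 'I_n) : (i.+1 < n)%N ->
  exists P Q, forall F, (forall j, j != i -> j != ordS i -> F j = A j) ->
    \big[mulmx/1%:M]_(j < n) F j = P *m (F i *m F (ordS i)) *m Q.
Proof.
elim: n A i => [|n IH] A i; first by case: i.
case: (unliftP ord0 i) => [i' ->|->] h.
  have [|P [Q H]] := IH (fun j => A (lift ord0 j)) i'; first by [].
  exists (A ord0 *m P), Q => F FA; rewrite big_ord_recl H.
    rewrite FA //; last by rewrite -val_eqE /= modn_small.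
    rewrite -!mulmxA; do 4!congr (_ *m _); congr F.
    by apply/val_inj; rewrite /= /bump /= !modn_small.
  move=> j ji jS; apply: FA; first by rewrite (inj_eq lift_inj).
  by apply: contraNneq jS => /(congr1 val) /=; rewrite /bump /= !add1n !modn_small // => -[e]; rewrite -val_eqE /= modn_small ?e.
clear i IH; case: n A h => [|n] A // _.
exists 1%:M, (\big[mulmx/1%:M]_(j < n) A (lift ord0 (lift ord0 j))) => F FA.
rewrite !big_ord_recl mul1mx -mulmxA; congr (_ *m (_ *m _)).
  by congr F; apply/val_inj; rewrite /= modn_small.
by apply: eq_bigr => j _; apply: FA.
Qed.
End Products.

(** * Spins and states of the lattice model *)

Section SpinCode.
Variable n : nat.
Implicit Types a b l t r : spin n.

Definition spin_code a : nat := if a is Some c then (n.*2 - color_pos c)%N else 0%N.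
Definition uturn a : spin n := if a is Some c then Some (c.1, true) else None.

Lemma color_pos_lt (c : letter n) : (color_pos c < n.*2)%N.
Proof. by case: c => k b; rewrite /color_pos /=; have := ltn_ord k; case: b; lia. Qed.

Lemma color_pos_inj : injective (@color_pos n).
Proof.
move=> [k b] [k' b']; rewrite /color_pos /=; have := ltn_ord k; have := ltn_ord k'.
by case: b; case: b' => /= h h' e; try (by exfalso; lia); congr (_, _);
  apply/val_inj; rewrite /=; lia.
Qed.

Lemma spin_code_inj : injective spin_code.
Proof.
case=> [c|] [c'|] //= e; last 2 first.
- by have := color_pos_lt c; lia.
- by have := color_pos_lt c'; lia.
congr Some; apply: color_pos_inj.
by have := color_pos_lt c; have := color_pos_lt c'; lia.
Qed.

Lemma spin_code_le a : (spin_code a <= n.*2)%N.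
Proof. by case: a => [c|] //=; rewrite leq_subr. Qed.

Lemma spin_code_uturn a : spin_code (uturn a) = fold_code n.*2 (spin_code a).
Proof.
case: a => [[k b]|]; last by rewrite /fold_code min0n.
by rewrite /uturn /spin_code /color_pos /fold_code; have := ltn_ord k; case: b => /=; lia.
Qed.

Lemma color_gtE (c c' : letter n) :
  color_gt c c' = (spin_code (Some c') < spin_code (Some c))%N.
Proof.
rewrite /color_gt /=; have := color_pos_lt c; have := color_pos_lt c'.
by move=> h h'; apply/idP/idP; lia.
Qed.

Lemma uturn_okE a b : uturn_ok (a, b) = (b == uturn a).
Proof.
apply/idP/eqP => [|->].
  case/orP => [/eqP [-> ->] //|/existsP [k]].
  by rewrite !inE => /orP [] /eqP [-> ->].
case: a => [[k b0]|] //=; apply/orP; right; apply/existsP; exists k.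
by rewrite !inE; case: b0; rewrite eqxx ?orbT.
Qed.

Definition spin_min := smin spin_code.
Definition spin_max := smax spin_code.

(** The vertex rules as functions of the incoming spins: left and top for a
    Gamma vertex, right and top for a Delta vertex. *)
Definition gamma_spec l t r b : bool :=
  match l, t with
  | None, _ => (r == t) && (b == None)
  | Some _, None => (r == l) && (b == None) || (r == None) && (b == l)
  | Some _, Some _ => (r == spin_max l t) && (b == spin_min l t)
  end.

Definition delta_spec l t r b : bool :=
  match r, t with
  | None, _ => (l == t) && (b == None)
  | Some _, None => (l == r) && (b == None) || (l == None) && (b == r)
  | Some _, Some _ => (l == spin_min r t) && (b == spin_max r t)
  end.

Lemma spin_min_maxE (c c' : letter n) : color_gt c c' ->
  [/\ spin_min (Some c) (Some c') = Some c', spin_min (Some c') (Some c) = Some c',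
      spin_max (Some c) (Some c') = Some c & spin_max (Some c') (Some c) = Some c].
Proof.
rewrite color_gtE /spin_min /spin_max /smin /smax => h.
by rewrite leqNgt h /= (ltnW h).
Qed.

Lemma spin_min_max_id a : spin_min a a = a /\ spin_max a a = a.
Proof. by rewrite /spin_min /spin_max /smin /smax leqnn. Qed.

Lemma color_total (c c' : letter n) : [\/ c = c', color_gt c c' | color_gt c' c].
Proof.
rewrite !color_gtE; case: (ltngtP (spin_code (Some c)) (spin_code (Some c'))) => h.
- by constructor 3.
- by constructor 2.
by constructor 1; case: (spin_code_inj h).
Qed.

Lemma gamma_okE l t r b : gamma_ok (l, t, r, b) = gamma_spec l t r b.
Proof.
apply/idP/idP.
  case/or3P => [/eqP [-> -> -> ->] //|/existsP [c /existsP [c' /andP [h]]]|/existsP [d]].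
    have [m1 m2 m3 m4] := spin_min_maxE h.
    by rewrite !inE => /orP [] /eqP [-> -> -> ->] /=; rewrite ?m1 ?m2 ?m3 ?m4 !eqxx.
  have [m1 m2] := spin_min_max_id (Some d).
  by rewrite !inE => /or4P [] /eqP [-> -> -> ->] /=; rewrite ?m1 ?m2 !eqxx ?orbT.
case: l t => [c|] [c'|] /=.
- move=> /andP [/eqP -> /eqP ->]; case: (color_total c c') => [<-|h|h].
  + have [-> ->] := spin_min_max_id (Some c).
    by apply/or3P/Or33/existsP; exists c; rewrite !inE eqxx.
  + have [-> _ -> _] := spin_min_maxE h.
    by apply/or3P/Or32/existsP; exists c; apply/existsP; exists c'; rewrite h !inE eqxx orbT.
  + have [_ -> _ ->] := spin_min_maxE h.
    by apply/or3P/Or32/existsP; exists c'; apply/existsP; exists c; rewrite h !inE eqxx.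
- by move=> /orP [] /andP [/eqP -> /eqP ->]; apply/or3P/Or33/existsP; exists c;
    rewrite !inE eqxx ?orbT.
- by move=> /andP [/eqP -> /eqP ->]; apply/or3P/Or33/existsP; exists c'; rewrite !inE eqxx ?orbT.
- by move=> /andP [/eqP -> /eqP ->].
Qed.

Lemma delta_okE l t r b : delta_ok (l, t, r, b) = delta_spec l t r b.
Proof.
apply/idP/idP.
  case/or3P => [/eqP [-> -> -> ->] //|/existsP [c /existsP [c' /andP [h]]]|/existsP [d]].
    have [m1 m2 m3 m4] := spin_min_maxE h.
    by rewrite !inE => /orP [] /eqP [-> -> -> ->] /=; rewrite ?m1 ?m2 ?m3 ?m4 !eqxx.
  have [m1 m2] := spin_min_max_id (Some d).
  by rewrite !inE => /or4P [] /eqP [-> -> -> ->] /=; rewrite ?m1 ?m2 !eqxx ?orbT.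
case: r t => [c|] [c'|] /=.
- move=> /andP [/eqP -> /eqP ->]; case: (color_total c c') => [<-|h|h].
  + have [-> ->] := spin_min_max_id (Some c).
    by apply/or3P/Or33/existsP; exists c; rewrite !inE eqxx.
  + have [-> _ -> _] := spin_min_maxE h.
    by apply/or3P/Or32/existsP; exists c; apply/existsP; exists c'; rewrite h !inE eqxx.
  + have [_ -> _ ->] := spin_min_maxE h.
    by apply/or3P/Or32/existsP; exists c'; apply/existsP; exists c; rewrite h !inE eqxx orbT.
- by move=> /orP [] /andP [/eqP -> /eqP ->]; apply/or3P/Or33/existsP; exists c;
    rewrite !inE eqxx ?orbT.
- by move=> /andP [/eqP -> /eqP ->]; apply/or3P/Or33/existsP; exists c'; rewrite !inE eqxx ?orbT.
- by move=> /andP [/eqP -> /eqP ->].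
Qed.

Lemma spin_code_eq0 a : (spin_code a == 0%N) = (a == None).
Proof. exact: (cd_eq0 spin_code_inj (o := None) erefl). Qed.

Lemma spin_code_eq a b : (spin_code a == spin_code b) = (a == b).
Proof. exact: (cd_eq spin_code_inj). Qed.

Section Weights.
Variable K : fieldType.
Variable z : K.

Lemma gamma_spin_wt0 l t r b : gamma_ok (l, t, r, b) = false -> gamma_spin_wt spin_code z l t r b = 0.
Proof.
rewrite gamma_okE /gamma_spin_wt /gamma_wt !spin_code_eq0 !spin_code_eq -cd_max -cd_min !spin_code_eq.
case: l t => [c|] [c'|] /=; rewrite ?spin_code_eq0 ?spin_code_eq; try by move=> ->.
by case/norP => /negPf -> /negPf ->; rewrite mulr0 addr0.
Qed.

Lemma delta_spin_wt0 l t r b : delta_ok (l, t, r, b) = false -> delta_spin_wt spin_code z l t r b = 0.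
Proof.
rewrite delta_okE /delta_spin_wt /delta_wt !spin_code_eq0 !spin_code_eq -cd_max -cd_min !spin_code_eq.
case: r t => [c|] [c'|] /=; rewrite ?spin_code_eq0 ?spin_code_eq ?mulr0; try by move=> ->; rewrite ?mulr0.
by case/norP => /negPf -> /negPf ->; rewrite addr0.
Qed.

Lemma gamma_spin_wtE l t r b : gamma_ok (l, t, r, b) ->
  gamma_spin_wt spin_code z l t r b = z ^+ ((l != None) && (b == None)).
Proof.
rewrite gamma_okE /gamma_spin_wt /gamma_wt !spin_code_eq0 !spin_code_eq -cd_max -cd_min !spin_code_eq.
case: l t => [c|] [c'|] /=.
- by move=> e; rewrite e; case/andP: e => _ /eqP ->; rewrite /spin_min /smin; case: ifP.
- by case/orP => /andP [/eqP -> /eqP ->]; rewrite !eqxx /= ?mulr0 ?add0r ?mulr1 ?addr0.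
- by move=> ->; rewrite expr0.
- by move=> ->; rewrite expr0.
Qed.

Lemma delta_spin_wtE l t r b : delta_ok (l, t, r, b) ->
  delta_spin_wt spin_code z l t r b = z ^+ (r == None).
Proof.
rewrite delta_okE /delta_spin_wt /delta_wt !spin_code_eq0 !spin_code_eq -cd_max -cd_min !spin_code_eq.
case: r t => [c|] [c'|] /=.
- by move=> ->; rewrite expr0.
- by case/orP => /andP [/eqP -> /eqP ->]; rewrite !eqxx /= ?addr0 ?add0r expr0.
- by move=> ->; rewrite mulr1 expr1.
- by move=> ->; rewrite mulr1 expr1.
Qed.
End Weights.
End SpinCode.

Lemma natr_forall (R : comNzRingType) (I : finType) (b : I -> bool) :
  \prod_i (b i)%:R = [forall i, b i]%:R :> R.
Proof.
case: (altP forallP) => [h|]; first by rewrite big1 // => i _; rewrite h.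
by rewrite negb_forall => /existsP [i /negPf bi]; rewrite (bigD1 i) //= bi mul0r.
Qed.

Section StateSum.
Variables (K : fieldType) (n m : nat) (c : K) (zz : 'I_n -> K).
Local Notation S := (spin n).
Local Notation configS := (config (spin n) m).
Implicit Types (s : state n m) (x : 'I_n -> spin n).

Definition gamma_row_wt s i : K :=
  \prod_(k < m) gamma_spin_wt (@spin_code n) (zz i)
    (hgamma s i (next k)) (vabove s (here i) k) (hgamma s i (here k)) (vbetween s i k).
Definition delta_row_wt s i : K :=
  \prod_(k < m) delta_spin_wt (@spin_code n) (zz i)^-1
    (hdelta s i (next k)) (vbetween s i k) (hdelta s i (here k)) (vabove s (next i) k).
Definition state_weight s : K :=
  \prod_i (uturn_wt (1 + c * zz i) (spin_code (hgamma s i ord0)) * gamma_row_wt s i * delta_row_wt s i).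

(** A state with its edges grouped by pairs of rows, which is the order in which
    a product of matrices sums over them. *)
Definition row_data : finType :=
  (configS * ({ffun 'I_m.+1 -> S} * {ffun 'I_m.+1 -> S}))%type.
Definition state_rows : finType := ({ffun 'I_n.+1 -> configS} * {ffun 'I_n -> row_data})%type.

Definition state_of_rows (t : state_rows) : state n m :=
  ([ffun p => t.1 p.1 p.2], [ffun p => (t.2 p.1).1 p.2],
   [ffun p => (t.2 p.1).2.1 p.2], [ffun p => (t.2 p.1).2.2 p.2]).

Definition rows_of_state s : state_rows :=
  ([ffun i => [ffun k => vabove s i k]],
   [ffun i => ([ffun k => vbetween s i k], ([ffun k => hgamma s i k], [ffun k => hdelta s i k]))]).

Lemma state_of_rowsK : cancel state_of_rows rows_of_state.
Proof.
move=> [V F]; rewrite /rows_of_state; congr (_, _).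
  by apply/ffunP=> i; apply/ffunP=> k; rewrite !ffunE /vabove /state_of_rows ffunE.
apply/ffunP=> i; rewrite !ffunE [RHS]surjective_pairing; congr (_, _).
  by apply/ffunP=> k; rewrite !ffunE /vbetween /state_of_rows ffunE.
rewrite [RHS]surjective_pairing; congr (_, _); apply/ffunP=> k.
  by rewrite !ffunE /hgamma /state_of_rows ffunE.
by rewrite !ffunE /hdelta /state_of_rows ffunE.
Qed.

Lemma rows_of_stateK : cancel rows_of_state state_of_rows.
Proof.
case=> -[[a b] g] d; rewrite /state_of_rows /rows_of_state /=; congr (_, _, _, _);
  by apply/ffunP => -[i k]; rewrite !ffunE.
Qed.

Definition exits_ok x s :=
  [forall i, [&& hgamma s i ord_max == None, hdelta s i ord_max == x i
               & hdelta s i ord0 == uturn (hgamma s i ord0)]].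

(** The matrix products sum over the vertical edges, and each double row sums
    over its horizontal edges. *)
Lemma state_sum x (a0 : configS) :
  entry (\big[mulmx/1%:M]_(i < n) double_row m (@spin_code n) None (@uturn n) c (zz i) (x i)) a0 [ffun=> None] =
  \sum_(s | [&& exits_ok x s, [forall k, vabove s ord0 k == a0 k]
              & [forall k, vabove s ord_max k == None]]) state_weight s.
Proof.
have dblE i : double_row m (@spin_code n) None (@uturn n) c (zz i) (x i) =
  kernel_mx (fun al be : configS => \sum_(r : row_data)
    [&& r.2.1 ord_max == None, r.2.2 ord_max == x i & r.2.2 ord0 == uturn (r.2.1 ord0)]%:R *
    (uturn_wt (1 + c * zz i) (spin_code (r.2.1 ord0)) *
     \prod_(k < m) gamma_spin_wt (@spin_code n) (zz i) (r.2.1 (next k)) (al k) (r.2.1 (here k)) (r.1 k) *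
     \prod_(k < m) delta_spin_wt (@spin_code n) (zz i)^-1 (r.2.2 (next k)) (r.1 k) (r.2.2 (here k)) (be k))).
  apply: entry_inj => al be; rewrite entry_kernel /double_row entry_sumZ.
  under eq_bigr do rewrite entry_mul big_distrr /=.
  rewrite exchange_big /= -(pair_bigA _ (fun (ga : configS) (hh : {ffun 'I_m.+1 -> S} * {ffun 'I_m.+1 -> S}) =>
    [&& hh.1 ord_max == None, hh.2 ord_max == x i & hh.2 ord0 == uturn (hh.1 ord0)]%:R *
    (uturn_wt (1 + c * zz i) (spin_code (hh.1 ord0)) *
     \prod_(k < m) gamma_spin_wt (@spin_code n) (zz i) (hh.1 (next k)) (al k) (hh.1 (here k)) (ga k) *
     \prod_(k < m) delta_spin_wt (@spin_code n) (zz i)^-1 (hh.2 (next k)) (ga k) (hh.2 (here k)) (be k)))) /=.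
  apply: eq_bigr => ga _.
  transitivity (\sum_(g : S) \sum_(h : {ffun 'I_m.+1 -> S} | (h ord0 == g) && (h ord_max == None))
     \sum_(h' : {ffun 'I_m.+1 -> S} | (h' ord0 == uturn g) && (h' ord_max == x i))
    (uturn_wt (1 + c * zz i) (spin_code g) *
     \prod_(k < m) gamma_spin_wt (@spin_code n) (zz i) (h (next k)) (al k) (h (here k)) (ga k) *
     \prod_(k < m) delta_spin_wt (@spin_code n) (zz i)^-1 (h' (next k)) (ga k) (h' (here k)) (be k))).
    apply: eq_bigr => g _; rewrite !entry_kernel /row_kernel /path_sum big_distrlr /= big_distrr /=.
    apply: eq_bigr => h _; rewrite big_distrr /=; apply: eq_bigr => h' _.
    by rewrite mulrA.
  rewrite (exchange_big_dep (fun h : {ffun 'I_m.+1 -> S} => h ord_max == None)) /=; last first.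
    by move=> g h _ /andP [].
  rewrite big_mkcond.
  rewrite -(pair_bigA _ (fun (h h' : {ffun 'I_m.+1 -> S}) =>
    [&& h ord_max == None, h' ord_max == x i & h' ord0 == uturn (h ord0)]%:R *
    (uturn_wt (1 + c * zz i) (spin_code (h ord0)) *
     \prod_(k < m) gamma_spin_wt (@spin_code n) (zz i) (h (next k)) (al k) (h (here k)) (ga k) *
     \prod_(k < m) delta_spin_wt (@spin_code n) (zz i)^-1 (h' (next k)) (ga k) (h' (here k)) (be k)))) /=.
  apply: eq_bigr => h _; case: ifP => hm; last first.
    by rewrite big1 // => h' _; rewrite mul0r.
  rewrite (big_pred1 (h ord0)); last by move=> g /=; rewrite hm andbT eq_sym.
  rewrite big_mkcond; apply: eq_bigr => h' _; rewrite andbC.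
  by case: ifP => _; rewrite ?mul1r ?mul0r.
under eq_bigr do rewrite dblE.
rewrite -path_sumE /path_sum.
under eq_bigr do rewrite bigA_distr_bigA /=.
rewrite pair_big_dep /= [RHS](reindex_onto state_of_rows rows_of_state) /=; last by move=> s _; rewrite rows_of_stateK.
rewrite big_mkcond [RHS]big_mkcond; apply: eq_bigr => -[V F] _ /=.
rewrite state_of_rowsK eqxx !andbT.
have -> : [forall k, vabove (state_of_rows (V, F)) ord0 k == a0 k] = (V ord0 == a0).
  apply/forallP/eqP => [h|<- k]; last by rewrite /vabove /state_of_rows ffunE.
  by apply/ffunP=> k; rewrite -(eqP (h k)) /vabove /state_of_rows ffunE.
have -> : [forall k, vabove (state_of_rows (V, F)) ord_max k == None] = (V ord_max == [ffun=> None]).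
  apply/forallP/eqP => [h|e k]; last by rewrite /vabove /state_of_rows ffunE e ffunE.
  by apply/ffunP=> k; have := eqP (h k); rewrite /vabove /state_of_rows !ffunE.
case: ifP => _; last by rewrite andbF.
rewrite andbT big_split /= natr_forall.
have -> : exits_ok x (state_of_rows (V, F)) = [forall i, [&& (F i).2.1 ord_max == None,
    (F i).2.2 ord_max == x i & (F i).2.2 ord0 == uturn ((F i).2.1 ord0)]].
  by apply: eq_forallb => i; rewrite /hgamma /hdelta /state_of_rows !ffunE.
case: ifP => _; rewrite ?mul0r // mul1r /state_weight; apply: eq_bigr => i _.
rewrite /gamma_row_wt /delta_row_wt /hgamma /state_of_rows ffunE; congr (_ * _ * _); apply: eq_bigr => k _.
  by rewrite /vabove /vbetween !ffunE.
by rewrite /hdelta /vabove /vbetween !ffunE.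
Qed.
End StateSum.

(** * Substitutions in rational functions *)

Section FieldLemmas.
Variables (F : fieldType) (a b c d : F).
Hypotheses (b0 : b != 0) (d0 : d != 0).
Lemma eq_div : a * d = c * b -> a / b = c / d.
Proof. by move=> e; apply/eqP; rewrite eqr_div // e. Qed.
Lemma exprV_mul (z : F) (k N : nat) : z != 0 -> (k <= N)%N -> z^-1 ^+ k * z ^+ N = z ^+ (N - k).
Proof.
by move=> z0 kN; rewrite -{1}(subnK kN) exprD mulrCA -exprMn mulVf // expr1n mulr1.
Qed.
Lemma sub_div : a / b - c / d = (a * d - c * b) / (b * d).
Proof. by rewrite -mulNr addf_div // mulNr. Qed.
End FieldLemmas.

Section Fractions.
Variable R : idomainType.
Lemma frac_repr (f : {fraction R}) :
  f = FracField.tofrac (\n_(repr f)) / FracField.tofrac (\d_(repr f)).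
Proof.
have d0 : FracField.tofrac (\d_(repr f)) != 0 by rewrite tofrac_eq0 denom_ratioP.
apply: (mulIf d0); rewrite mulfVK // -{1}[f]reprK; unlock FracField.tofrac.
rewrite -[LHS]FracField.pi_mul; apply/eqmodP => /=.
rewrite FracField.equivfE /FracField.mulf !numden_Ratio ?oner_eq0 ?mulr1 ?denom_ratioP //.
by rewrite mulrC.
Qed.

Lemma frac_sub (p q p' q' : R) : q != 0 -> q' != 0 ->
  FracField.tofrac p / FracField.tofrac q - FracField.tofrac p' / FracField.tofrac q' =
  FracField.tofrac (p * q' - p' * q) / FracField.tofrac (q * q').
Proof. by move=> q0 q'0; rewrite tofracB !tofracM sub_div ?tofrac_eq0. Qed.

Lemma frac_mul (p q p' q' : R) :
  (FracField.tofrac p / FracField.tofrac q) * (FracField.tofrac p' / FracField.tofrac q') =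
  FracField.tofrac (p * p') / FracField.tofrac (q * q').
Proof. by rewrite !tofracM mulf_div. Qed.
End Fractions.

Section Subst.
Variable n : nat.
Notation K := (ratfun n).
Notation "x %:F" := (FracField.tofrac x).
Implicit Types (v : 'I_n -> K) (f g : K) (p q : {mpoly int[n]}).

Definition alg_indep v := forall p, mmap intr v p = 0 -> p = 0.

Section Morphism.
Variable v : 'I_n -> K.
Hypothesis vI : alg_indep v.
Local Notation phi := (mmap intr v).

Lemma phiM : {morph phi : p q / p * q}.
Proof. exact: (rmorphM (mmap intr v)). Qed.

Lemma phi_neq0 p : p != 0 -> phi p != 0.
Proof. by apply: contraNneq => /vI ->. Qed.

(** Algebraic independence keeps the denominators nonzero, so that the value
    does not depend on the representative. *)
Lemma subst_frac p q : q != 0 -> subst v (p%:F / q%:F) = phi p / phi q.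
Proof.
move=> q0; rewrite /subst; set r := repr _.
have e : p * \d_r = \n_r * q.
  have /eqP := frac_repr (p%:F / q%:F); rewrite -/r eqr_div ?tofrac_eq0 ?denom_ratioP //.
  by rewrite -!tofracM tofrac_eq => /eqP.
have d0 : phi \d_r != 0 by rewrite phi_neq0 ?denom_ratioP.
apply: eq_div; [exact: d0 | exact: phi_neq0 |].
exact: (etrans (esym (phiM _ _)) (etrans (congr1 phi (esym e)) (phiM _ _))).
Qed.

Lemma subst_tofrac p : subst v p%:F = phi p.
Proof. by rewrite -[p%:F]divr1 -tofrac1 subst_frac ?oner_eq0 // rmorph1 divr1. Qed.

Lemma frac_ind f : exists p q, q != 0 /\ f = p%:F / q%:F.
Proof. by exists (\n_(repr f)), (\d_(repr f)); rewrite denom_ratioP -frac_repr. Qed.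

Lemma subst_zmod : zmod_morphism (subst v).
Proof.
move=> f g; case: (frac_ind f) (frac_ind g) => [p [q [q0 ->]]] [p' [q' [q'0 ->]]].
transitivity (subst v ((p * q' - p' * q)%:F / (q * q')%:F)).
  by congr (subst v _); apply: frac_sub.
rewrite !subst_frac ?mulf_neq0 // phiM.
have -> : phi (p * q' - p' * q) = phi p * phi q' - phi p' * phi q.
  by rewrite -!phiM; apply: (rmorphB (mmap intr v)).
by apply/esym/(@sub_div K); apply: phi_neq0.
Qed.

Lemma subst_monoid : monoid_morphism (subst v).
Proof.
split; first by rewrite -tofrac1 subst_tofrac rmorph1.
move=> f g; case: (frac_ind f) (frac_ind g) => [p [q [q0 ->]]] [p' [q' [q'0 ->]]].
transitivity (subst v ((p * p')%:F / (q * q')%:F)).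
  by congr (subst v _); apply: frac_mul.
rewrite !subst_frac ?mulf_neq0 // !phiM.
by apply/esym/(@mulf_div K).
Qed.
End Morphism.

Lemma subst_rmorphism v : alg_indep v ->
  exists s : {rmorphism K -> K}, s =1 subst v.
Proof.
move=> vI.
pose s0 := GRing.isZmodMorphism.Build K K (subst v) (subst_zmod vI).
pose s1 := GRing.isMonoidMorphism.Build K K (subst v) (subst_monoid vI).
pose s : {rmorphism K -> K} := HB.pack (subst v) s0 s1.
by exists s.
Qed.

Lemma subst_zvar v j : alg_indep v -> subst v (zvar j) = v j.
Proof. by move=> vI; rewrite /zvar subst_tofrac // mmapX mmap1U. Qed.

Lemma zvar_neq0 (j : 'I_n) : zvar j != 0.
Proof.
rewrite tofrac_eq0; apply/eqP => /(congr1 (mcoeff U_(j))).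
by rewrite mcoeffX eqxx mcoeff0.
Qed.

(** If the monomials in [v] are, up to a common factor [u], distinct monomials
    in the variables, then no cancellation is possible. *)
Lemma alg_indep_monomials v :
  (forall p, exists (u : K) (tau : 'X_{1..n} -> 'X_{1..n}),
     {in msupp p &, injective tau} /\
     {in msupp p, forall m, mmap1 v m * u = ('X_[tau m])%:F}) ->
  alg_indep v.
Proof.
move=> H p p0; have [u [tau [ti e]]] := H p.
have q0 : \sum_(m <- msupp p) (p@_m *: 'X_[tau m]) = 0 :> {mpoly int[n]}.
  apply/eqP; rewrite -tofrac_eq0 rmorph_sum; apply/eqP.
  transitivity (mmap intr v p * u); last by rewrite p0 mul0r.
  rewrite /mmap mulr_suml; apply: eq_big_seq => m mp.
  rewrite -mulrA e // -mul_mpolyC /= tofracM; congr (_ * _).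
  have -> : (p@_m)%:MP = (p@_m)%:~R :> {mpoly int[n]}.
    by rewrite -{1}[p@_m]intz (rmorph_int (@mpolyC n int)).
  exact: (rmorph_int (@FracField.tofrac {mpoly int[n]})).
apply/mpolyP => m; rewrite mcoeff0; apply/eqP; rewrite mcoeff_eq0; apply/negP => mp.
have := congr1 (mcoeff (tau m)) q0; rewrite mcoeff0 raddf_sum /=.
rewrite (bigD1_seq m) ?msupp_uniq //= mcoeffZ mcoeffX eqxx mulr1 big1_seq ?addr0.
  by move/eqP; rewrite mcoeff_eq0 mp.
move=> m' /andP [ne m'p]; rewrite mcoeffZ mcoeffX.
case: eqP => [/(ti _ _ m'p mp) e'|_]; last by rewrite mulr0.
by rewrite e' eqxx in ne.
Qed.

(** For the inversion of the last variable, negative exponents are cleared by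
    [u = z_i ^ N], where [N] bounds the exponents of [z_i] in [p]. *)
Lemma refl_vars_indep (i : 'I_n) : alg_indep (refl_vars i).
Proof.
apply: alg_indep_monomials => p; rewrite /refl_vars; case: ifP => _.
  exists 1, (fun m => [multinom m (tperm i (ordS i) j) | j < n]%MM); split.
    move=> m m' _ _ /mnmP e; apply/mnmP => j.
    by have := e (tperm i (ordS i) j); rewrite !mnmE tpermK.
  move=> m _; rewrite mulr1 mpolyXE_id rmorph_prod /mmap1.
  rewrite (reindex_inj (@perm_inj _ (tperm i (ordS i)))); apply: eq_bigr => j _ /=.
  by rewrite mnmE tpermK rmorphXn.
pose N := (\max_(m <- msupp p) m i)%N.
have mN m : m \in msupp p -> (m i <= N)%N by move=> mp; exact: leq_bigmax_seq.
exists (zvar i ^+ N), (fun m => [multinom (if j == i then N - m i else m j)%N | j < n]%MM); split.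
  move=> m m' mp m'p /mnmP e; apply/mnmP => j.
  have := e j; rewrite !mnmE; case: eqP => [->|//].
  by have := mN _ mp; have := mN _ m'p; lia.
move=> m mp; rewrite mpolyXE_id rmorph_prod /mmap1 (bigD1 i) //= [RHS](bigD1 i) //=.
rewrite mulrAC mnmE eqxx rmorphXn; congr (_ * _).
  exact: (exprV_mul (zvar_neq0 i) (mN _ mp)).
by apply: eq_bigr => j /negPf ji; rewrite mnmE ji rmorphXn.
Qed.
End Subst.

Local Open Scope nat_scope.

(** * Reduced words of signed permutations *)

Section WeylGroup.
Variable n : nat.
Implicit Types (x y : letter n) (i j k : 'I_n) (w u : {perm letter n}).

Lemma barK : involutive (@bar n).
Proof. by case=> k b; rewrite /bar /= negbK. Qed.

Lemma bar_neq x : bar x != x.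
Proof. by case: x => k b; rewrite /bar xpair_eqE eqxx /=; case: b. Qed.

Lemma WP w : reflect (forall x, w (bar x) = bar (w x)) (w \in W n).
Proof. by rewrite inE; apply: (iffP forallP) => h x; apply/eqP. Qed.

Lemma val_ordS k : k.+1 < n -> val (ordS k) = k.+1.
Proof. by move=> h /=; rewrite modn_small. Qed.

Lemma reflE_lt j k b : j.+1 < n -> refl j (k, b) = (tperm j (ordS j) k, b).
Proof.
move=> jn; rewrite /refl jn permM.
have neq (b1 b2 : bool) (k1 k2 : 'I_n) : ~~ b1 = b2 -> (k1, b1) != (k2, b2) :> letter n.
  by move=> <-; rewrite xpair_eqE; case: b1; rewrite andbF.
have inj (b0 : bool) : injective (fun k : 'I_n => (k, b0) : letter n) by move=> ? ? [].
have tE (b0 : bool) : tperm (j, b0) (ordS j, b0) (k, b0) = (tperm j (ordS j) k, b0) :> letter n.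
  case: (tpermP j) => [->|->|/eqP h1 /eqP h2]; rewrite ?tpermL ?tpermR //.
  by rewrite tpermD // (inj_eq (inj b0)) eq_sym.
case: b.
  have -> : tperm (j, false) (ordS j, false) (k, true) = (k, true) :> letter n.
    by rewrite tpermD ?neq.
  exact: tE.
by rewrite tE (@tpermD _ (j, true)) ?neq.
Qed.

Lemma reflE_last j k b : ~~ (j.+1 < n) -> refl j (k, b) = (k, if k == j then ~~ b else b).
Proof.
move=> jn; rewrite /refl (negPf jn).
case: eqP => [->|ne]; first by case: b; rewrite ?tpermL ?tpermR.
by rewrite tpermD // xpair_eqE eq_sym (introF eqP ne).
Qed.

Lemma refl_W j : refl j \in W n.
Proof.
apply/WP => -[k b]; case: (boolP (j.+1 < n)) => jn; first by rewrite /bar !reflE_lt.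
by rewrite /bar !reflE_last //=; case: (k == j).
Qed.

Lemma refl_invol j : involutive (refl j).
Proof.
case=> k b; case: (boolP (j.+1 < n)) => jn.
  by rewrite !reflE_lt // tpermK.
by rewrite !reflE_last //; case: (k == j); rewrite ?negbK.
Qed.

Lemma reflV j : (refl j)^-1%g = refl j.
Proof.
by apply/permP => x; apply: (@perm_inj _ (refl j)); rewrite permKV refl_invol.
Qed.

Lemma refl_mul j : (refl j * refl j = 1)%g.
Proof. by rewrite -{1}(reflV j) mulVg. Qed.

Lemma W1 : 1%g \in W n.
Proof. by apply/WP => x; rewrite !perm1. Qed.

Lemma W_mul u w : u \in W n -> w \in W n -> (u * w)%g \in W n.
Proof. by move=> /WP hu /WP hw; apply/WP => x; rewrite !permM hu hw. Qed.

Lemma W_inv w : w \in W n -> w^-1%g \in W n.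
Proof. by move=> /WP hw; apply/WP => x; apply: (@perm_inj _ w); rewrite hw !permKV. Qed.

Lemma word_perm_W s : word_perm s \in W n.
Proof. by elim: s => [|i s IH] /=; rewrite ?W1 // W_mul ?refl_W. Qed.

(** The reflection of the group of signed permutations that interchanges [x]
    and [y]. *)
Definition pair_refl x y : {perm letter n} :=
  if y == bar x then tperm x y else (tperm x y * tperm (bar x) (bar y))%g.

Lemma pair_reflJ j x y : (pair_refl x y ^ refl j)%g = pair_refl (refl j x) (refl j y).
Proof.
have /WP h := refl_W j.
rewrite /pair_refl -h (inj_eq perm_inj); case: ifP => _.
  by rewrite tpermJ.
by rewrite conjMg !tpermJ !h.
Qed.

(** A simple reflection reverses the order of one pair of letters only, up to
    bar. *)
Lemma color_pos_lt_flip j x y : color_pos x < color_pos y ->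
  ~~ (color_pos (refl j x) < color_pos (refl j y)) -> pair_refl x y = refl j.
Proof.
case: x y => [k b] [k' b'].
case: (boolP (j.+1 < n)) => jn; last first.
  rewrite !reflE_last // /color_pos /= => h1 h2.
  have [-> -> -> ->] : [/\ k = j, k' = j, b = false & b' = true].
    have := ltn_ord k; have := ltn_ord k'; have := ltn_ord j.
    move: h1 h2; rewrite -!val_eqE /=; case: b; case: b' => /=; do 2?case: eqP => /= ?;
    move=> *; (try by exfalso; lia); split=> //; first [assumption | by apply/val_inj; rewrite /=; lia | by congr val].
  by rewrite /pair_refl /bar /= eqxx /refl (negPf jn).
rewrite !reflE_lt // /color_pos /= => h1 h2.
have vS := val_ordS jn.
have tP (l : 'I_n) : [\/ l = j :> nat /\ tperm j (ordS j) l = j.+1 :> nat,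
    l = j.+1 :> nat /\ tperm j (ordS j) l = j :> nat |
    [/\ (l <> j :> nat), (l <> j.+1 :> nat) & tperm j (ordS j) l = l :> nat]].
  case: tpermP => [->|->|n1 n2].
  - by constructor 1; split.
  - by constructor 2; split.
  constructor 3; split=> // e; [apply: n1 | apply: n2]; apply/val_inj => //.
  by rewrite vS.
have : [\/ [/\ k = j, k' = ordS j, b = false & b' = false]
         | [/\ k = ordS j, k' = j, b = true & b' = true]].
  have lk := ltn_ord k; have lk' := ltn_ord k'.
  move: h1 h2; case: (tP k) => [[? ?]|[? ?]|[? ? ?]];
  case: (tP k') => [[? ?]|[? ?]|[? ? ?]];
  case: b; case: b' => /= ? ?; try (by exfalso; lia);
  [left|right]; split=> //; apply/val_inj; rewrite ?vS; assumption.
have tc (a b0 c d : letter n) : a != c -> a != d -> b0 != c -> b0 != d -> (tperm a b0 * tperm c d = tperm c d * tperm a b0)%g.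
  by move=> ac ad bc bd; apply/commgP/conjg_fixP; rewrite tpermJ !tpermD // eq_sym.
case=> -[-> -> -> ->]; rewrite /pair_refl /refl jn /bar xpair_eqE /= ?andbF ?andbT //.
by rewrite tc ?xpair_eqE ?andbF // tpermC [X in (_ * X)%g]tpermC.
Qed.

(** Strong exchange: read the letters from the left and follow the pair
    [x, y]; at the letter that reverses their order, the reflection has been
    conjugated into this letter, which can be deleted. *)
Lemma exchange s x y : color_pos x < color_pos y ->
  color_pos (((word_perm s)^-1)%g y) < color_pos (((word_perm s)^-1)%g x) ->
  exists2 s', (size s').+1 = size s & word_perm s' = (word_perm s * pair_refl x y)%g.
Proof.
elim: s x y => [|j s IH] x y xy /=.
  by rewrite invg1 !perm1 ltnNge (ltnW xy).
rewrite invMg reflV !permM => h.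
case: (boolP (color_pos (refl j x) < color_pos (refl j y))) => f; last first.
  by exists s => //; rewrite (color_pos_lt_flip xy f) -mulgA refl_mul mulg1.
have [s' <- e] := IH _ _ f h; exists (j :: s') => //=.
by rewrite e -pair_reflJ conjgE reflV -!mulgA refl_mul mulg1.
Qed.

(** If the order of the two letters were already reversed, [exchange] would
    produce a word for [w] that is shorter than [i :: s]. *)
Lemma reduced_cons w i s : reduced_word w (i :: s) ->
  let u := word_perm s in
  [/\ w = (u * refl i)%g, reduced_word u s &
    if i.+1 < n then color_pos ((u^-1)%g (i, false)) < color_pos ((u^-1)%g (ordS i, false))
    else ~~ ((u^-1)%g (i, false)).2].
Proof.
move=> [ew red] u; have eu : word_perm s = u by [].
split; first by rewrite -ew.
  split=> // s' es'; have := red (i :: s'); rewrite /= es' -ew => /(_ erefl).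
  by rewrite ltnS.
have noexch x y : color_pos x < color_pos y -> pair_refl x y = refl i ->
    color_pos ((u^-1)%g x) < color_pos ((u^-1)%g y).
  move=> xy exy; rewrite ltnNge leq_eqVlt negb_or; apply/andP; split.
    apply/negP => /eqP e.
    by move/color_pos_inj/perm_inj: e xy => ->; rewrite ltnn.
  apply/negP => h; have [s' es e] := exchange xy h.
  by have := red s'; rewrite e exy -ew /= => /(_ erefl); rewrite -es; lia.
case: ifP => hn.
  apply: noexch; first by rewrite /color_pos /= modn_small.
  by rewrite /pair_refl /refl hn /bar xpair_eqE andbF.
have /WP hb := W_inv (word_perm_W s).
have := noexch (i, false) (i, true).
rewrite -[(i, true)]/(bar (i, false)) hb /color_pos /= /pair_refl eqxx /refl hn.
case: (u^-1%g (i, false)) => [k [|]] //=; have := ltn_ord k; have := ltn_ord i => h1 h2 h.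
by have := h _ erefl; lia.
Qed.
End WeylGroup.

(** * Configurations of particles on a line *)

Lemma ord_down m (P : 'I_m.+1 -> Prop) : P ord_max ->
  (forall k : 'I_m, P (next k) -> P (here k)) -> forall i, P i.
Proof.
move=> P0 PS; have H j : j <= m -> forall i : 'I_m.+1, (i + j = m)%N -> P i.
  elim: j => [|j IH] jm i e.
    by rewrite (_ : i = ord_max) //; apply/val_inj => /=; lia.
  have im : i < m by lia.
  rewrite (_ : i = here (Ordinal im)); last exact/val_inj.
  by apply: PS; apply: IH; [lia | rewrite /= /bump /=; lia].
by move=> i; apply: (H (m - i)); have := ltn_ord i; lia.
Qed.

Lemma ord_up m (P : 'I_m.+1 -> Prop) : P ord0 ->
  (forall k : 'I_m, P (here k) -> P (next k)) -> forall i, P i.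
Proof.
move=> P0 PS; have H j : forall i : 'I_m.+1, (i = j :> nat) -> P i.
  elim: j => [|j IH] i e.
    by rewrite (_ : i = ord0) //; apply/val_inj.
  have im : j < m by have := ltn_ord i; lia.
  rewrite (_ : i = next (Ordinal im)); last by apply/val_inj.
  by apply: PS; apply: IH.
by move=> i; apply: (H i).
Qed.

Lemma downset_card M (P : pred nat) (k : nat) :
  (forall i j, i <= j -> P j -> P i) ->
  (k < #|[pred i : 'I_M | P i]|) = (k < M) && P k.
Proof.
move=> dn.
have cardlt (t : nat) : #|[pred i : 'I_M | i < t]| = minn t M.
  rewrite -sum1_card (eq_bigl (fun i : 'I_M => (i < t) && true)); last first.
    by move=> i; rewrite inE andbT.
  rewrite -(big_mkord (fun i => (i < t) && true) (fun=> 1)).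
  rewrite big_mkcond /=; elim: M {P dn} => [|M IH]; first by rewrite big_geq // minn0.
  by rewrite big_nat_recr //= IH andbT; case: ifP => h; lia.
apply/idP/andP => [h|[kM Pk]].
  have Pk : P k.
    apply: contraLR h => nPk; rewrite -leqNgt.
    apply: (@leq_trans #|[pred i : 'I_M | i < k]|); last by rewrite cardlt geq_minl.
    apply: subset_leq_card; apply/subsetP => i; rewrite !inE => Pi.
    by rewrite ltnNge; apply: contra nPk => ki; apply: dn Pi.
  by split=> //; apply: leq_trans h _; rewrite -[leqRHS](card_ord M) max_card.
apply: (@leq_trans #|[pred i : 'I_M | i < k.+1]|); first by rewrite cardlt; lia.
by apply: subset_leq_card; apply/subsetP => i; rewrite !inE ltnS => ik; apply: dn Pk.
Qed.

Section Counts.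
Variable m : nat.
Implicit Types (O : 'I_m -> bool) (k d r : nat) (Q : nat -> nat).

Definition count_from O d : nat := #|[pred c : 'I_m | (d <= c) && O c]|.

Lemma count_from_big O d : m <= d -> count_from O d = 0.
Proof.
by move=> md; apply: eq_card0 => c; rewrite inE leqNgt (leq_trans (ltn_ord c) md).
Qed.

Lemma count_from_step O (c : 'I_m) : count_from O c = O c + count_from O c.+1.
Proof.
rewrite /count_from (cardD1 c) inE leqnn /=; congr (_ + _).
by apply: eq_card => e; rewrite !inE ltn_neqAle -andbA eq_sym -val_eqE.
Qed.

Lemma count_from_mono O d e : d <= e -> count_from O e <= count_from O d.
Proof.
move=> de; apply: subset_leq_card; apply/subsetP => c; rewrite !inE => /andP [ec ->].
by rewrite (leq_trans de ec).
Qed.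

Lemma count_from_le1 O d : count_from O d <= (count_from O d.+1).+1.
Proof.
case: (ltnP d m) => [dm|md]; last by rewrite count_from_big.
by have := count_from_step O (Ordinal dm) => /= ->; case: (O _) => /=; lia.
Qed.

Lemma eq_count_from O O' d : O =1 O' -> count_from O d = count_from O' d.
Proof. by move=> e; apply: eq_card => c; rewrite !inE e. Qed.

(** There are [k] particles, and [Q r] is one more than the column of the [r]-th
    one from the left; [Q r = 0] stands for a particle that is absent. *)
Definition positions O k Q := forall r d, (r < count_from O d) = (r < k) && (d < Q r).

Lemma positions_occ O k Q c : positions O k Q -> O c = [exists r : 'I_k, Q r == c.+1].
Proof.
move=> R; apply/idP/existsP => [Oc|[r /eqP Qr]].
  have h := count_from_step O c; rewrite Oc in h.
  have := R (count_from O c.+1) c; rewrite h leqnn => /esym/andP [tk ct].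
  exists (Ordinal tk); have := R (count_from O c.+1) c.+1; rewrite ltnn tk /=.
  by move/esym/negbT; rewrite -leqNgt eqn_leq ct => ->.
have := R r c; have := R r c.+1; rewrite ltn_ord Qr ltnn leqnn /=.
by have := count_from_step O c; case: (O c) => // ->; rewrite add0n => ->.
Qed.

Lemma occ_positions O k Q :
  (forall r r', r < r' -> r' < k -> Q r' < Q r) -> (forall r, r < k -> Q r <= m) ->
  (forall c, O c = [exists r : 'I_k, Q r == c.+1]) -> positions O k Q.
Proof.
move=> dec Qm OE r d.
have H j : forall d r, m <= d + j -> (r < count_from O d) = (r < k) && (d < Q r).
  elim: j => [|j IH] {}d {}r mdj.
    rewrite count_from_big ?ltn0; last by rewrite addn0 in mdj.
    by apply/esym/negbTE/negP => /andP [/Qm]; lia.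
  case: (ltnP d m) => [dm|md]; last by apply: IH; lia.
  have := count_from_step O (Ordinal dm) => /= ->.
  have IH' r0 : (r0 < count_from O d.+1) = (r0 < k) && (d.+1 < Q r0) by apply: IH; lia.
  rewrite OE /=; case: existsP => [[r0 /eqP Q0]|nex] /=.
    have e0 : count_from O d.+1 = r0.
      apply/eqP; rewrite eqn_leq; apply/andP; split.
        by rewrite leqNgt IH' Q0 ltnn andbF.
      rewrite leqNgt; apply/negP => h.
      have := IH' (count_from O d.+1); rewrite ltnn (ltn_trans h (ltn_ord r0)) /=.
      by have := dec _ _ h (ltn_ord r0); rewrite Q0; lia.
    rewrite e0 add1n ltnS; case: (ltngtP r r0) => [rr|rr|->].
    - by rewrite (ltn_trans rr (ltn_ord r0)) /=; have := dec _ _ rr (ltn_ord r0); lia.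
    - by apply/esym/negbTE/negP => /andP [rk]; have := dec _ _ rr rk; lia.
    - by rewrite ltn_ord Q0 ltnSn.
  rewrite add0n IH'; case rk : (r < k) => //=.
  have : Q r <> d.+1 by move=> e; case: nex; exists (Ordinal rk); rewrite /= e.
  by lia.
by apply: (H m); lia.
Qed.

Lemma positions_le O k Q d : positions O k Q -> count_from O d <= k.
Proof.
move=> R; rewrite leqNgt; apply/negP => h.
by have := R k d; rewrite h ltnn.
Qed.

(** Double counting of the pairs of a particle and a column weakly to its
    right. *)
Lemma sum_count_from O k Q : (forall r, r < k -> Q r <= m) -> positions O k Q ->
  \sum_(d < m) count_from O d = \sum_(r < k) Q r.
Proof.
move=> Qm R.
have cardlt (t M : nat) : t <= M -> \sum_(i < M) (i < t) = t.
  suff -> : \sum_(i < M) (i < t) = minn t M by move/minn_idPl.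
  elim: M => [|M IH]; first by rewrite big_ord0 minn0.
  by rewrite big_ord_recr /= IH; case: (ltnP M t) => h /=; lia.
transitivity (\sum_(d < m) \sum_(r < k) (d < Q r)).
  apply: eq_bigr => d _; rewrite -{1}(cardlt _ _ (positions_le d R)).
  by apply: eq_bigr => r _; rewrite R ltn_ord.
rewrite exchange_big; apply: eq_bigr => r _ /=.
exact: cardlt (Qm _ _).
Qed.
End Counts.

(** * Flux of particles through a row *)

Section VertexOccupancy.
Variable n : nat.
Implicit Types (l t r b : spin n).

Lemma spin_min_neq0 (c c' : letter n) : spin_min (Some c) (Some c') != None.
Proof. by rewrite /spin_min /smin; case: ifP. Qed.
Lemma spin_max_neq0 (c c' : letter n) : spin_max (Some c) (Some c') != None.
Proof. by rewrite /spin_max /smax; case: ifP. Qed.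

Lemma gamma_occ l t r b : gamma_ok (l, t, r, b) ->
  (l != None) + (t != None) = (r != None) + (b != None) /\ ((b != None) -> (l != None)).
Proof.
rewrite gamma_okE; case: l t => [c|] [c'|] /=.
- by case/andP=> /eqP -> /eqP ->; rewrite spin_min_neq0 spin_max_neq0.
- by case/orP => /andP [/eqP -> /eqP ->].
- by case/andP=> /eqP -> /eqP ->.
- by case/andP=> /eqP -> /eqP ->.
Qed.

Lemma delta_occ l t r b : delta_ok (l, t, r, b) ->
  (r != None) + (t != None) = (l != None) + (b != None) /\ ((t != None) -> (l != None)).
Proof.
rewrite delta_okE; case: r t => [c|] [c'|] /=.
- by case/andP=> /eqP -> /eqP ->; rewrite spin_min_neq0 spin_max_neq0.
- by case/orP => /andP [/eqP -> /eqP ->].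
- by case/andP=> /eqP -> /eqP ->.
- by case/andP=> /eqP -> /eqP ->.
Qed.

(** This allows one to fill in a Gamma row from left to right, and a Delta row from
    right to left, when the occupied edges below it are given. *)
Lemma gamma_det l t r b r' b' : gamma_ok (l, t, r, b) -> gamma_ok (l, t, r', b') ->
  (b != None) = (b' != None) -> r = r' /\ b = b'.
Proof.
rewrite !gamma_okE; case: l t => [c|] [c'|] /=.
- by move=> /andP [/eqP -> /eqP ->] /andP [/eqP -> /eqP ->].
- by move=> /orP [] /andP [/eqP -> /eqP ->] /orP [] /andP [/eqP -> /eqP ->].
- by move=> /andP [/eqP -> /eqP ->] /andP [/eqP -> /eqP ->].
- by move=> /andP [/eqP -> /eqP ->] /andP [/eqP -> /eqP ->].
Qed.

Lemma delta_det l t r b l' b' : delta_ok (l, t, r, b) -> delta_ok (l', t, r, b') ->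
  (b != None) = (b' != None) -> l = l' /\ b = b'.
Proof.
rewrite !delta_okE; case: r t => [c|] [c'|] /=.
- by move=> /andP [/eqP -> /eqP ->] /andP [/eqP -> /eqP ->].
- by move=> /orP [] /andP [/eqP -> /eqP ->] /orP [] /andP [/eqP -> /eqP ->].
- by move=> /andP [/eqP -> /eqP ->] /andP [/eqP -> /eqP ->].
- by move=> /andP [/eqP -> /eqP ->] /andP [/eqP -> /eqP ->].
Qed.
End VertexOccupancy.

Section RowCounts.
Variables n m : nat.
Variables (h : 'I_m.+1 -> spin n) (t b : 'I_m -> spin n).
Notation occ f := (fun c => f c != None).

Section Gamma.
Hypothesis ok : forall k, gamma_ok (h (next k), t k, h (here k), b k).
Hypothesis hmax : h ord_max = None.

(** Vertices conserve particles, and none enters a Gamma row at the left. *)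
Lemma gamma_flux i : (h i != None) + count_from (occ b) i = count_from (occ t) i.
Proof.
elim/ord_down: i => [|k IH]; first by rewrite hmax !count_from_big.
have [e _] := gamma_occ (ok k).
have := count_from_step (occ t) k; have := count_from_step (occ b) k => /= -> ->.
rewrite /= /bump /= add1n in IH.
by rewrite -IH addnA -e addnCA addnA.
Qed.

(** With [gamma_lower]: the positions above and below a Gamma row interlace. A
    particle goes down only where one arrives horizontally, hence it has moved
    by at least one column. *)
Lemma gamma_upper d : count_from (occ b) d <= count_from (occ t) d.+1.
Proof.
case: (ltnP d m) => [dm|md]; last by rewrite count_from_big.
pose k := Ordinal dm; have := gamma_flux (next k); rewrite /= /bump /= add1n.
have [_ e] := gamma_occ (ok k).
have := count_from_step (occ b) k => /= ->.
by case: (b k != None) e => [->|_] //; case: (h (next k) != None); lia.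
Qed.

Lemma gamma_lower d : count_from (occ t) d <= (count_from (occ b) d).+1.
Proof.
case: (ltnP d m) => [dm|md]; last by rewrite count_from_big.
by have := gamma_flux (here (Ordinal dm)) => /= <-; case: (_ != None); lia.
Qed.
End Gamma.

Section Delta.
Hypothesis ok : forall k, delta_ok (h (next k), t k, h (here k), b k).
Hypothesis hmax : h ord_max != None.

(** Vertices conserve particles, and one leaves a Delta row at the left. *)
Lemma delta_flux i : (h i != None) + count_from (occ t) i = (count_from (occ b) i).+1.
Proof.
elim/ord_down: i => [|k IH]; first by rewrite hmax !count_from_big.
have [e _] := delta_occ (ok k).
have := count_from_step (occ t) k; have := count_from_step (occ b) k => /= -> ->.
rewrite /= /bump /= add1n in IH; by rewrite addnA e addnAC IH addSn addnC.
Qed.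

Lemma delta_upper d : count_from (occ t) d <= (count_from (occ b) d.+1).+1.
Proof.
case: (ltnP d m) => [dm|md]; last by rewrite count_from_big.
pose k := Ordinal dm; have := delta_flux (next k); rewrite /= /bump /= add1n.
have [_ e] := delta_occ (ok k).
have := count_from_step (occ t) k => /= ->.
by case: (t k != None) e => [->|_] //; case: (h (next k) != None); lia.
Qed.

Lemma delta_lower d : count_from (occ b) d <= count_from (occ t) d.
Proof.
case: (ltnP d m) => [dm|md]; last by rewrite count_from_big.
by have := delta_flux (here (Ordinal dm)) => /=; case: (_ != None); lia.
Qed.
End Delta.
End RowCounts.

(** * Shapes of the subtableaux of a reverse King tableau *)

Section Shapes.
Variables (n : nat) (lam : n.-tuple nat).
Hypothesis lam_part : sorted geq lam.
Implicit Types (U : {ffun cell lam -> letter n}) (rho r col : nat).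

Lemma geq_trans : transitive geq.
Proof. by move=> a b c /= h1 h2; apply: leq_trans h2 h1. Qed.

Lemma lam_anti (r r' : 'I_n) : r <= r' -> tnth lam r' <= tnth lam r.
Proof.
move=> h; rewrite !(tnth_nth 0).
have H := sorted_leq_nth geq_trans leqnn 0 lam_part.
by apply: H; rewrite ?inE ?size_tuple.
Qed.

Lemma lam_head (r : 'I_n) : tnth lam r <= head 0 lam.
Proof.
have n0 : 0 < n by apply: leq_trans (ltn_ord r).
rewrite -nth0 -[nth _ _ _](tnth_nth 0 lam (Ordinal n0)).
exact: lam_anti.
Qed.

Lemma cell_ex (r : 'I_n) col : col < tnth lam r ->
  exists c : cell lam, rowc c = r /\ colc c = col.
Proof.
move=> h; have hh : col < head 0 lam by apply: leq_trans h (lam_head r).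
by exists (exist _ (r, Ordinal hh) h : cell lam).
Qed.

Lemma cell_lt (c : cell lam) : colc c < tnth lam (rowc c).
Proof. exact: (valP c). Qed.

Lemma cell_inj (c d : cell lam) : rowc c = rowc d -> colc c = colc d -> c = d.
Proof.
case: c d => [[r1 c1] h1] [[r2 c2] h2] /= e1 e2; apply: val_inj => /=.
by congr (_, _) => //; apply: val_inj.
Qed.

(** For [rho = 2 i] and [rho = 2 i + 1] these are the parts of the shapes of the
    subtableaux that define the edges above and below a Gamma row. *)
Definition row_len U rho r : nat :=
  #|[set c : cell lam | (rowc c == r :> nat) && (rho <= letter_rank (U c))]|.

Definition in_shape U rho r col : bool :=
  [exists c : cell lam, [&& rowc c == r :> nat, colc c == col & rho <= letter_rank (U c)]].

Lemma in_shapeP U rho (c : cell lam) :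
  in_shape U rho (rowc c) (colc c) = (rho <= letter_rank (U c)).
Proof.
apply/existsP/idP => [[d /and3P [/eqP e1 /eqP e2]]|h]; last by exists c; rewrite !eqxx.
by rewrite (cell_inj (val_inj e1) e2).
Qed.

Lemma in_shape_row U rho (r : 'I_n) col : in_shape U rho r col -> col < tnth lam r.
Proof.
case/existsP=> c /and3P [/eqP e1 /eqP <- _].
by rewrite -(val_inj e1) cell_lt.
Qed.

Section King.
Variable U : {ffun cell lam -> letter n}.
Hypothesis kU : reverse_king U.

Lemma king_row (c d : cell lam) : rowc c = rowc d -> colc c <= colc d ->
  letter_rank (U d) <= letter_rank (U c).
Proof.
case/and3P: kU => /forallP k1 _ _ e; rewrite leq_eqVlt => /orP [/eqP e'|h].
  by rewrite (cell_inj e e').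
by have /forallP/(_ d)/implyP := k1 c; apply; rewrite e eqxx.
Qed.

Lemma king_col (c d : cell lam) : colc c = colc d -> rowc c < rowc d ->
  letter_rank (U d) < letter_rank (U c).
Proof.
case/and3P: kU => _ /forallP k2 _ e h.
by have /forallP/(_ d)/implyP := k2 c; apply; rewrite e eqxx.
Qed.

Lemma king_bound (c : cell lam) : letter_rank (U c) <= (n - (rowc c).+1).*2.+1.
Proof.
case/and3P: kU => _ _ /forallP /(_ c).
by rewrite /letter_rank /row_bound /= addn1.
Qed.

(** Rows weakly decrease, so the entries in question form an initial segment of
    the row. *)
Lemma row_lenP rho r col : (col < row_len U rho r) = in_shape U rho r col.
Proof.
have -> : row_len U rho r = #|[pred i : 'I_(head 0 lam) | in_shape U rho r i]|.
  rewrite /row_len -(card_in_imset (f := fun c : cell lam => (val c).2)); last first.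
    move=> c d; rewrite !inE => /andP [/eqP e1 _] /andP [/eqP e2 _] e.
    apply: cell_inj; last by rewrite /colc e.
    by apply: val_inj; rewrite /= e1 e2.
  apply: eq_card => i; rewrite [RHS]inE; apply/imsetP/existsP => -[c].
    by rewrite inE => /andP [h1 h2] ->; exists c; rewrite h1 h2 /colc eqxx.
  case/and3P=> h1 /eqP h2 h3; exists c; first by rewrite inE h1 h3.
  by apply: val_inj; exact: esym h2.
rewrite downset_card; last first.
  move=> i j ij /existsP [c /and3P [/eqP h1 /eqP h2 h3]].
  have [d [e1 e2]] : exists d : cell lam, rowc d = rowc c /\ colc d = i.
    by apply: cell_ex; apply: leq_ltn_trans ij _; rewrite -h2 cell_lt.
  apply/existsP; exists d; rewrite e1 h1 e2 !eqxx /=.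
  by apply: leq_trans h3 (king_row _ _); rewrite // e2 h2.
rewrite andbC; case h : (in_shape _ _ _ _) => //=.
by case/existsP: h => c /and3P [_ /eqP <- _]; rewrite /colc ltn_ord.
Qed.

Lemma row_len_lift rho r rho' r' : 
  (forall col, in_shape U rho r col -> in_shape U rho' r' col) -> row_len U rho r <= row_len U rho' r'.
Proof.
move=> H; rewrite leqNgt; apply/negP => h.
by have := row_lenP rho' r' (row_len U rho' r'); rewrite ltnn H // -row_lenP.
Qed.

Lemma row_len_mono rho r : row_len U rho.+1 r <= row_len U rho r.
Proof.
apply: row_len_lift => col /existsP [c /and3P [h1 h2 h3]].
by apply/existsP; exists c; rewrite h1 h2 ltnW.
Qed.

(** An entry is less than the entry above it. *)
Lemma row_len_strict rho r : row_len U rho r.+1 <= row_len U rho.+1 r.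
Proof.
apply: row_len_lift => col /existsP [c /and3P [/eqP h1 /eqP h2 h3]].
have rn : r < n by have := ltn_ord (rowc c); rewrite h1; lia.
have [d [e1 e2]] : exists d : cell lam, rowc d = Ordinal rn /\ colc d = col.
  apply: cell_ex; rewrite -h2; apply: leq_trans (cell_lt c) _.
  by apply: lam_anti; rewrite h1 /=.
apply/existsP; exists d; rewrite e1 e2 !eqxx /=.
by apply: leq_ltn_trans h3 (king_col _ _); rewrite ?e2 ?e1 ?h1.
Qed.

Lemma row_len_next rho r : row_len U rho r.+1 <= row_len U rho r.
Proof. exact: leq_trans (row_len_strict _ _) (row_len_mono _ _). Qed.

Lemma row_len_bound rho r : (n - r.+1).*2.+1 < rho -> row_len U rho r = 0.
Proof.
move=> h; apply/eqP; rewrite cards_eq0 -subset0; apply/subsetP => c.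
rewrite !inE => /andP [/eqP e h2].
by have := king_bound c; rewrite e; lia.
Qed.

Lemma row_len_big rho r : n <= r -> row_len U rho r = 0.
Proof.
move=> h; apply/eqP; rewrite cards_eq0 -subset0; apply/subsetP => c.
by rewrite !inE => /andP [/eqP e h2]; have := ltn_ord (rowc c); rewrite e; lia.
Qed.

Lemma row_len_out i rho r : n - i <= r -> i.*2 <= rho -> row_len U rho r = 0.
Proof.
move=> h h'; case: (ltnP r n) => rn; last exact: row_len_big.
by apply: row_len_bound; lia.
Qed.

Lemma row_len0 (r : 'I_n) : row_len U 0 r = tnth lam r.
Proof.
apply/eqP; rewrite eqn_leq; apply/andP; split; rewrite leqNgt; apply/negP => h.
  by have := h; rewrite row_lenP => /in_shape_row; rewrite ltnn.
have [c [e1 e2]] := cell_ex h.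
by have := in_shapeP U 0 c; rewrite e1 e2 -row_lenP ltnn.
Qed.

Lemma row_len_le rho r : row_len U rho r <= head 0 lam.
Proof.
case: (ltnP r n) => [rn|h]; last by rewrite row_len_big.
apply: leq_trans (lam_head (Ordinal rn)).
rewrite -row_len0 /=; elim: rho => // rho IH.
exact: leq_trans (row_len_mono _ _) IH.
Qed.

Definition pos_above (i : nat) r := row_len U i.*2 r + (n - i - r).
Definition pos_between (i : nat) r := row_len U i.*2.+1 r + (n - i - r.+1).

Lemma pos_above_dec i r r' : r < r' -> r' < n - i -> pos_above i r' < pos_above i r.
Proof.
move=> h h'; elim: r' h h' => // r' IH h h'.
have step : pos_above i r'.+1 < pos_above i r' by rewrite /pos_above; have := row_len_next i.*2 r'; lia.
move: h; rewrite ltnS leq_eqVlt => /orP [/eqP -> //|h].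
by apply: ltn_trans step (IH h _); lia.
Qed.

Lemma pos_between_dec i r r' : r < r' -> r' < n - i -> pos_between i r' < pos_between i r.
Proof.
move=> h h'; elim: r' h h' => // r' IH h h'.
have step : pos_between i r'.+1 < pos_between i r' by rewrite /pos_between; have := row_len_next i.*2.+1 r'; lia.
move: h; rewrite ltnS leq_eqVlt => /orP [/eqP -> //|h].
by apply: ltn_trans step (IH h _); lia.
Qed.

Lemma cols_aboveE (i : 'I_n) c : cols_above U i c = [exists r : 'I_(n - i), pos_above i r == c.+1].
Proof.
have rank : letter_rank (i, false) = i.*2 by rewrite /letter_rank /= addn0.
apply/existsP/existsP => [[j /andP [ij /eqP ->]]|[r /eqP e]].
  have h : j - i < n - i by have := ltn_ord j; lia.
  exists (Ordinal h); rewrite /pos_above /subshape rank -/(row_len _ _ _) /=.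
  by have := ltn_ord j; lia.
have h : i + r < n by have := ltn_ord r; lia.
exists (Ordinal h); rewrite leq_addr /= /subshape rank -/(row_len _ _ _) /=.
by move: e; rewrite /pos_above addKn; have := ltn_ord r; lia.
Qed.

Lemma cols_betweenE (i : 'I_n) c : cols_between U i c = [exists r : 'I_(n - i), pos_between i r == c.+1].
Proof.
have rank : letter_rank (i, true) = i.*2.+1 by rewrite /letter_rank /= addn1.
apply/existsP/existsP => [[j /and3P [ij nz /eqP ->]]|[r /eqP e]].
  have h : j - i < n - i by have := ltn_ord j; lia.
  exists (Ordinal h); move: nz; rewrite /pos_between /subshape rank -/(row_len _ _ _) /=.
  by have := ltn_ord j; lia.
have h : i + r < n by have := ltn_ord r; lia.
exists (Ordinal h); rewrite leq_addr /= /subshape rank -/(row_len _ _ _) /=.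
by move: e; rewrite /pos_between addKn; have := ltn_ord r; lia.
Qed.

Variable m : nat.
Hypothesis m_ge : head 0 lam + n <= m.

Lemma pos_above_le i r : pos_above i r <= m.
Proof. by rewrite /pos_above; have := row_len_le i.*2 r; lia. Qed.
Lemma pos_between_le i r : pos_between i r <= m.
Proof. by rewrite /pos_between; have := row_len_le i.*2.+1 r; lia. Qed.

Variable s : state n m.
Definition occ_above (i : 'I_n.+1) (c : 'I_m) : bool := vabove s i c != None.
Definition occ_between (i : 'I_n) (c : 'I_m) : bool := vbetween s i c != None.

(** The edge to be omitted between the rows is the one for which [pos_between]
    vanishes, in accordance with the convention of [positions]. *)
Lemma same_edges_positions : same_vertical_edges U s <->
  (forall i : 'I_n, positions (occ_above (here i)) (n - i) (pos_above i) /\ positions (occ_between i) (n - i) (pos_between i)).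
Proof.
split=> [/forallP E i|R].
  split; apply: occ_positions.
  - exact: pos_above_dec.
  - by move=> *; apply: pos_above_le.
  - by move=> c; have /forallP/(_ c)/andP [/eqP e _] := E i; rewrite /occ_above e cols_aboveE.
  - exact: pos_between_dec.
  - by move=> *; apply: pos_between_le.
  - by move=> c; have /forallP/(_ c)/andP [_ /eqP e] := E i; rewrite /occ_between e cols_betweenE.
apply/forallP => i; apply/forallP => c; have [ra rb] := R i.
by rewrite cols_aboveE cols_betweenE -(positions_occ c ra) -(positions_occ c rb) !eqxx.
Qed.
End King.
End Shapes.

(** * The tableau of a state *)

Lemma rank_case n rho : rho < n.*2 ->
  (exists i : 'I_n, rho = i.*2) \/ (exists i : 'I_n, rho = i.*2.+1).
Proof.
move=> h; have hi : rho./2 < n by lia.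
have := odd_double_half rho; case: (odd rho) => e; [right|left]; exists (Ordinal hi);
  by rewrite /= -{1}e.
Qed.

Section StateCounts.
Variables (n m : nat) (lam : n.-tuple nat).
Hypothesis lam_part : sorted geq lam.
Hypothesis m_ge : head 0 lam + n <= m.
Variables (w : {perm letter n}) (s : state n m).
Hypothesis adm : admissible lam w s.

Definition count_above i d := count_from (occ_above s i) d.
Definition count_between i d := count_from (occ_between s i) d.

Lemma adm_gamma i k :
  gamma_ok (hgamma s i (next k), vabove s (here i) k, hgamma s i (here k), vbetween s i k).
Proof. by case/andP: adm => /forallP /(_ i) /and3P [/forallP /(_ k)]. Qed.

Lemma adm_delta i k :
  delta_ok (hdelta s i (next k), vbetween s i k, hdelta s i (here k), vabove s (next i) k).
Proof. by case/andP: adm => /forallP /(_ i) /and3P [_ /forallP /(_ k)]. Qed.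

Lemma adm_uturn i : hdelta s i ord0 = uturn (hgamma s i ord0).
Proof.
case/andP: adm => /forallP /(_ i) /and3P [_ _ h] _.
by apply/eqP; rewrite -uturn_okE.
Qed.

Lemma adm_gmax i : hgamma s i ord_max = None.
Proof. by case/andP: adm => _ /and5P [_ /forallP /(_ i) /eqP]. Qed.

Lemma adm_dmax i : hdelta s i ord_max != None.
Proof. by case/andP: adm => _ /and5P [_ _ /forallP /(_ i) /eqP ->]. Qed.

Lemma adm_gamma_flux i (k : 'I_m.+1) : (hgamma s i k != None) + count_between i k = count_above (here i) k.
Proof. exact: gamma_flux (adm_gamma i) (adm_gmax i) k. Qed.
Lemma adm_delta_flux i (k : 'I_m.+1) : (hdelta s i k != None) + count_between i k = (count_above (next i) k).+1.
Proof. exact: delta_flux (adm_delta i) (adm_dmax i) k. Qed.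
Lemma adm_gamma_upper i d : count_between i d <= count_above (here i) d.+1.
Proof. exact: gamma_upper (adm_gamma i) (adm_gmax i) d. Qed.
Lemma adm_gamma_lower i d : count_above (here i) d <= (count_between i d).+1.
Proof. exact: gamma_lower (adm_gamma i) (adm_gmax i) d. Qed.
Lemma adm_delta_upper i d : count_between i d <= (count_above (next i) d.+1).+1.
Proof. exact: delta_upper (adm_delta i) (adm_dmax i) d. Qed.
Lemma adm_delta_lower i d : count_above (next i) d <= count_between i d.
Proof. exact: delta_lower (adm_delta i) (adm_dmax i) d. Qed.

Lemma top_occ c : occ_above s ord0 c = [exists r : 'I_n, tnth lam r + (n - r) == c.+1].
Proof.
case/andP: adm => _ /and5P [_ _ _ /forallP h1 /forallP h2].
have sh (i : 'I_n) : (c == tnth lam i + (n - i.+1) :> nat) = (tnth lam i + (n - i) == c.+1).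
  by have := ltn_ord i; lia.
apply/idP/existsP => [oc|[i]].
  apply/existsP; apply: contraTT oc => /existsPn h; rewrite negbK.
  by apply: (implyP (h2 c)); apply/forallP => i; rewrite sh.
rewrite -sh => e; have /forallP/(_ c)/implyP/(_ e)/eqP := h1 i.
by rewrite /occ_above => ->.
Qed.

Lemma top_positions : positions (occ_above s ord0) n (fun r => nth 0 lam r + (n - r)).
Proof.
apply: occ_positions => [r r' h h'|r rn|c].
- have := lam_anti lam_part (r := Ordinal (ltn_trans h h')) (r' := Ordinal h') (ltnW h).
  by rewrite !(tnth_nth 0) /=; lia.
- by have := lam_head lam_part (Ordinal rn); rewrite (tnth_nth 0) /=; lia.
by rewrite top_occ; apply: eq_existsb => r; rewrite (tnth_nth 0).
Qed.

(** The U-turn conserves the number of particles, and each Delta row loses one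
    at its left end. *)
Lemma count_above_total i : count_above i 0 = n - i.
Proof.
elim/ord_up: i => [|i IH].
  rewrite subn0; apply/eqP; rewrite eqn_leq (positions_le _ top_positions) /=.
  case: (leqP n (count_above ord0 0)) => // h; have n0 : 0 < n by apply: leq_ltn_trans h.
  have := top_positions n.-1 0; rewrite -/(count_above ord0 0).
  have -> : (n.-1 < n) = true by apply/idP; lia.
  have -> : 0 < nth 0 lam n.-1 + (n - n.-1) by lia.
  move=> h'; have h2 : n.-1 < count_above ord0 0 by rewrite h'.
  by lia.
have g := adm_gamma_flux i ord0; have d := adm_delta_flux i ord0; rewrite adm_uturn /= in d.
have e : (uturn (hgamma s i ord0) != None) = (hgamma s i ord0 != None).
  by case: (hgamma _ _ _).
rewrite e in d; rewrite g in d.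
have d' : count_above (here i) 0 = (count_above (next i) 0).+1 by exact: d.
have -> : n - next i = (n - here i).-1 by rewrite /= /bump leq0n add1n subnS.
by rewrite -IH d'.
Qed.

Lemma count_above_le (i : 'I_n.+1) d : count_above i d <= n - i.
Proof. by rewrite -count_above_total; apply: count_from_mono. Qed.

Lemma count_between_le (i : 'I_n) d : count_between i d <= n - i.
Proof. by apply: leq_trans (adm_gamma_upper i d) (count_above_le _ _). Qed.

Lemma count_above_ge (i : 'I_n.+1) d : n - i <= count_above i d + d.
Proof.
elim: d => [|d IH]; first by rewrite addn0 count_above_total.
by apply: leq_trans IH _; rewrite addnS -addSn leq_add2r; apply: count_from_le1.
Qed.

(** The shape of the entries of rank at least [rho] of the tableau to be
    constructed, read off from the vertical edges above a Gamma row ([rho] even)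
    or below it ([rho] odd). The cell [(r, col)] belongs to it if the [r]-th
    particle is far enough to the left. *)
Definition level_count rho d : nat :=
  if odd rho then (if insub rho./2 is Some i then count_between i d else 0)
  else (if insub rho./2 is Some i then count_above i d else 0).
Definition state_shape rho r col := r < level_count rho (col + (n - rho./2 - r - odd rho)).

Lemma level_count_even (i : 'I_n.+1) d : level_count i.*2 d = count_above i d.
Proof. by rewrite /level_count odd_double doubleK valK. Qed.
Lemma level_count_odd (i : 'I_n) d : level_count i.*2.+1 d = count_between i d.
Proof. by rewrite /level_count /= odd_double /= uphalf_double valK. Qed.

Lemma level_count_le rho d : level_count rho d <= n - rho./2.
Proof.
rewrite /level_count; case: (odd rho); case: insubP => // i _ <-; [exact: count_between_le | exact: count_above_le].
Qed.

Lemma state_shape_bound rho r col : state_shape rho r col -> rho./2 + r < n.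
Proof. by move=> h; have := level_count_le rho (col + (n - rho./2 - r - odd rho)); move: h; rewrite /state_shape; lia. Qed.

Lemma state_shape_even (i : 'I_n.+1) r col : state_shape i.*2 r col = (r < count_above i (col + (n - i - r))).
Proof. by rewrite /state_shape level_count_even odd_double doubleK subn0. Qed.
Lemma state_shape_odd (i : 'I_n) r col : state_shape i.*2.+1 r col = (r < count_between i (col + (n - i - r.+1))).
Proof. by rewrite /state_shape level_count_odd /= odd_double /= uphalf_double -subnDA addn1. Qed.

Lemma state_shape_col rho r col col' : col <= col' -> state_shape rho r col' -> state_shape rho r col.
Proof.
rewrite /state_shape => h h'; apply: leq_trans h' _; rewrite /level_count.
by case: (odd rho); case: insubP => // i _ _; apply: count_from_mono; rewrite leq_add2r.
Qed.

(** Interlacing says that each shape contains the next one and, with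
    [state_shape_strict], that they differ by a horizontal strip. *)
Lemma state_shape_nest rho r col : state_shape rho.+1 r col -> state_shape rho r col.
Proof.
move=> h; have hb := state_shape_bound h.
have [|[i e]|[i e]] := @rank_case n rho; first by move: hb; lia.
  move: h hb; rewrite e state_shape_odd (state_shape_even (here i)) /= => h hb.
  apply: leq_trans h _; apply: leq_trans (adm_gamma_upper _ _) _; apply: count_from_mono => /=.
  by move: hb; rewrite uphalf_double; lia.
move: h hb; rewrite e -doubleS -[i.+1]/(val (next i)) state_shape_odd (state_shape_even (next i)) /= => h hb.
rewrite /bump /= add1n in h; rewrite subnS -subnS -subSS in h *.
by apply: leq_trans h _; apply: leq_trans (adm_delta_lower _ _) _; apply: count_from_mono; lia.
Qed.

Lemma state_shape_strict rho r col : rho < n.*2 -> state_shape rho r.+1 col -> state_shape rho.+1 r col.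
Proof.
move=> hr h; have hb := state_shape_bound h.
have [//|[i e]|[i e]] := @rank_case n rho.
  move: h; rewrite e state_shape_odd (state_shape_even (here i)) /= => h.
  by have := adm_gamma_lower i (col + (n - i - r.+1)); lia.
move: h hb; rewrite e -doubleS -[i.+1]/(val (next i)) state_shape_odd (state_shape_even (next i)) /= => h hb.
rewrite uphalf_double in hb; have := adm_delta_upper i (col + (n - i - r.+2)).
have -> : (col + (n - i - r.+2)).+1 = col + (n - bump 0 i - r) by rewrite /bump /=; lia.
by lia.
Qed.

Lemma state_shape0 (r : 'I_n) col : state_shape 0 r col = (col < tnth lam r).
Proof.
rewrite (state_shape_even ord0) /= subn0 top_positions ltn_ord (tnth_nth 0) /=.
by have := ltn_ord r; lia.
Qed.

Lemma state_shape_nest_le rho rho' r col : rho <= rho' -> state_shape rho' r col -> state_shape rho r col.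
Proof.
move=> h; rewrite -(subnKC h); elim: (rho' - rho) => [|j IH]; first by rewrite addn0.
by rewrite addnS => /state_shape_nest.
Qed.

Definition state_rank (c : cell lam) : nat :=
  #|[pred rho : 'I_(n.*2) | state_shape rho (rowc c) (colc c)]|.-1.

Definition state_tableau : {ffun cell lam -> letter n} :=
  [ffun c => (insubd (rowc c) (state_rank c)./2, odd (state_rank c))].

Lemma state_rankP (c : cell lam) rho :
  (rho <= letter_rank (state_tableau c)) = state_shape rho (rowc c) (colc c).
Proof.
have n0 : 0 < n by apply: leq_trans (ltn_ord (rowc c)).
have dc := @downset_card n.*2 (fun rho => state_shape rho (rowc c) (colc c)).
have {}dc k := dc k (fun i j ij => @state_shape_nest_le i j _ _ ij).
have pos : 0 < #|[pred rho : 'I_(n.*2) | state_shape rho (rowc c) (colc c)]|.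
  by rewrite dc double_gt0 n0 state_shape0 cell_lt.
have lt : state_rank c < n.*2.
  rewrite /state_rank prednK // -[leqRHS](card_ord n.*2); exact: max_card.
have -> : letter_rank (state_tableau c) = state_rank c.
  rewrite /letter_rank ffunE /= insubdK ?unfold_in; last by rewrite /=; lia.
  by rewrite addnC odd_double_half.
rewrite -ltnS /state_rank prednK // dc andbC; case h : (state_shape _ _ _) => //=.
by have := state_shape_bound h; lia.
Qed.

Lemma state_king : reverse_king state_tableau.
Proof.
apply/and3P; split.
- apply/forallP => c; apply/forallP => d; apply/implyP => /andP [/eqP e h].
  rewrite state_rankP e; apply: state_shape_col (ltnW h) _.
  by rewrite -state_rankP.
- apply/forallP => c; apply/forallP => d; apply/implyP => /andP [/eqP e h].
  rewrite state_rankP e.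
  have hd : state_shape (letter_rank (state_tableau d)) (rowc d) (colc d) by rewrite -state_rankP.
  have hb := state_shape_bound hd.
  have [j ej] : exists j, rowc d = (rowc c + j).+1 :> nat.
    by exists (rowc d - (rowc c).+1); lia.
  move: hd hb; rewrite ej; set R := letter_rank _ => hd hb.
  have : R < n.*2 by lia.
  move=> {}hb; elim: j hd {ej} => [|j IH]; rewrite ?addn0 ?addnS => hd.
    exact: state_shape_strict.
  by apply: IH; apply: state_shape_nest; apply: state_shape_strict.
apply/forallP => c; set R := letter_rank (state_tableau c).
have : state_shape R (rowc c) (colc c) by rewrite -state_rankP.
move/state_shape_bound; rewrite /letter_rank /= addn1; have := ltn_ord (rowc c).
by lia.
Qed.

Lemma in_shape_state rho (r : 'I_n) col : in_shape state_tableau rho r col = state_shape rho r col.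
Proof.
apply/existsP/idP => [[c /and3P [/eqP e1 /eqP e2]]|h].
  by rewrite state_rankP e1 e2.
have [|c [e1 e2]] := @cell_ex n lam lam_part r col.
  by rewrite -state_shape0; apply: state_shape_nest_le h.
by exists c; rewrite state_rankP e1 e2 !eqxx.
Qed.

Lemma state_edges : same_vertical_edges state_tableau s.
Proof.
apply/(same_edges_positions lam_part state_king m_ge) => i; split=> r d; last first.
  rewrite /pos_between; case: (ltnP r (n - i)) => h; last first.
    by apply/negbTE; rewrite -leqNgt; apply: leq_trans (count_between_le i d) h.
  case: (ltnP d (n - i - r.+1)) => hd.
    rewrite (leq_trans hd) ?leq_addl //.
    have := adm_gamma_lower i d; have := count_above_ge (here i) d; rewrite /= -/(count_between i d); lia.
  have rn : r < n by lia.
  rewrite -[d](subnK hd) ltn_add2r (row_lenP lam_part state_king _ _ _).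
  by rewrite (in_shape_state _ (Ordinal rn)) state_shape_odd.
rewrite /pos_above; case: (ltnP r (n - i)) => h; last first.
  by apply/negbTE; rewrite -leqNgt; apply: leq_trans (count_above_le (here i) d) h.
case: (ltnP d (n - i - r)) => hd.
  rewrite (leq_trans hd) ?leq_addl //.
  have := count_above_ge (here i) d; rewrite /= -/(count_above (here i) d); lia.
have rn : r < n by lia.
rewrite -[d](subnK hd) ltn_add2r (row_lenP lam_part state_king _ _ _).
by rewrite (in_shape_state _ (Ordinal rn)) (state_shape_even (here i)).
Qed.
End StateCounts.

(** * States with given occupied edges *)

Section RowEvolution.
Variables n m : nat.
Notation spin := (spin n).
Notation occ f := (fun c => f c != None).
Implicit Types (l t r b a : spin) (o : bool).

(** The outgoing spins of a vertex entered by [a] horizontally and by [t] from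
    above; [o] tells whether the bottom edge shall be occupied, and matters only
    if [a] comes alone. Two colors that meet are separated by [mx] and [mn]. *)
Definition step_h (mx : spin -> spin -> spin) a t o : spin :=
  match a, t with
  | None, _ => t
  | Some _, None => if o then None else a
  | Some _, Some _ => mx a t
  end.
Definition step_v (mn : spin -> spin -> spin) a t o : spin :=
  match a, t with
  | None, _ => None
  | Some _, None => if o then a else None
  | Some _, Some _ => mn a t
  end.

Lemma gamma_step l t o : gamma_ok (l, t, step_h (@spin_max n) l t o, step_v (@spin_min n) l t o).
Proof.
by rewrite gamma_okE; case: l t o => [c|] [c'|] [] /=; rewrite ?eqxx ?orbT.
Qed.

Lemma delta_step r t o : delta_ok (step_h (@spin_min n) r t o, t, r, step_v (@spin_max n) r t o).
Proof.
by rewrite delta_okE; case: r t o => [c|] [c'|] [] /=; rewrite ?eqxx ?orbT.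
Qed.

Lemma step_v_occ (mn : spin -> spin -> spin) a t o :
  (forall c c', mn (Some c) (Some c') != None) ->
  (a != None -> t != None -> o) -> (a = None -> ~~ o) -> (step_v mn a t o != None) = o.
Proof.
move=> mnP; case: a t o => [c|] [c'|] [] //= h1 h2; rewrite ?mnP //.
- by have := h1 isT isT.
- by have := h2 erefl.
- by have := h2 erefl.
Qed.

Definition spin_at (f : 'I_m -> spin) (c : nat) : spin := oapp f None (insub c).
Definition occ_at (f : 'I_m -> bool) (c : nat) : bool := oapp f false (insub c).
Lemma spin_atE f (k : 'I_m) : spin_at f k = f k. Proof. by rewrite /spin_at valK. Qed.
Lemma occ_atE f (k : 'I_m) : occ_at f k = f k. Proof. by rewrite /occ_at valK. Qed.

Variables (t : 'I_m -> spin) (ob : 'I_m -> bool).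

Fixpoint from_left (j : nat) : spin :=
  if j is j'.+1 then step_h (@spin_max n) (from_left j') (spin_at t (m - j)) (occ_at ob (m - j)) else None.

(** Where the bottom edge is forced to be occupied or empty, the interlacing
    condition agrees. *)
Lemma gamma_row_ex :
  (forall d, count_from ob d <= count_from (occ t) d.+1) -> (forall d, count_from (occ t) d <= (count_from ob d).+1) ->
  exists (h : {ffun 'I_m.+1 -> spin}) (b : {ffun 'I_m -> spin}),
    [/\ forall k, gamma_ok (h (next k), t k, h (here k), b k), h ord_max = None
      & forall k, (b k != None) = ob k].
Proof.
move=> up lo.
pose h : {ffun 'I_m.+1 -> spin} := [ffun i : 'I_m.+1 => from_left (m - i)].
pose b : {ffun 'I_m -> spin} := [ffun k => step_v (@spin_min n) (h (next k)) (t k) (ob k)].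
have hS k : h (here k) = step_h (@spin_max n) (h (next k)) (t k) (ob k).
  rewrite !ffunE /= /bump /= add1n -(subnSK (ltn_ord k)) /=.
  by rewrite subnSK ?ltn_ord // subKn ?spin_atE ?occ_atE // ltnW.
have bE k : b k = step_v (@spin_min n) (h (next k)) (t k) (ob k) by rewrite [b k]ffunE.
have ok k : gamma_ok (h (next k), t k, h (here k), b k).
  by rewrite hS bE; apply: gamma_step.
have hm : h ord_max = None by rewrite ffunE /= subnn.
have flux i : (h i != None) + count_from ob i = count_from (occ t) i /\
   forall k : 'I_m, i <= k -> (b k != None) = ob k.
  elim/ord_down: i => [|k [IH bo]].
    rewrite hm !count_from_big //; split=> // k /= mk.
    by have := ltn_ord k; rewrite ltnNge mk.
  rewrite /= /bump /= add1n in IH bo.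
  have e1 := count_from_step ob k; have e2 := count_from_step (occ t) k; rewrite /= in e2.
  have up' := up k; have lo' := lo k.
  have bk : (b k != None) = ob k.
    rewrite bE; apply: step_v_occ; first exact: spin_min_neq0.
      move=> hk tk; rewrite hk tk in IH e2.
      by case: (ob k) e1 => // e1; move: lo'; rewrite e1 e2 -IH /= !(add0n, add1n) ltnn.
    move=> hk; rewrite hk in IH.
    by case: (ob k) e1 => // e1; move: up'; rewrite e1 -IH /= !(add0n, add1n) ltnn.
  split.
    have [e _] := gamma_occ (ok k).
    by rewrite /= e1 e2 -IH -bk addnA -e [X in X + _ = _]addnC addnA.
  move=> k' /=; rewrite leq_eqVlt => /orP [/eqP e|]; last exact: bo.
  by rewrite -(val_inj e : k = k').
exists h, b; split=> // k.
by have [_ ->] := flux ord0.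
Qed.

Variable u : spin.
Fixpoint from_right (j : nat) : spin :=
  if j is j'.+1 then step_h (@spin_min n) (from_right j') (spin_at t j') (occ_at ob j') else u.

Lemma delta_row_ex :
  (forall d, count_from (occ t) d <= (count_from ob d.+1).+1) -> (forall d, count_from ob d <= count_from (occ t) d) ->
  (u != None) + count_from (occ t) 0 = (count_from ob 0).+1 ->
  exists (h : {ffun 'I_m.+1 -> spin}) (b : {ffun 'I_m -> spin}),
    [/\ forall k, delta_ok (h (next k), t k, h (here k), b k), h ord0 = u, h ord_max != None
      & forall k, (b k != None) = ob k].
Proof.
move=> up lo u0.
pose h : {ffun 'I_m.+1 -> spin} := [ffun i : 'I_m.+1 => from_right i].
pose b : {ffun 'I_m -> spin} := [ffun k => step_v (@spin_max n) (h (here k)) (t k) (ob k)].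
have hS k : h (next k) = step_h (@spin_min n) (h (here k)) (t k) (ob k).
  by rewrite !ffunE /= ?/bump /= ?add1n /= spin_atE occ_atE.
have bE k : b k = step_v (@spin_max n) (h (here k)) (t k) (ob k) by rewrite [b k]ffunE.
have ok k : delta_ok (h (next k), t k, h (here k), b k).
  by rewrite hS bE; apply: delta_step.
have h0 : h ord0 = u by rewrite ffunE.
have flux i : (h i != None) + count_from (occ t) i = (count_from ob i).+1 /\
   forall k : 'I_m, k < i -> (b k != None) = ob k.
  elim/ord_up: i => [|k [IH bo]]; first by rewrite h0.
  rewrite /= in IH bo.
  have e1 := count_from_step ob k; have e2 := count_from_step (occ t) k; rewrite /= in e2.
  have up' := up k; have lo' := lo k.
  have bk : (b k != None) = ob k.
    rewrite bE; apply: step_v_occ; first exact: spin_max_neq0.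
      move=> hk tk; rewrite hk tk in IH e2.
      case: (ob k) e1 => // e1; have := lo k.+1.
      by move: IH; rewrite e1 e2 !(add0n, add1n) => -[<-]; rewrite ltnn.
    move=> hk; rewrite hk in IH.
    case: (ob k) e1 => // e1; move: up'.
    by move: IH; rewrite e1 !(add0n, add1n) => ->; rewrite ltnn.
  have [e _] := delta_occ (ok k).
  split.
    apply: (@addnI (b k != None)); rewrite /= /bump /= add1n addnA [_ + (h _ != None)]addnC -e.
    rewrite -addnA -e2 IH e1 -bk addnS; congr (_.+1); by rewrite addnC.
  move=> k'; rewrite /= /bump /= add1n ltnS leq_eqVlt => /orP [/eqP e'|]; last exact: bo.
  by rewrite (val_inj e' : k' = k).
exists h, b; split=> //; last by move=> k; have [_ ->] := flux ord_max.
by have [] := flux ord_max; rewrite !count_from_big // addn0; case: (h ord_max).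
Qed.
End RowEvolution.

(** * The state of a tableau *)

Section ColorContent.
Variables n m : nat.

Definition content (p : pred (letter n)) (a : spin n) : nat :=
  if a is Some c then p c else false.

Lemma content_min_max p (c c' : letter n) :
  content p (spin_max (Some c) (Some c')) + content p (spin_min (Some c) (Some c')) =
  content p (Some c) + content p (Some c').
Proof. by rewrite /spin_max /spin_min /smax /smin; case: ifP; rewrite // addnC. Qed.

Lemma gamma_content p l t r b : gamma_ok (l, t, r, b) ->
  content p l + content p t = content p r + content p b.
Proof.
rewrite gamma_okE; case: l t => [c|] [c'|] /=.
- by case/andP=> /eqP -> /eqP ->; rewrite content_min_max.
- by case/orP => /andP [/eqP -> /eqP ->] //; rewrite addnC.
- by case/andP=> /eqP -> /eqP ->; rewrite addnC.
- by case/andP=> /eqP -> /eqP ->.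
Qed.

Lemma delta_content p l t r b : delta_ok (l, t, r, b) ->
  content p r + content p t = content p l + content p b.
Proof.
rewrite delta_okE; case: r t => [c|] [c'|] /=.
- by case/andP=> /eqP -> /eqP ->; rewrite addnC [RHS]addnC content_min_max addnC.
- by case/orP => /andP [/eqP -> /eqP ->] //; rewrite addnC.
- by case/andP=> /eqP -> /eqP ->; rewrite addnC.
- by case/andP=> /eqP -> /eqP ->.
Qed.

Lemma telescope_ord M (f : 'I_M.+1 -> nat) (a b : 'I_M -> nat) :
  (forall k, f (next k) + a k = f (here k) + b k) ->
  f ord_max + \sum_k a k = f ord0 + \sum_k b k.
Proof.
move=> H; have : \sum_k (f (next k) + a k) = \sum_k (f (here k) + b k).
  by apply: eq_bigr => k _.
rewrite !big_split /=.
have e1 : \sum_(i < M.+1) f i = f ord0 + \sum_k f (next k) by rewrite big_ord_recl.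
have e2 : \sum_(i < M.+1) f i = \sum_k f (here k) + f ord_max by rewrite big_ord_recr.
rewrite e2 in e1; move: e1.
move: (\sum_k f (next k)) (\sum_k f (here k)) (\sum_k a k) (\sum_k b k) => S1 S2 A B.
by move: (f ord_max) (f ord0) => x y; lia.
Qed.
End ColorContent.

Section Exits.
Variables (n m : nat) (lam : n.-tuple nat).
Hypothesis lam_part : sorted geq lam.
Hypothesis m_ge : head 0 lam + n <= m.
Variable s : state n m.
Hypothesis ok : local_ok s.
Hypothesis gmax : forall i, hgamma s i ord_max = None.
Hypothesis bot : forall c, vabove s ord_max c = None.
Variable x : 'I_n -> letter n.
Hypothesis dmax : forall i, hdelta s i ord_max = Some (x i).
Hypothesis top : forall c, vabove s ord0 c =
  omap (fun i => (i, false)) [pick i : 'I_n | c == tnth lam i + (n - i.+1) :> nat].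

(** Each index enters once at the top, and it is conserved by vertices and
    U-turns; so it exits once. *)
Lemma exits_inj : injective (fun i => (x i).1).
Proof.
have row k i : \sum_c content (fun c => c.1 == k) (vabove s (here i) c) =
    ((x i).1 == k) + \sum_c content (fun c => c.1 == k) (vabove s (next i) c).
  have /and3P [/forallP g /forallP d u] := forallP ok i.
  have eg := @telescope_ord m (fun c => content (fun c => c.1 == k) (hgamma s i c)) _ _ (fun c => gamma_content _ (g c)).
  have ed := @telescope_ord m (fun c => content (fun c => c.1 == k) (hdelta s i c))
    (fun c => content (fun c => c.1 == k) (vabove s (next i) c)) (fun c => content (fun c => c.1 == k) (vbetween s i c))
    (fun c => esym (delta_content _ (d c))).
  rewrite gmax dmax /= in eg ed.
  have eu : content (fun c => c.1 == k) (hdelta s i ord0) = content (fun c => c.1 == k) (hgamma s i ord0).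
    by move: u; rewrite uturn_okE => /eqP ->; case: (hgamma s i ord0).
  by rewrite ed eu -eg.
have tot k : \sum_i ((x i).1 == k) = \sum_c content (fun c => c.1 == k) (vabove s ord0 c).
  have := @telescope_ord n (fun i => \sum_c content (fun c => c.1 == k) (vabove s i c))
    (fun i => (x i).1 == k : nat) (fun=> 0).
  rewrite [X in _ = _ + X]big1 // addn0 => <-.
    by rewrite [X in X + _]big1 // => c _; rewrite bot.
  by move=> i; rewrite row addn0 addnC.
have top1 k : \sum_c content (fun c => c.1 == k) (vabove s ord0 c) <= 1.
  have le c : content (fun c => c.1 == k) (vabove s ord0 c) <= (c == tnth lam k + (n - k.+1) :> nat).
    by rewrite top; case: pickP => [i /eqP e|] //=; case: eqP => // <-; rewrite e eqxx.
  apply: (@leq_trans (\sum_(c < m) (c == tnth lam k + (n - k.+1) :> nat))).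
    by apply: leq_sum => c _; apply: le.
  case: (ltnP (tnth lam k + (n - k.+1)) m) => h.
    rewrite (bigD1 (Ordinal h)) //= eqxx big1 // => c.
    by rewrite -val_eqE /= => /negPf ->.
  rewrite big1 // => c _; apply/eqP; rewrite eqb0; apply/negP => /eqP e.
  by have := ltn_ord c; rewrite e ltnNge h.
move=> i j e; apply/eqP; apply/negPn/negP => ij.
have := top1 (x i).1; rewrite -tot (bigD1 i) //= (bigD1 j) 1?eq_sym //= e eqxx.
by rewrite addnA.
Qed.

(** The values at the unbarred letters are given; those at the barred ones are
    forced. *)
Lemma exits_perm : exists2 w, w \in W n & forall i, Some (bar (w^-1%g (i, false))) = hdelta s i ord_max.
Proof.
pose g (y : letter n) : letter n := if y.2 then x y.1 else bar (x y.1).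
have gi : injective g.
  move=> [i b] [j b'] e.
  have ij : i = j.
    apply: exits_inj; move: (congr1 fst e); rewrite /g /=.
    by case: b {e}; case: b'.
  rewrite -ij in e *; congr (_, _); move: e; rewrite /g /=.
  case: b; case: b' => // /eqP; first by rewrite eq_sym (negPf (bar_neq _)).
  by rewrite (negPf (bar_neq _)).
exists ((perm gi)^-1)%g.
  apply: W_inv; apply/WP => -[i b]; rewrite !permE /g /bar /=.
  by case: b => //=; rewrite negbK; case: (x i).
by move=> i; rewrite invgK permE /g /= barK dmax.
Qed.
End Exits.

Section Evolution.
Variables (n m : nat) (lam : n.-tuple nat).
Hypothesis lam_part : sorted geq lam.
Hypothesis m_ge : head 0 lam + n <= m.
Variable U : {ffun cell lam -> letter n}.
Hypothesis kU : reverse_king U.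
Notation spin := (spin n).

Definition tab_above i (c : 'I_m) : bool := [exists r : 'I_(n - i), pos_above U i r == c.+1].
Definition tab_between i (c : 'I_m) : bool := [exists r : 'I_(n - i), pos_between U i r == c.+1].

Lemma tab_above_positions i : positions (tab_above i) (n - i) (pos_above U i).
Proof.
apply: occ_positions => [r r'|r _|c] //; first exact: (pos_above_dec lam_part kU).
exact: (pos_above_le lam_part kU m_ge).
Qed.
Lemma tab_between_positions i : positions (tab_between i) (n - i) (pos_between U i).
Proof.
apply: occ_positions => [r r'|r _|c] //; first exact: (pos_between_dec lam_part kU).
exact: (pos_between_le lam_part kU m_ge).
Qed.

Lemma leq_lt_all (a b : nat) : (forall r, r < a -> r < b) -> a <= b.
Proof. by move=> H; case: (leqP a b) => // /H; rewrite ltnn. Qed.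
Lemma leq_lt_allS (a b : nat) : (forall r, r.+1 < a -> r < b) -> a <= b.+1.
Proof. by move=> H; case: (leqP a b.+1) => // /H; rewrite ltnn. Qed.

Lemma tab_above_total i : count_from (tab_above i) 0 = n - i.
Proof.
apply/eqP; rewrite eqn_leq (positions_le _ (tab_above_positions i)) /=.
by apply: leq_lt_all => r h; rewrite tab_above_positions h /pos_above; lia.
Qed.

Lemma tab_between_upper i d : count_from (tab_between i) d <= count_from (tab_above i) d.+1.
Proof.
apply: leq_lt_all => r; rewrite tab_between_positions tab_above_positions /pos_above /pos_between.
by have := row_len_mono lam_part kU i.*2 r; lia.
Qed.
Lemma tab_above_lower i d : count_from (tab_above i) d <= (count_from (tab_between i) d).+1.
Proof.
apply: leq_lt_allS => r; rewrite tab_between_positions tab_above_positions /pos_above /pos_between.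
by have := row_len_strict lam_part kU i.*2 r; lia.
Qed.
Lemma tab_between_upperS i d : count_from (tab_between i) d <= (count_from (tab_above i.+1) d.+1).+1.
Proof.
apply: leq_lt_allS => r; rewrite tab_between_positions tab_above_positions /pos_above /pos_between doubleS.
by have := row_len_strict lam_part kU i.*2.+1 r; lia.
Qed.
Lemma tab_above_lowerS i d : count_from (tab_above i.+1) d <= count_from (tab_between i) d.
Proof.
apply: leq_lt_all => r; rewrite tab_between_positions tab_above_positions /pos_above /pos_between doubleS.
by have := row_len_mono lam_part kU i.*2.+1 r; lia.
Qed.

Definition row_type : finType := ({ffun 'I_m -> spin} * {ffun 'I_m.+1 -> spin} *
  {ffun 'I_m.+1 -> spin} * {ffun 'I_m -> spin})%type.

Definition row_good (i : nat) (V : {ffun 'I_m -> spin}) (d : row_type) : bool :=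
  let: (b, h, h', V') := d in
  [&& [forall k, gamma_ok (h (next k), V k, h (here k), b k)],
      [forall k, delta_ok (h' (next k), b k, h' (here k), V' k)],
      h' ord0 == uturn (h ord0), h ord_max == None, h' ord_max != None,
      [forall k, (b k != None) == tab_between i k] & [forall k, (V' k != None) == tab_above i.+1 k]].

Lemma row_good_ex i (V : {ffun 'I_m -> spin}) : i < n -> (forall k, (V k != None) = tab_above i k) -> exists d, row_good i V d.
Proof.
move=> iN VE.
have cV d : count_from (fun c => V c != None) d = count_from (tab_above i) d by apply: eq_count_from.
have [||h [b [g hm bE]]] := @gamma_row_ex n m V (tab_between i).
- by move=> d; rewrite cV tab_between_upper.
- by move=> d; rewrite cV tab_above_lower.
have cb d : count_from (fun c => b c != None) d = count_from (tab_between i) d by apply: eq_count_from.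
have [|||h' [V' [d h0 hm' V'E]]] := @delta_row_ex n m b (tab_above i.+1) (uturn (h ord0)).
- by move=> d; rewrite cb tab_between_upperS.
- by move=> d; rewrite cb tab_above_lowerS.
- have := gamma_flux g hm ord0; rewrite cV cb !tab_above_total => e.
  have -> : (uturn (h ord0) != None) = (h ord0 != None) by case: (h ord0).
  by apply: etrans e _; rewrite /=; lia.
exists (b, h, h', V'); apply/and5P; split; [exact/forallP|exact/forallP|exact/eqP|exact/eqP|].
by rewrite hm' /=; apply/andP; split; apply/forallP => k; apply/eqP.
Qed.

Definition top_row : {ffun 'I_m -> spin} :=
  [ffun c : 'I_m => omap (fun i => (i, false)) [pick i : 'I_n | c == tnth lam i + (n - i.+1) :> nat]].

(** The default value is never taken when [V] is occupied according to [U], by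
    [row_good_ex]. *)
Definition next_row i V : row_type :=
  odflt ([ffun=> None], [ffun=> None], [ffun=> None], [ffun=> None]) [pick d | row_good i V d].

Fixpoint rows_from_top i : {ffun 'I_m -> spin} :=
  if i is i'.+1 then (next_row i' (rows_from_top i')).2 else top_row.

Lemma top_rowE c : (top_row c != None) = tab_above 0 c.
Proof.
rewrite ffunE; apply/idP/existsP.
  case: pickP => [i /eqP e _|] //=; have h : i < n - 0 by rewrite subn0.
  exists (Ordinal h); rewrite /pos_above /= (row_len0 lam_part kU) e; have := ltn_ord i.
  by lia.
case=> r /eqP; rewrite /pos_above /= => e; have h : r < n by have := ltn_ord r; lia.
case: pickP => // /(_ (Ordinal h)); rewrite -(row_len0 lam_part kU) /= => /negP []; apply/eqP.
by move: e; rewrite double0; move: (nat_of_ord r) h => r0; lia.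
Qed.

Lemma rows_good i : i <= n -> (forall k, (rows_from_top i k != None) = tab_above i k) /\
  (i < n -> row_good i (rows_from_top i) (next_row i (rows_from_top i))).
Proof.
have nr j V : (exists d, row_good j V d) -> row_good j V (next_row j V).
  by move=> [d h]; rewrite /next_row; case: pickP => //= /(_ d); rewrite h.
elim: i => [|i IH] iN.
  by split; [exact: top_rowE | move=> n0; apply: nr; apply: row_good_ex; first by []; exact: top_rowE].
have E k : (rows_from_top i.+1 k != None) = tab_above i.+1 k.
  have [_ /(_ iN)] := IH (ltnW iN); rewrite /=.
  case: (next_row _ _) => [[[b h] h'] V'] /and5P [_ _ _ _ /and3P [_ _ /forallP H]].
  exact: (eqP (H k)).
by split=> // iN'; apply: nr; apply: row_good_ex.
Qed.

Definition evolved_state : state n m :=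
  let R i := next_row i (rows_from_top i) in
  ([ffun p : 'I_n.+1 * 'I_m => rows_from_top p.1 p.2],
   [ffun p : 'I_n * 'I_m => (R p.1).1.1.1 p.2],
   [ffun p : 'I_n * 'I_m.+1 => (R p.1).1.1.2 p.2],
   [ffun p : 'I_n * 'I_m.+1 => (R p.1).1.2 p.2]).

(** The exits are not prescribed: they turn out to be those of a signed
    permutation, which is the key. *)
Lemma evolvedP : exists w, [/\ w \in W n, admissible lam w evolved_state
                             & same_vertical_edges U evolved_state].
Proof.
set s := evolved_state.
have good (i : 'I_n) : row_good i [ffun c => vabove s (here i) c]
    ([ffun c => vbetween s i c], [ffun c => hgamma s i c], [ffun c => hdelta s i c],
     [ffun c => vabove s (next i) c]).
  have [_ /(_ (ltn_ord i))] := rows_good (ltnW (ltn_ord i)).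
  have -> : [ffun c => vabove s (here i) c] = rows_from_top i.
    by apply/ffunP => c; rewrite ffunE /vabove ffunE.
  case e : (next_row _ _) => [[[b h] h'] V'].
  have -> : [ffun c => vbetween s i c] = b by apply/ffunP => c; rewrite ffunE /vbetween ffunE /= e.
  have -> : [ffun c => hgamma s i c] = h by apply/ffunP => c; rewrite ffunE /hgamma ffunE /= e.
  have -> : [ffun c => hdelta s i c] = h' by apply/ffunP => c; rewrite ffunE /hdelta ffunE /= e.
  have -> // : [ffun c => vabove s (next i) c] = V'.
  by apply/ffunP => c; rewrite ffunE /vabove ffunE; change (rows_from_top i.+1 c = V' c); rewrite /= e.
have lo : local_ok s.
  apply/forallP => i; have /and5P [/forallP g /forallP d /eqP u _ _] := good i.
  apply/and3P; split; try (apply/forallP => k).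
  - by have := g k; rewrite !ffunE.
  - by have := d k; rewrite !ffunE.
  - by rewrite uturn_okE; move: u; rewrite !ffunE => ->.
have gm i : hgamma s i ord_max = None.
  by have /and5P [_ _ _ /eqP h _] := good i; rewrite ffunE in h.
have dm i : hdelta s i ord_max != None.
  by have /and5P [_ _ _ _ /and3P [h _ _]] := good i; rewrite ffunE in h.
have oE i c : (vabove s i c != None) = tab_above i c.
  have [e _] := rows_good (leq_ord i); by rewrite -e /vabove ffunE.
have bot c : vabove s ord_max c = None.
  apply/eqP; apply: negPn; rewrite oE; apply/existsP => -[[r]] /=.
  by rewrite subnn ltn0.
have top c : vabove s ord0 c =
    omap (fun i => (i, false)) [pick i : 'I_n | c == tnth lam i + (n - i.+1) :> nat].
  by rewrite /vabove ffunE /= ffunE.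
have [x xE] : exists x : 'I_n -> letter n, forall i, hdelta s i ord_max = Some (x i).
  exists (fun i => odflt (i, false) (hdelta s i ord_max)) => i.
  by have := dm i; case: (hdelta s i ord_max).
have [w wW we] := exits_perm lo gm bot xE top.
exists w; split=> //.
  rewrite /admissible lo /=; apply/and5P; split.
  - by apply/forallP => c; rewrite bot.
  - by apply/forallP => i; rewrite gm.
  - by apply/forallP => i; rewrite we.
  - apply/forallP => i; apply/forallP => c; apply/implyP => /eqP e; rewrite top.
    case: pickP => [j /eqP e'|/(_ i)]; last by rewrite e eqxx.
    apply/eqP; congr (Some (_, _)); apply/val_inj/eqP => /=; rewrite eqn_leq.
    have := ltn_ord i; have := ltn_ord j.
    case: (ltngtP i j) => // ij.
      by have := lam_anti lam_part (ltnW ij); lia.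
    by have := lam_anti lam_part (ltnW ij); lia.
  - apply/forallP => c; apply/implyP => /forallP h; rewrite top.
    by case: pickP => [i|//]; rewrite (negPf (h i)).
apply/forallP => i; apply/forallP => c.
rewrite cols_aboveE ?cols_betweenE // oE eqxx /=.
have /and5P [_ _ _ _ /and3P [_ /forallP /(_ c)]] := good i.
by rewrite ffunE.
Qed.
End Evolution.

(** * States, tableaux and exits determine each other *)

Lemma letter_rank_inj n : injective (@letter_rank n).
Proof.
move=> [i b] [j b']; rewrite /letter_rank /= => e.
have eb : b = b' by move: (congr1 odd e); rewrite !oddD !odd_double; case: b {e}; case: b'.
by rewrite -eb in e *; congr (_, _); apply/val_inj => /=; lia.
Qed.

Section Correspondence.
Variables (n m : nat) (lam : n.-tuple nat).
Hypothesis lam_part : sorted geq lam.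
Hypothesis m_ge : head 0 lam + n <= m.
Implicit Types (U : {ffun cell lam -> letter n}) (s : state n m) (w : {perm letter n}).

Lemma adm_top w s c : admissible lam w s -> vabove s ord0 c =
  omap (fun i => (i, false)) [pick i : 'I_n | c == tnth lam i + (n - i.+1) :> nat].
Proof.
case/andP => _ /and5P [_ _ _ /forallP h1 /forallP h2].
case: pickP => [i e|h] /=.
  by have /forallP/(_ c)/implyP/(_ e)/eqP := h1 i.
by apply/eqP; apply: (implyP (h2 c)); apply/forallP => i; rewrite h.
Qed.

(** Rows are determined from top to bottom, a Gamma row from left to right and
    then, after the U-turn, a Delta row from right to left. *)
Lemma state_unique U w w' s s' : admissible lam w s -> admissible lam w' s' ->
  same_vertical_edges U s -> same_vertical_edges U s' -> s = s'.
Proof.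
move=> a a' e e'.
have occA_eq (i : 'I_n.+1) c : (vabove s i c != None) = (vabove s' i c != None).
  case: (ltnP i n) => h.
    have -> : i = here (Ordinal h) by apply/val_inj.
    have /forallP/(_ c)/andP [/eqP -> _] := forallP e (Ordinal h).
    by have /forallP/(_ c)/andP [/eqP -> _] := forallP e' (Ordinal h).
  have -> : i = ord_max by apply/val_inj => /=; have := ltn_ord i; lia.
  case/andP: a => _ /and5P [/forallP /(_ c) /eqP -> _ _ _ _].
  by case/andP: a' => _ /and5P [/forallP /(_ c) /eqP -> _ _ _ _].
have occB_eq i c : (vbetween s i c != None) = (vbetween s' i c != None).
  have /forallP/(_ c)/andP [_ /eqP ->] := forallP e i.
  by have /forallP/(_ c)/andP [_ /eqP ->] := forallP e' i.
have gam (i : 'I_n) : (forall c, vabove s (here i) c = vabove s' (here i) c) ->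
    forall c, hgamma s i c = hgamma s' i c /\
      forall k : 'I_m, c <= k -> vbetween s i k = vbetween s' i k.
  move=> eV; elim/ord_down => [|c [IH IHb]].
    rewrite (adm_gmax a) (adm_gmax a'); split=> // k /= mk.
    by have := ltn_ord k; rewrite ltnNge mk.
  have g := adm_gamma a i c; have g' := adm_gamma a' i c.
  rewrite -IH -eV in g'; have [e1 e2] := gamma_det g g' (occB_eq _ _).
  split=> // k /=; rewrite leq_eqVlt => /orP [/eqP ek|ck]; last by apply: IHb; rewrite /= /bump /= add1n.
  by rewrite -(val_inj ek : c = k).
have del (i : 'I_n) : (forall c, vabove s (here i) c = vabove s' (here i) c) ->
    forall c, hdelta s i c = hdelta s' i c /\
      forall k : 'I_m, k < c -> vabove s (next i) k = vabove s' (next i) k.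
  move=> eV; have eB k : vbetween s i k = vbetween s' i k by have [_ ->] := gam i eV ord0.
  elim/ord_up => [|c [IH IHb]].
    by rewrite (adm_uturn a) (adm_uturn a'); have [-> _] := gam i eV ord0.
  have g := adm_delta a i c; have g' := adm_delta a' i c.
  rewrite -IH -eB in g'; have [e1 e2] := delta_det g g' (occA_eq _ _).
  split=> // k; rewrite /= /bump /= add1n ltnS leq_eqVlt => /orP [/eqP ek|ck]; last exact: IHb.
  by rewrite (val_inj ek : k = c).
have eV i c : vabove s i c = vabove s' i c.
  elim/ord_up: i c => [|i IH] c; first by rewrite (adm_top c a) (adm_top c a').
  by have [_ ->] := del i IH ord_max.
have eB i k : vbetween s i k = vbetween s' i k by have [_ ->] := gam i (eV _) ord0.
have eG i k : hgamma s i k = hgamma s' i k by have [-> _] := gam i (eV _) k.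
have eD i k : hdelta s i k = hdelta s' i k by have [-> _] := del i (eV _) k.
case: s s' {a a' e e' occA_eq occB_eq gam del} eV eB eG eD => [[[A B] G] D] [[[A' B'] G'] D'].
rewrite /vabove /vbetween /hgamma /hdelta /= => eV eB eG eD.
by congr (_, _, _, _); apply/ffunP => -[i c].
Qed.

Lemma exit_unique w w' s : w \in W n -> w' \in W n ->
  admissible lam w s -> admissible lam w' s -> w = w'.
Proof.
move=> wW wW' /andP [_ /and5P [_ _ /forallP e _ _]] /andP [_ /and5P [_ _ /forallP e' _ _]].
have /WP vb := W_inv wW; have /WP vb' := W_inv wW'.
have H i : (w^-1)%g (i, false) = (w'^-1)%g (i, false).
  have := e i; rewrite (eqP (e' i)) => /eqP [h1 h2]; apply: (can_inj (@barK n)).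
  by rewrite /bar h1 h2.
apply: invg_inj; apply/permP => -[i []]; last exact: H.
by rewrite -[(i, true)]/(bar (i, false)) vb vb' H.
Qed.

(** The positions of the particles determine the shapes of all subtableaux. *)
Lemma tableau_unique U U' s : reverse_king U -> reverse_king U' ->
  same_vertical_edges U s -> same_vertical_edges U' s -> U = U'.
Proof.
have ltP (a b : nat) : (forall d, (d < a) = (d < b)) -> a = b.
  by move=> H; case: (ltngtP a b) => // h; [have := H a | have := H b]; rewrite h ltnn.
move=> k k' e e'; have R := (same_edges_positions lam_part k m_ge s).1 e.
have R' := (same_edges_positions lam_part k' m_ge s).1 e'; clear e e'.
have shE rho r : rho < n.*2 -> row_len U rho r = row_len U' rho r.
  move=> hr; have [|[i e]|[i e]] := @rank_case n rho; first by [].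
    case: (ltnP r (n - i)) => h; last first.
      by rewrite (row_len_out lam_part k h) ?(row_len_out lam_part k' h) // e ?leqnSn.
    have : pos_above U i r = pos_above U' i r; last by rewrite /pos_above e; lia.
    apply: ltP => d; have [r1 _] := R i; have [r2 _] := R' i.
    by have := r1 r d; rewrite r2 h.
  case: (ltnP r (n - i)) => h; last first.
    by rewrite (row_len_out lam_part k h) ?(row_len_out lam_part k' h) // e ?leqnSn.
  have : pos_between U i r = pos_between U' i r; last by rewrite /pos_between e; lia.
  apply: ltP => d; have [_ r1] := R i; have [_ r2] := R' i.
  by have := r1 r d; rewrite r2 h.
have rk (V : {ffun cell lam -> letter n}) (c : cell lam) : letter_rank (V c) < n.*2.
  by rewrite /letter_rank; have := ltn_ord (V c).1; case: (V c).2; lia.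
apply/ffunP => c; apply: letter_rank_inj; apply/eqP; rewrite eqn_leq; apply/andP; split.
  by rewrite -in_shapeP -(row_lenP lam_part k') -shE // (row_lenP lam_part k) in_shapeP.
by rewrite -in_shapeP -(row_lenP lam_part k) shE // (row_lenP lam_part k') in_shapeP.
Qed.
End Correspondence.

(** * The weight of a state *)

Section KeySum.
Variables (n m : nat) (lam : n.-tuple nat).
Hypothesis lam_part : sorted geq lam.
Hypothesis m_ge : head 0 lam + n <= m.
Implicit Types (U : {ffun cell lam -> letter n}) (s : state n m) (w : {perm letter n}).

Definition king_key U w : bool :=
  (w \in W n) && [exists s : state n m, admissible lam w s && same_vertical_edges U s].

Lemma king_key_unique U : reverse_king U -> exists! w, king_key U w.
Proof.
move=> k; have [w [wW a e]] := evolvedP lam_part m_ge k.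
exists w; split.
  by rewrite /king_key wW; apply/existsP; exists (evolved_state m U); rewrite a e.
move=> w' /andP [w'W /existsP [s /andP [a' e']]].
have es := state_unique lam_part m_ge a a' e e'.
by apply: (exit_unique wW w'W a); rewrite es.
Qed.

(** The constructions of a tableau from a state and of a state from a tableau
    are inverse to each other. *)
Lemma king_key_sum (V : nmodType) w (F : {ffun cell lam -> letter n} -> V) :
  w \in W n ->
  (\sum_(U | reverse_king U && king_key U w) F U =
   \sum_(s : state n m | admissible lam w s) F (state_tableau lam s))%R.
Proof.
move=> wW; rewrite (reindex_onto (@state_tableau n m lam) (@evolved_state n m lam)) /=; last first.
  move=> U /andP [k /andP [_ /existsP [s /andP [a e]]]].
  have [w0 [_ a0 e0]] := evolvedP lam_part m_ge k.
  have es := state_unique lam_part m_ge a a0 e e0.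
  rewrite -es; apply: (tableau_unique lam_part m_ge _ k _ e).
    exact: (state_king lam_part m_ge a).
  exact: (state_edges lam_part m_ge a).
apply: eq_bigl => s; apply/idP/idP.
  case/andP=> /andP [k /andP [_ /existsP [s1 /andP [a1 e1]]]] /eqP es.
  have [w0 [_ a0 e0]] := evolvedP lam_part m_ge k.
  have := state_unique lam_part m_ge a1 a0 e1 e0.
  by rewrite es => <-.
move=> a.
have k := state_king lam_part m_ge a; have e := state_edges lam_part m_ge a.
rewrite k /king_key wW /=; apply/andP; split.
  by apply/existsP; exists s; rewrite a e.
have [w0 [_ a0 e0]] := evolvedP lam_part m_ge k.
by apply/eqP; have H := state_unique lam_part m_ge a0 a e0 e; exact: H.
Qed.

End KeySum.

Section Weights.
Variables (n m : nat) (lam : n.-tuple nat).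
Hypothesis lam_part : sorted geq lam.
Hypothesis m_ge : head 0 lam + n <= m.
Variables (w : {perm letter n}) (s : state n m) (U : {ffun cell lam -> letter n}).
Hypotheses (adm : admissible lam w s) (kU : reverse_king U) (same : same_vertical_edges U s).

(** The size of a subtableau, which up to a constant is the total displacement
    of the particles. *)
Definition volume rho := \sum_(r < n) row_len U rho r.
Definition letter_count x := #|[set c | U c == x]|.

Lemma volume_card rho : volume rho = #|[set c | rho <= letter_rank (U c)]|.
Proof.
rewrite /volume -sum1_card (partition_big (fun c : cell lam => rowc c) xpredT) //=.
apply: eq_bigr => r _; rewrite sum1_card; apply: eq_card => c.
by rewrite !inE unfold_in /= !inE andbC.
Qed.

Lemma volume_step (x : letter n) : volume (letter_rank x) = letter_count x + volume (letter_rank x).+1.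
Proof.
rewrite !volume_card /letter_count -cardsUI (_ : _ :&: _ = set0) ?cards0 ?addn0.
  apply: eq_card => c; rewrite !inE leq_eqVlt; congr (_ || _).
  by rewrite eq_sym (inj_eq (@letter_rank_inj n)).
by apply/setP => c; rewrite !inE; case: eqP => [->|//]; rewrite ltnn.
Qed.

Lemma king_positions (i : 'I_n) : positions (occ_above s (here i)) (n - i) (pos_above U i) /\ positions (occ_between s i) (n - i) (pos_between U i).
Proof. exact: (same_edges_positions lam_part kU m_ge s).1. Qed.

Lemma sum_row_len rho k : (forall r, k <= r -> row_len U rho r = 0) -> k <= n ->
  \sum_(r < k) row_len U rho r = volume rho.
Proof.
move=> H kn; rewrite /volume -!(big_mkord xpredT (row_len U rho)).
rewrite [RHS](big_cat_nat (n := k)) //= -[LHS]addn0; congr (_ + _).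
by rewrite big_nat_cond big1 // => r /andP [/andP [kr _] _]; apply: H.
Qed.

Lemma sum_count_above (i : 'I_n) :
  \sum_(d < m) count_above s (here i) d = volume i.*2 + \sum_(r < n - i) (n - i - r).
Proof.
have [ra _] := king_positions i; rewrite /count_above (sum_count_from _ ra); last by move=> r _; apply: (pos_above_le lam_part kU m_ge).
rewrite big_split /= sum_row_len ?leq_subr // => r h.
by apply: (row_len_out lam_part kU h); rewrite ?leqnSn.
Qed.

Lemma sum_count_between (i : 'I_n) :
  \sum_(d < m) count_between s i d = volume i.*2.+1 + \sum_(r < n - i) (n - i - r.+1).
Proof.
have [_ rb] := king_positions i; rewrite /count_between (sum_count_from _ rb); last by move=> r _; apply: (pos_between_le lam_part kU m_ge).
rewrite big_split /= sum_row_len ?leq_subr // => r h.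
by apply: (row_len_out lam_part kU h); rewrite ?leqnSn.
Qed.

Lemma sum_count_above_next (i : 'I_n) :
  \sum_(d < m) count_above s (next i) d = volume i.*2.+2 + \sum_(r < n - i) (n - i - r.+1).
Proof.
case: (ltnP i.+1 n) => h.
  have -> : next i = here (Ordinal h) by apply/val_inj.
  rewrite sum_count_above /=; congr (_ + _).
  have e : n - i = (n - i.+1).+1 by lia.
  rewrite e big_ord_recr /= subnn addn0; apply: eq_bigr => r _.
  by rewrite subSS.
have -> : next i = ord_max by apply/val_inj => /=; rewrite /bump /=; have := ltn_ord i; lia.
rewrite big1; last first.
  move=> d _; have := count_above_le lam_part m_ge adm ord_max d.
  by rewrite /= subnn leqn0 => /eqP.
have -> : volume i.*2.+2 = 0.
  by rewrite /volume big1 // => r _; apply: (row_len_out (i := i.+1) lam_part kU); rewrite ?doubleS //; lia.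
have e : n - i = 1 by have := ltn_ord i; lia.
by rewrite e big_ord_recl big_ord0.
Qed.

Lemma sum_pred_succ k : \sum_(r < k) (k - r) = \sum_(r < k) (k - r.+1) + k.
Proof.
rewrite -[X in _ + X]muln1 -[X in _ + X * _](card_ord k) -sum_nat_const -big_split /=.
by apply: eq_bigr => r _; have := ltn_ord r; lia.
Qed.

(** The left-hand sum is the number of Gamma vertices of weight [z_i]. *)
Lemma gamma_exponent (i : 'I_n) :
  \sum_(k < m) ((hgamma s i (next k) != None) && (vbetween s i k == None)) + volume i.*2.+1 = volume i.*2.
Proof.
have F (k : 'I_m) : ((hgamma s i (next k) != None) && (vbetween s i k == None)) + count_between s i k = count_above s (here i) k.+1.
  have g := adm_gamma_flux adm i (next k).
  have [_ h] := gamma_occ (adm_gamma adm i k).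
  have st := count_from_step (occ_between s i) k; rewrite -/(count_between s i k) -/(count_between s i k.+1) in st.
  have g' : (hgamma s i (next k) != None) + count_between s i k.+1 = count_above s (here i) k.+1 by exact: g.
  rewrite st -g' /occ_between; case: (vbetween s i k == None) h => /=; first by rewrite andbT.
  by move=> /(_ isT) ->.
have : \sum_(k < m) (((hgamma s i (next k) != None) && (vbetween s i k == None)) + count_between s i k) =
  \sum_(k < m) count_above s (here i) k.+1 by apply: eq_bigr.
rewrite big_split /= sum_count_between.
have : count_above s (here i) 0 + \sum_(k < m) count_above s (here i) k.+1 = \sum_(k < m) count_above s (here i) k.
  have e1 : \sum_(d < m.+1) count_above s (here i) d = count_above s (here i) 0 + \sum_(k < m) count_above s (here i) k.+1.
    by rewrite big_ord_recl.
  by rewrite -e1 big_ord_recr /= [X in _ + X]count_from_big // addn0.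
rewrite (count_above_total lam_part m_ge adm) sum_count_above sum_pred_succ /=.
by lia.
Qed.

(** The left-hand sum is the number of Delta vertices of weight [z_i^-1]. *)
Lemma delta_exponent (i : 'I_n) :
  \sum_(k < m) (hdelta s i (here k) == None) + volume i.*2.+2 = volume i.*2.+1.
Proof.
have F (k : 'I_m) : (hdelta s i (here k) == None) + count_above s (next i) k = count_between s i k.
  have d : (hdelta s i (here k) != None) + count_between s i k = (count_above s (next i) k).+1 by exact: adm_delta_flux adm i (here k).
  by case: (hdelta s i (here k) == None) d => /=; lia.
have : \sum_(k < m) ((hdelta s i (here k) == None) + count_above s (next i) k) = \sum_(k < m) count_between s i k.
  by apply: eq_bigr.
by rewrite big_split /= sum_count_between sum_count_above_next; lia.
Qed.

Definition barred_start (U : {ffun cell lam -> letter n}) (r : 'I_n) : bool :=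
  [exists c : cell lam, [&& rowc c == r, colc c == 0 & U c == row_bound r]].

(** The U-turn is empty when all particles stay to its left, that is, when the
    last part of the shape of the entries at least [bar i] is nonzero; by the
    bound on the entries of its row, such an entry is [bar i]. *)
Lemma uturn_empty (i : 'I_n) : (hgamma s i ord0 == None) = barred_start U (rev_ord i).
Proof.
have g := adm_gamma_flux adm i ord0; rewrite (count_above_total lam_part m_ge adm) /= in g.
have [_ rb] := king_positions i.
have h1 : (hgamma s i ord0 == None) = (n - i.+1 < count_between s i 0).
  have := ltn_ord i; case: (hgamma s i ord0 == None) g => /=; lia.
rewrite h1 /count_between rb /pos_between.
have -> : (n - i.+1 < n - i) = true by have := ltn_ord i; lia.
have -> : n - i - (n - i.+1).+1 = 0 by lia.
rewrite /= addn0 (row_lenP lam_part kU); apply/existsP/existsP => -[c].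
  case/and3P=> h2 h3 h4; exists c; rewrite h3 -val_eqE /= h2 /=.
  apply/eqP/letter_rank_inj/eqP; rewrite eqn_leq.
  have b := king_bound kU c; rewrite (eqP h2) in b.
  by rewrite /letter_rank /row_bound /= addn1 in b h4 *; have := ltn_ord i; lia.
case/and3P=> /eqP h2 h3 /eqP h4; exists c; rewrite h2 h3 h4 /letter_rank /row_bound /= eqxx /=.
by have := ltn_ord i; lia.
Qed.

Local Open Scope ring_scope.
Variables (K : fieldType) (c : K) (zz : 'I_n -> K).
Hypothesis zz0 : forall i, zz i != 0.

Lemma state_weightE : state_weight c zz s =
  \prod_i ((if barred_start U (rev_ord i) then 1 + c * zz i else 1) *
     zz i ^ ((letter_count (i, false))%:Z - (letter_count (i, true))%:Z)).
Proof.
rewrite /state_weight; apply: eq_bigr => i _; rewrite -mulrA; congr (_ * _).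
  by rewrite /uturn_wt spin_code_eq0 uturn_empty.
rewrite /gamma_row_wt /delta_row_wt.
under eq_bigr do rewrite (gamma_spin_wtE _ (adm_gamma adm _ _)).
under [X in _ * X]eq_bigr do rewrite (delta_spin_wtE _ (adm_delta adm _ _)).
rewrite -!expr_sum exprVn.
have r1 : letter_rank (i, false) = i.*2 by rewrite /letter_rank /= addn0.
have r2 : letter_rank (i, true) = i.*2.+1 by rewrite /letter_rank /= addn1.
have v1 := volume_step (i, false); have v2 := volume_step (i, true); rewrite r1 r2 in v1 v2.
have g := gamma_exponent i; have d := delta_exponent i.
have -> : (\sum_(k < m) ((hgamma s i (next k) != None) && (vbetween s i k == None)) = letter_count (i, false))%N.
  by apply: (@addIn (volume i.*2.+1)); rewrite g v1.
have -> : (\sum_(k < m) (hdelta s i (here k) == None) = letter_count (i, true))%N.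
  by apply: (@addIn (volume i.*2.+2)); rewrite d v2.
by rewrite expfzDr ?zz0 // -exprnP -exprnN.
Qed.
End Weights.

(** * The unique state for the identity *)

Lemma gamma_bottom n (l t r b b' : spin n) :
  gamma_ok (l, t, r, b) -> gamma_ok (l, t, r, b') -> b = b'.
Proof.
rewrite !gamma_okE; case: l t => [c|] [c'|] /=.
- by move=> /andP [_ /eqP ->] /andP [_ /eqP ->].
- by move=> /orP [] /andP [/eqP -> /eqP ->] /orP [] /andP [/eqP ? /eqP ->].
- by move=> /andP [_ /eqP ->] /andP [_ /eqP ->].
- by move=> /andP [_ /eqP ->] /andP [_ /eqP ->].
Qed.

Lemma delta_bottom n (l t r b b' : spin n) :
  delta_ok (l, t, r, b) -> delta_ok (l, t, r, b') -> b = b'.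
Proof.
rewrite !delta_okE; case: r t => [c|] [c'|] /=.
- by move=> /andP [_ /eqP ->] /andP [_ /eqP ->].
- by move=> /orP [] /andP [/eqP -> /eqP ->] /orP [] /andP [/eqP ? /eqP ->].
- by move=> /andP [_ /eqP ->] /andP [_ /eqP ->].
- by move=> /andP [_ /eqP ->] /andP [_ /eqP ->].
Qed.

Section GroundState.
Variables (n m : nat) (lam : n.-tuple nat).
Hypothesis lam_part : sorted geq lam.
Hypothesis m_ge : head 0 lam + n <= m.

Definition top_pos (i : 'I_n) : nat := tnth lam i + (n - i.+1).

Lemma top_pos_lt (i j : 'I_n) : i < j -> top_pos j < top_pos i.
Proof.
by move=> ij; have := lam_anti lam_part (ltnW ij); rewrite /top_pos; have := ltn_ord j; lia.
Qed.

Lemma top_pos_lt_m i : top_pos i < m.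
Proof. by have := lam_head lam_part i; rewrite /top_pos; have := ltn_ord i; lia. Qed.

Lemma top_pos_inj (i j : 'I_n) : top_pos i = top_pos j -> i = j.
Proof.
move=> e; apply/val_inj; case: (ltngtP i j) => // h; have := top_pos_lt h; by rewrite e ltnn.
Qed.

Definition ground_row (i : nat) (c : nat) : spin n :=
  omap (fun j => (j, false)) [pick j : 'I_n | (c == top_pos j) && (i <= j)].

Lemma ground_row_pos i (j : 'I_n) : i <= j -> ground_row i (top_pos j) = Some (j, false).
Proof.
move=> ij; rewrite /ground_row; case: pickP => [k /andP [/eqP /top_pos_inj -> //]|/(_ j)].
by rewrite eqxx ij.
Qed.

Lemma ground_rowP i c : ground_row i c = None \/
  exists j : 'I_n, [/\ i <= j, c = top_pos j & ground_row i c = Some (j, false)].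
Proof.
rewrite /ground_row; case: pickP => [j /andP [/eqP e ij]|h]; [right|left] => //.
by exists j.
Qed.

Lemma ground_row_next (i : 'I_n) c : c <> top_pos i -> ground_row i c = ground_row i.+1 c.
Proof.
move=> ne; rewrite /ground_row; congr omap; apply: eq_pick => j.
case: eqP => //= e; apply/idP/idP => [|/ltnW //].
by rewrite leq_eqVlt => /orP [/eqP/val_inj ij|//]; case: ne; rewrite ij.
Qed.

Lemma ground_row_at (i : 'I_n) : ground_row i.+1 (top_pos i) = None.
Proof.
case: (ground_rowP i.+1 (top_pos i)) => // -[j [ij e _]].
by have := top_pos_lt ij; rewrite e ltnn.
Qed.

Lemma ground_row_left (i : 'I_n) c : top_pos i < c -> ground_row i c = None.
Proof.
move=> ic; case: (ground_rowP i c) => // -[j [ij e _]]; move: ij; rewrite leq_eqVlt.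
case/orP => [/eqP/val_inj ij|/top_pos_lt]; first by move: ic; rewrite e ij ltnn.
by rewrite -e ltnNge (ltnW ic).
Qed.

(** Color [i] turns right where it enters, follows the [i]-th Gamma row to the
    U-turn and leaves, barred, along the whole Delta row; the other colors go
    straight down. *)
Definition ground_state : state n m :=
  ([ffun p : 'I_n.+1 * 'I_m => ground_row p.1 p.2],
   [ffun p : 'I_n * 'I_m => ground_row p.1.+1 p.2],
   [ffun p : 'I_n * 'I_m.+1 => if p.2 <= top_pos p.1 then Some (p.1, false) else None],
   [ffun p : 'I_n * 'I_m.+1 => Some (p.1, true)]).

Lemma ground_vabove i c : vabove ground_state i c = ground_row i c.
Proof. by rewrite /vabove ffunE. Qed.
Lemma ground_vbetween i c : vbetween ground_state i c = ground_row i.+1 c.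
Proof. by rewrite /vbetween ffunE. Qed.
Lemma ground_hgamma i k : hgamma ground_state i k = if k <= top_pos i then Some (i, false) else None.
Proof. by rewrite /hgamma ffunE. Qed.
Lemma ground_hdelta i k : hdelta ground_state i k = Some (i, true).
Proof. by rewrite /hdelta ffunE. Qed.

Lemma color_gt_unbarred (i j : 'I_n) : i < j -> color_gt (i, false) (j, false).
Proof. by []. Qed.
Lemma color_gt_barred (i j : 'I_n) : i < j -> color_gt (j, false) (i, true).
Proof. by rewrite /color_gt /color_pos /=; have := ltn_ord j; lia. Qed.

Lemma nextE k (i : 'I_k) : next i = i.+1 :> nat.
Proof. by rewrite /= /bump /= add1n. Qed.

Lemma ground_gamma i k : gamma_ok (hgamma ground_state i (next k), vabove ground_state (here i) k,
  hgamma ground_state i (here k), vbetween ground_state i k).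
Proof.
rewrite gamma_okE !ground_hgamma ground_vabove ground_vbetween nextE /=.
case: (ltngtP k (top_pos i)) => h.
- rewrite ground_row_next; last by move=> e; rewrite e ltnn in h.
  case: (ground_rowP i.+1 k) => [->|[j [ij _ ->]]] /=; first by rewrite eqxx.
  by have [-> _ -> _] := spin_min_maxE (color_gt_unbarred ij); rewrite !eqxx.
- have tn : ground_row i k = None by exact: ground_row_left.
  have bn : ground_row i.+1 k = None.
    by rewrite -ground_row_next // => e; rewrite e ltnn in h.
  by rewrite tn bn.
- by rewrite h ground_row_pos // ground_row_at /= eqxx.
Qed.

Lemma ground_delta i k : delta_ok (hdelta ground_state i (next k), vbetween ground_state i k,
  hdelta ground_state i (here k), vabove ground_state (next i) k).
Proof.
rewrite delta_okE !ground_hdelta ground_vabove ground_vbetween nextE /=.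
case: (ground_rowP i.+1 k) => [->|[j [ij _ ->]]] /=; first by rewrite eqxx.
by have [_ -> _ ->] := spin_min_maxE (color_gt_barred ij); rewrite !eqxx.
Qed.

Lemma ground_top c : vabove ground_state ord0 c =
  omap (fun i => (i, false)) [pick i : 'I_n | c == tnth lam i + (n - i.+1) :> nat].
Proof. by rewrite ground_vabove /ground_row; congr omap; apply: eq_pick => j /=; rewrite leq0n andbT. Qed.

Lemma ground_adm : admissible lam 1 ground_state.
Proof.
apply/andP; split.
  apply/forallP => i; apply/and3P; split; try apply/forallP => k.
  - exact: ground_gamma.
  - exact: ground_delta.
  - by rewrite uturn_okE ground_hgamma ground_hdelta.
apply/and5P; split.
- apply/forallP => c; rewrite ground_vabove /=; case: (ground_rowP n c) => [-> //|[j [h _ _]]].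
  by have := ltn_ord j; rewrite ltnNge h.
- by apply/forallP => i; rewrite ground_hgamma leqNgt top_pos_lt_m.
- by apply/forallP => i; rewrite ground_hdelta invg1 perm1.
- apply/forallP => i; apply/forallP => c; apply/implyP => /eqP e.
  by rewrite ground_vabove e -/(top_pos i) ground_row_pos.
- apply/forallP => c; apply/implyP => /forallP h; rewrite ground_top.
  by case: pickP => [i|//]; rewrite (negPf (h i)).
Qed.

Lemma content1 (x : letter n) (a : spin n) : content (pred1 x) a = 1 -> a = Some x.
Proof. by case: a => [c|] //=; case: eqP => // ->. Qed.

(** The exit of row pair [i] is the bar of color [i], which no vertical edge
    above carries; so it is created at this U-turn, where color [i] must
    arrive. Conservation of these two colors determines both rows. *)
Lemma ground_unique s : admissible lam 1 s -> s = ground_state.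
Proof.
move=> a.
have row (i : 'I_n) : (forall c, vabove s (here i) c = vabove ground_state (here i) c) ->
  [/\ forall k, hgamma s i k = hgamma ground_state i k,
      forall c, vbetween s i c = vbetween ground_state i c,
      forall k, hdelta s i k = hdelta ground_state i k &
      forall c, vabove s (next i) c = vabove ground_state (next i) c].
  move=> eV; pose p : pred (letter n) := pred1 (i, true); pose q : pred (letter n) := pred1 (i, false).
  have pE (j : 'I_n) : p (j, false) = false by apply/negbTE/eqP => -[].
  have qE (j : 'I_n) : q (j, false) = (j == i) by apply/eqP/eqP => [[]|->].
  have p1 : p (i, true) by exact: eqxx.
  have q1 : q (i, false) by exact: eqxx.
  have dmax : hdelta s i ord_max = Some (i, true).
    by case/andP: a => _ /and5P [_ _ /forallP /(_ i) /eqP -> _ _]; rewrite invg1 perm1.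
  have gp := @telescope_ord m (fun c => content p (hgamma s i c)) _ _
    (fun c => gamma_content p (adm_gamma a i c)).
  have gq := @telescope_ord m (fun c => content q (hgamma s i c)) _ _
    (fun c => gamma_content q (adm_gamma a i c)).
  have dp := @telescope_ord m (fun c => content p (hdelta s i c)) _ _
    (fun c => esym (delta_content p (adm_delta a i c))).
  rewrite /= (adm_gmax a) /= !add0n in gp gq; rewrite /= dmax /= ?eqxx in dp.
  have Vp : \sum_c content p (vabove s (here i) c) = 0.
    rewrite big1 // => c _; rewrite eV ground_vabove.
    by case: (ground_rowP (here i) c) => [->|[j [_ _ ->]]] //; rewrite /content pE.
  have Vq : \sum_c content q (vabove s (here i) c) = 1.
    rewrite (bigD1 (Ordinal (top_pos_lt_m i))) //= big1 ?addn0 => [|c ne].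
      by rewrite eV ground_vabove ground_row_pos // /content q1.
    rewrite eV ground_vabove; case: (ground_rowP (here i) c) => [->|[j [_ ej ->]]] //; rewrite /content qE.
    case: (j =P i) => // ij; case/eqP: ne.
    by apply/val_inj; rewrite /= ej ij.
  rewrite Vp in gp; rewrite Vq in gq.
  have g0p : content p (hgamma s i ord0) = 0 by move: gp; case: (content _ _).
  have bp : \sum_c content p (vbetween s i c) = 0 by move: gp; rewrite g0p.
  have d0 : hdelta s i ord0 = Some (i, true).
    apply: content1; move: dp; rewrite bp addn0 => dp.
    have : content p (hdelta s i ord0) <= 1 by rewrite /content; case: (hdelta _ _ _) => [d|] //; apply: leq_b1.
    by rewrite -/p -dp; move: (\sum_k _) => S0 /=; lia.
  have Vn : \sum_c content p (vabove s (next i) c) = 0.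
    by move: dp; rewrite bp d0 [content p (Some _)]/content p1; case: (\sum_k _).
  have g0 : hgamma s i ord0 = Some (i, false).
    move: d0 g0p; rewrite (adm_uturn a); case: (hgamma s i ord0) => [[k b]|] // [->].
    by case: b => //; rewrite /content p1.
  have bq c : content q (vbetween s i c) = 0.
    have : \sum_c content q (vbetween s i c) = 0.
      by move: gq; rewrite g0 [content q (Some _)]/content q1; case: (\sum_k _).
    by move/eqP; rewrite sum_nat_eq0 => /forallP /(_ c) /eqP.
  have hgL (k : 'I_m.+1) : k <= top_pos i -> hgamma s i k = Some (i, false).
    elim/ord_up: k => [//|k IH]; rewrite nextE => kp; apply: content1.
    have e := gamma_content q (adm_gamma a i k).
    rewrite IH ?(ltnW kp) // bq eV ground_vabove [content q (Some _)]/content q1 in e.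
    have h0 : content q (ground_row (here i) k) = 0.
      case: (ground_rowP i k) => [->|[j [_ ej ->]]] //; rewrite /content qE.
      by case: (j =P i) => // ij; move: kp; rewrite ej ij ltnn.
    by rewrite h0 !addn0 in e.
  have hgR (k : 'I_m.+1) : top_pos i < k -> hgamma s i k = None.
    elim/ord_down: k => [|k IH] kp; first by rewrite (adm_gmax a).
    have := adm_gamma a i k; rewrite eV ground_vabove ground_row_left // IH ?nextE; last exact: ltnW.
    by rewrite gamma_okE => /andP [/eqP].
  have eG k : hgamma s i k = hgamma ground_state i k.
    by rewrite ground_hgamma; case: leqP => [/hgL|/hgR].
  have eB c : vbetween s i c = vbetween ground_state i c.
    have := adm_gamma a i c; rewrite !eG eV => g.
    exact: gamma_bottom g (ground_gamma i c).
  have eD k : hdelta s i k = hdelta ground_state i k.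
    rewrite ground_hdelta; elim/ord_up: k => [//|k IH]; apply: content1.
    have e := delta_content p (adm_delta a i k).
    have b0 : content p (vbetween s i k) = 0.
      by move/eqP: bp; rewrite sum_nat_eq0 => /forallP /(_ k) /eqP.
    have v0 : content p (vabove s (next i) k) = 0.
      by move/eqP: Vn; rewrite sum_nat_eq0 => /forallP /(_ k) /eqP.
    by rewrite IH b0 v0 [content p (Some _)]/content p1 !addn0 in e.
  split=> // c; have := adm_delta a i c; rewrite !eD eB => d.
  exact: delta_bottom d (ground_delta i c).
have eV i c : vabove s i c = vabove ground_state i c.
  elim/ord_up: i c => [|i IH] c; first by rewrite ground_top (adm_top c a).
  by have [_ _ _ ->] := row i IH.
have eB i c : vbetween s i c = vbetween ground_state i c by have [_ -> _ _] := row i (eV _).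
have eG i k : hgamma s i k = hgamma ground_state i k by have [-> _ _ _] := row i (eV _).
have eD i k : hdelta s i k = hdelta ground_state i k by have [_ _ -> _] := row i (eV _).
case: s {a row} eV eB eG eD => [[[A B] G] D].
case: ground_state => [[[A' B'] G'] D'].
rewrite /vabove /vbetween /hgamma /hdelta /= => eV eB eG eD.
by congr (_, _, _, _); apply/ffunP => -[i c].
Qed.

(** Of the [top_pos i] columns to the right of the one where color [i] enters,
    [n - i.+1] contain another particle. *)
Lemma ground_count (i : 'I_n) :
  \sum_(k < m) ((hgamma ground_state i (next k) != None) && (vbetween ground_state i k == None)) = tnth lam i.
Proof.
have tot := count_above_total lam_part m_ge ground_adm (next i); rewrite nextE in tot.
have totE : \sum_(k < m) (ground_row i.+1 k != None : nat) = n - i.+1.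
  rewrite -tot /count_above /count_from -sum1_card [RHS]big_mkcond; apply: eq_bigr => k _.
  by rewrite inE leq0n /occ_above ground_vabove nextE; case: (ground_row _ _).
have posE : \sum_(k < m) (k < top_pos i : nat) = top_pos i.
  have := downset_card (P := fun k => k < top_pos i) m _ => dc.
  have -> : \sum_(k < m) (k < top_pos i : nat) = #|[pred k : 'I_m | k < top_pos i]|.
    by rewrite -sum1_card [RHS]big_mkcond; apply: eq_bigr => k _; rewrite inE; case: (k < top_pos i).
  apply/eqP; rewrite eqn_leq; apply/andP; split; rewrite leqNgt; apply/negP => h.
    have := dc (top_pos i); rewrite h ltnn andbF => e; have : true = false by apply: e => a b ab /(leq_ltn_trans ab).
    by [].
  have := dc #|[pred k : 'I_m | k < top_pos i]|; rewrite ltnn h (ltn_trans h (top_pos_lt_m i)) => e.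
  by have : false = true by apply: e => a b ab /(leq_ltn_trans ab).
apply: (@addIn (n - i.+1)); rewrite -[in LHS]totE -big_split /= -/(top_pos i) -posE.
apply: eq_bigr => k _; rewrite ground_hgamma ground_vbetween nextE.
case: (ground_rowP i.+1 k) => [->|[j [ij -> ->]]] /=; first by rewrite addn0 andbT; case: ifP.
by rewrite andbF (top_pos_lt ij).
Qed.

Local Open Scope ring_scope.
Lemma ground_weight (K : fieldType) (c : K) (zz : 'I_n -> K) :
  state_weight c zz ground_state = \prod_i zz i ^+ tnth lam i.
Proof.
rewrite /state_weight; apply: eq_bigr => i _.
rewrite /gamma_row_wt /delta_row_wt.
under eq_bigr do rewrite (gamma_spin_wtE _ (ground_gamma _ _)).
under [X in _ * X]eq_bigr do rewrite (delta_spin_wtE _ (ground_delta _ _)) ground_hdelta expr0.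
rewrite big1_eq mulr1 -expr_sum ground_count /uturn_wt spin_code_eq0 ground_hgamma leq0n.
by rewrite mul1r.
Qed.
End GroundState.

Local Open Scope ring_scope.

(** * Sundaram tableaux *)

Section Infinity.
Variables (n m : nat) (lam : n.-tuple nat).
Implicit Types (U : {ffun cell lam -> letter n}) (R : {set 'I_n}) (T : filling lam).

Definition allowed (X : cartan_type) R : bool := if X is TypeC then R == set0 else true.

Lemma infty_rowsP U R (c : cell lam) : infty_rows U R -> rowc c \in R -> colc c = 0%N ->
  U c = row_bound (rowc c).
Proof.
move=> /forallP /(_ (rowc c)) /implyP h /h /existsP [d /and3P [/eqP e1 /eqP e2 /eqP e3]] e.
by rewrite -(cell_inj e1 (etrans e2 (esym e))) e3 e1.
Qed.

Lemma fill_inftyK U R : infty_rows U R -> fill_infty (with_infty U R) = U.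
Proof.
move=> h; apply/ffunP => c; rewrite !ffunE.
by case: ifP => // /andP [cR /eqP c0]; rewrite /= (infty_rowsP h).
Qed.

Definition infty_set T : {set 'I_n} := [set r | [exists c : cell lam, (rowc c == r) && (T c == None)]].

Lemma infty_setK U R : infty_rows U R -> infty_set (with_infty U R) = R.
Proof.
move=> h; apply/setP => r; rewrite inE; apply/existsP/idP.
  by case=> c /andP [/eqP <-]; rewrite ffunE; case: ifP => // /andP [].
move=> rR; have /forallP /(_ r) /implyP /(_ rR) /existsP [c /and3P [e1 e2 _]] := h.
by exists c; rewrite ffunE e1 e2 (eqP e1) rR.
Qed.

Lemma infty_rows0 U : infty_rows U set0.
Proof. by apply/forallP => r; rewrite inE. Qed.

Lemma tableauxP X T : reflect
  (exists U R, [/\ reverse_king U, infty_rows U R, allowed X R & T = with_infty U R])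
  (T \in tableaux lam X).
Proof.
case: X; rewrite inE; apply: (iffP existsP).
- by case=> U /existsP [R /and3P [h1 h2 /eqP h3]]; exists U, R.
- by case=> U [R [h1 h2 _ h3]]; exists U; apply/existsP; exists R; rewrite h1 h2 h3 eqxx.
- by case=> U /andP [h1 /eqP h3]; exists U, set0; rewrite infty_rows0 /= eqxx.
- by case=> U [R [h1 h2 /eqP e h3]]; exists U; rewrite h1 h3 e eqxx.
Qed.

(** A tableau with infinities amounts to a reverse King tableau with a set of
    rows, both of which can be recovered from it. *)
Lemma tableaux_sum (V : nmodType) X (P : pred {ffun cell lam -> letter n}) (F : filling lam -> V) :
  \sum_(T in tableaux lam X | P (fill_infty T)) F T =
  \sum_(U | reverse_king U && P U) \sum_(R | infty_rows U R && allowed X R) F (with_infty U R).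
Proof.
rewrite pair_big_dep /= (reindex_onto (fun p : {ffun cell lam -> letter n} * {set 'I_n} =>
  with_infty p.1 p.2) (fun T => (fill_infty T, infty_set T))) /=; last first.
  by move=> T /andP [/tableauxP [U [R [_ h _ ->]]] _]; rewrite fill_inftyK ?infty_setK.
apply: eq_bigl => -[U R] /=; apply/idP/idP.
  case/andP=> /andP [/tableauxP [U1 [R1 [k h a ->]]]].
  rewrite fill_inftyK // infty_setK // => PU /eqP [<- <-].
  by rewrite k PU h a.
case/andP=> /andP [k PU] /andP [h a].
rewrite fill_inftyK // infty_setK // eqxx PU !andbT.
by apply/tableauxP; exists U, R.
Qed.

Lemma mult_false U R i : infty_rows U R -> mult (with_infty U R) (i, false) = letter_count U (i, false).
Proof.
move=> h; apply: eq_card => c; rewrite !inE ffunE.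
case: ifP => [/andP [cR /eqP c0]|_]; last by [].
by rewrite (infty_rowsP h cR c0) /row_bound xpair_eqE andbF.
Qed.

(** Only a letter [bar i] in row [n + 1 - i] can be replaced, and there is one
    such letter at the start of the row. *)
Lemma mult_true U R i : infty_rows U R ->
  letter_count U (i, true) = (mult (with_infty U R) (i, true) + (rev_ord i \in R))%N.
Proof.
move=> h.
have -> : letter_count U (i, true) = (mult (with_infty U R) (i, true) +
   #|[set c | [&& rowc c \in R, colc c == 0%N & U c == (i, true)]]|)%N.
  rewrite /letter_count /mult -cardsUI (_ : _ :&: _ = set0) ?cards0 ?addn0.
    apply: eq_card => c; rewrite !inE ffunE.
    by case: ifP => [/andP [-> ->]|/nandP [] /negPf ->] //=; rewrite ?andbF orbF.
  apply/setP => c; rewrite !inE ffunE.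
  by case: ifP => [_|/nandP [] /negPf ->] //=; rewrite ?andbF.
congr (_ + _)%N; case: (boolP (rev_ord i \in R)) => iR /=.
  have /forallP /(_ (rev_ord i)) /implyP /(_ iR) /existsP [c /and3P [/eqP e1 /eqP e2 /eqP e3]] := h.
  rewrite (_ : [set _ | _] = [set c]) ?cards1 //; apply/setP => d; rewrite !inE.
  apply/idP/eqP => [/and3P [dR /eqP d0 /eqP Ud]|->].
    apply: cell_inj; last by rewrite d0 e2.
    move: Ud; rewrite (infty_rowsP h dR d0) /row_bound e1 => -[<-].
    by rewrite rev_ordK.
  by rewrite e1 e2 e3 iR /row_bound rev_ordK !eqxx.
apply: eq_card0 => d; rewrite !inE; apply/negP => /and3P [dR /eqP d0 /eqP Ud].
move: Ud; rewrite (infty_rowsP h dR d0) /row_bound => -[e].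
by move: iR; rewrite -e rev_ordK dR.
Qed.

Lemma zwt_infty U R : infty_rows U R ->
  zwt (with_infty U R) =
  \prod_i (zvar i ^ ((letter_count U (i, false))%:Z - (letter_count U (i, true))%:Z) * zvar i ^+ (rev_ord i \in R)).
Proof.
move=> h; apply: eq_bigr => i _; rewrite (mult_false i h) (mult_true i h).
rewrite exprnP -expfzDr ?zvar_neq0 //; congr (_ ^ _).
by rewrite PoszD opprD addrA addrNK.
Qed.

(** The parameter [c] in the weight of an empty U-turn. *)
Definition xparam (X : cartan_type) : ratfun n := if X is TypeB then 1 else 0.

(** Rows are chosen independently of each other: distributivity. *)
Lemma infty_sum X U :
  \sum_(R | infty_rows U R && allowed X R) \prod_i zvar i ^+ (rev_ord i \in R) =
  \prod_i (if barred_start U (rev_ord i) then 1 + xparam X * zvar i else 1) :> ratfun n.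
Proof.
case: X => /=; last first.
  rewrite (big_pred1 set0); last first.
    by move=> R /=; case: eqP => [->|]; rewrite ?infty_rows0 ?andbF.
  rewrite !big1 // => i _; last by rewrite inE.
  by rewrite mul0r addr0; case: ifP.
pose Z r : ratfun n := (barred_start U r)%:R * zvar (rev_ord r).
transitivity (\prod_r (Z r + 1)).
  rewrite bigA_distr big_mkcond; apply: eq_bigr => R _; rewrite andbT.
  rewrite [X in if _ then X else _](reindex_inj rev_ord_inj) /=.
  under eq_bigr do rewrite rev_ordK.
  case: ifP => [h|].
    apply: eq_bigr => r _; case: ifP => rR; last by rewrite expr0.
    have /forallP /(_ r) /implyP /(_ rR) b := h.
    by rewrite /Z /barred_start b mul1r expr1.
  move/negbT; rewrite negb_forall => /existsP [r]; rewrite negb_imply => /andP [rR /negPf b].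
  by rewrite (bigD1 r) //= rR /Z /barred_start b !mul0r.
rewrite (reindex_inj rev_ord_inj) /=; apply: eq_bigr => i _.
rewrite /Z rev_ordK mul1r addrC.
by case: ifP => _; rewrite ?mul1r // mul0r addr0.
Qed.

Theorem tableau_weight_sum X (P : pred {ffun cell lam -> letter n}) :
  \sum_(T in tableaux lam X | P (fill_infty T)) zwt T =
  \sum_(U | reverse_king U && P U)
    \prod_i ((if barred_start U (rev_ord i) then 1 + xparam X * zvar i else 1) *
             zvar i ^ ((letter_count U (i, false))%:Z - (letter_count U (i, true))%:Z)).
Proof.
rewrite tableaux_sum; apply: eq_bigr => U _.
rewrite big_split /= -infty_sum mulr_suml; apply: eq_bigr => R /andP [h _].
by rewrite (zwt_infty h) big_split /= mulrC.
Qed.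
End Infinity.

(** * The partition function *)

Lemma prod_last (K : fieldType) N n (A : 'I_n -> 'M[K]_N) (i : 'I_n) : ~~ (i.+1 < n)%N ->
  exists P, forall F, (forall j, j != i -> F j = A j) ->
    \big[mulmx/1%:M]_(j < n) F j = P *m F i.
Proof.
case: n A i => [|n] A i hi; first by case: i hi.
have -> : i = ord_max by apply/val_inj => /=; have := ltn_ord i; move: hi; lia.
exists (\big[mulmx/1%:M]_(j < n) A (widen_ord (leqnSn n) j)) => F FA.
rewrite big_ord_recr /=; congr (_ *m _); apply: eq_bigr => j _; apply: FA.
by rewrite -val_eqE /= ltn_eqF.
Qed.

(** Replacing the parameter of the bottom pair of rows by its inverse. *)
Lemma last_row_reflect (K : fieldType) (S : finType) (m N : nat) (cd : S -> nat) (o : S) (f : S -> S)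
  (cd_inj : injective cd) (cd0 : cd o = 0%N) (cd_le : forall a, (cd a <= N)%N)
  (cdf : forall a, cd (f a) = fold_code N (cd a)) (c z D : K) (x x' : S)
  (P : 'M[K]_#|config S m|) al :
  z != 0 -> z ^+ 2 - 1 != 0 -> D * (1 + c * z) = z ^+ 2 - 1 ->
  (0 < cd x)%N -> ((cd x).*2 <= N)%N -> cd x' = (N.+1 - cd x)%N ->
  entry (P *m double_row m cd o f c z x) al [ffun=> o] - entry (P *m double_row m cd o f c z^-1 x) al [ffun=> o] =
  D * entry (P *m double_row m cd o f c z x') al [ffun=> o].
Proof.
move=> z0 z21 HD x0 xN ex.
rewrite !entry_mul -sumrB big_distrr /=; apply: eq_bigr => be _.
have [st dl] := bottom_double_row cd_inj cd0 cd_le cdf c be.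
have xo : x != o by rewrite -(cd_eq0 cd_inj cd0) -lt0n.
have x'o : x' != o by rewrite -(cd_eq0 cd_inj cd0) ex; lia.
rewrite !dl //; case: st {dl} => [[k0 a0]|]; last by ring.
by rewrite -mulrBr mulrCA ex (last_wt_reflect cd0 k0 a0 z0 z21 HD x0 xN).
Qed.

Section PartitionFunction.
Variables (n m : nat) (lam : n.-tuple nat).
Variables (K : fieldType) (c : K).
Implicit Types (zz : 'I_n -> K) (x : 'I_n -> spin n) (w : {perm letter n}) (s : state n m).

Local Notation DR := (double_row m (@spin_code n) None (@uturn n) c).

Definition partition_fn zz x : K :=
  entry (\big[mulmx/1%:M]_(i < n) DR (zz i) (x i)) (top_row m lam) [ffun=> None].

Definition exit_spins w (i : 'I_n) : spin n := Some (bar (w^-1%g (i, false))).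

Let cd0 : @spin_code n None = 0%N := erefl.
Let cd_inj := @spin_code_inj n.
Let cd_le := @spin_code_le n.
Let cdf := @spin_code_uturn n.

Lemma partition_fn_swap zz zz' x x' (i : 'I_n) : (i.+1 < n)%N ->
  (forall j, zz' j = zz (tperm i (ordS i) j)) -> (forall j, x' j = x (tperm i (ordS i) j)) ->
  (forall j, zz j != 0) -> x i != None ->
  (spin_code (x i) < spin_code (x (ordS i)))%N ->
  partition_fn zz x - partition_fn zz' x = (zz i / zz (ordS i) - 1) * partition_fn zz x'.
Proof.
move=> hi ez ex z0 xi lt.
have [P [Q H]] := prod_at2 (fun j => DR (zz j) (x j)) hi.
have D : forall j, j != i -> j != ordS i -> tperm i (ordS i) j = j.
  by move=> j h1 h2; rewrite tpermD // eq_sym.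
rewrite /partition_fn !H //; try by move=> j h1 h2; rewrite ?ez ?ex D.
rewrite !ez !ex.
rewrite tpermL tpermR /entry.
have e := double_row_exchange m cd_inj cd0 cd_le cdf c (z0 i) (z0 (ordS i)) xi lt.
move: e; set A := _ *m _; set B := _ *m _; set C := _ *m _ => e.
have -> : A = B + (zz i / zz (ordS i) - 1) *: C by rewrite -e addrC subrK.
by rewrite mulmxDr mulmxDl -scalemxAr -scalemxAl !mxE addrAC subrr add0r.
Qed.

Lemma partition_fn_reflect zz zz' x x' (i : 'I_n) (k : 'I_n) D : ~~ (i.+1 < n)%N ->
  (forall j, j != i -> zz' j = zz j) -> zz' i = (zz i)^-1 ->
  (forall j, j != i -> x' j = x j) ->
  x i = Some (k, true) -> x' i = Some (k, false) ->
  zz i != 0 -> zz i ^+ 2 - 1 != 0 -> D * (1 + c * zz i) = zz i ^+ 2 - 1 ->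
  partition_fn zz x - partition_fn zz' x = D * partition_fn zz x'.
Proof.
move=> hi ez ezi ex exi ex'i z0 z21 HD.
have [P H] := prod_last (fun j => DR (zz j) (x j)) hi.
rewrite /partition_fn !H //; try by move=> j ji; rewrite ?ez ?ex.
have lk := ltn_ord k.
rewrite ezi exi ex'i.
apply: (last_row_reflect cd_inj cd0 cd_le cdf) => //; rewrite /spin_code /color_pos /=; lia.
Qed.
Hypothesis lam_part : sorted geq lam.
Hypothesis m_ge : (head 0%N lam + n <= m)%N.

(** Admissible states are the ones without vertices of weight 0. *)
Lemma partition_fn_states zz w : partition_fn zz (exit_spins w) = \sum_(s : state n m | admissible lam w s) state_weight c zz s.
Proof.
rewrite /partition_fn state_sum big_mkcond [RHS]big_mkcond; apply: eq_bigr => s _.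
case: (boolP (admissible lam w s)) => a.
  rewrite ifT //; apply/and3P; split; apply/forallP => i.
  - rewrite (adm_gmax a) (adm_uturn a) !eqxx andbT.
    by case/andP: a => _ /and5P [_ _ /forallP /(_ i)].
  - by rewrite (adm_top i a) ffunE.
  - by case/andP: a => _ /and5P [/forallP /(_ i)].
case: ifP => // /and3P [/forallP ex /forallP top /forallP bot].
apply/eqP; apply: contraNT a => nz; apply/andP; split.
  apply/forallP => i.
  have nzi : [&& gamma_row_wt zz s i != 0 & delta_row_wt zz s i != 0].
    apply: contraNT nz => h; apply/eqP; rewrite /state_weight (bigD1 i) //=.
    by case/nandP: h => /negPn /eqP ->; rewrite ?mulr0 ?mul0r.
  case/andP: nzi => gz dz; apply/and3P; split.
  - apply/forallP => k; apply: contraNT gz => /negbTE h.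
    by rewrite /gamma_row_wt (bigD1 k) //= (gamma_spin_wt0 _ h) mul0r.
  - apply/forallP => k; apply: contraNT dz => /negbTE h.
    by rewrite /delta_row_wt (bigD1 k) //= (delta_spin_wt0 _ h) mul0r.
  - by rewrite uturn_okE; case/and3P: (ex i).
have topE k : vabove s ord0 k =
    omap (fun i => (i, false)) [pick i : 'I_n | k == tnth lam i + (n - i.+1) :> nat]%N.
  by rewrite (eqP (top k)) ffunE.
apply/and5P; split.
- exact/forallP.
- by apply/forallP => i; case/and3P: (ex i).
- by apply/forallP => i; case/and3P: (ex i).
- apply/forallP => i; apply/forallP => k; apply/implyP => /eqP e; rewrite topE.
  case: pickP => [j /eqP e'|/(_ i)]; last by rewrite e eqxx.
  by rewrite (top_pos_inj lam_part m_ge (etrans (esym e) e' : top_pos lam i = top_pos lam j)).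
- apply/forallP => k; apply/implyP => /forallP h; rewrite topE.
  by case: pickP => [i|//]; rewrite (negPf (h i)).
Qed.

(** The start of the recursion. *)
Lemma partition_fn_one zz : partition_fn zz (exit_spins 1) = \prod_i zz i ^+ tnth lam i.
Proof.
rewrite partition_fn_states (big_pred1 (ground_state m lam)).
  exact: ground_weight.
move=> s /=; apply/idP/eqP => [/(ground_unique lam_part m_ge) //|->].
exact: ground_adm.
Qed.

End PartitionFunction.

(** * Demazure atoms *)

Section Morphism.
Variables (K : fieldType) (sg : {rmorphism K -> K}) (n m : nat).
Variables (c : K) (zz zz' : 'I_n -> K).
Hypotheses (sgc : sg c = c) (sgz : forall i, sg (zz i) = zz' i).

Lemma gamma_wt_morph z l t r b : sg (gamma_wt z l t r b) = gamma_wt (sg z) l t r b.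
Proof.
rewrite /gamma_wt; case: ifP => _; first by rewrite rmorph_nat.
by case: ifP => _; rewrite ?rmorphD ?rmorphM !rmorph_nat.
Qed.

Lemma delta_wt_morph z l t r b : sg (delta_wt z l t r b) = delta_wt (sg z) l t r b.
Proof.
rewrite /delta_wt; case: ifP => _; first by rewrite rmorphM rmorph_nat.
by case: ifP => _; rewrite ?rmorphD !rmorph_nat.
Qed.

Lemma state_weight_morph (s : state n m) :
  sg (state_weight c zz s) = state_weight c zz' s.
Proof.
rewrite /state_weight rmorph_prod; apply: eq_bigr => i _.
rewrite !rmorphM /gamma_row_wt /delta_row_wt !rmorph_prod; congr (_ * _ * _).
- by rewrite /uturn_wt; case: ifP => _; rewrite ?rmorphD ?rmorphM ?rmorph1 ?sgc ?sgz.
- by apply: eq_bigr => k _; rewrite /gamma_spin_wt gamma_wt_morph sgz.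
by apply: eq_bigr => k _; rewrite /delta_spin_wt delta_wt_morph fmorphV sgz.
Qed.
End Morphism.

Lemma div_cancel (F : fieldType) (f d g : F) : d != 0 -> f = d * g -> f / d = g.
Proof. by move=> d0 ->; rewrite mulrC mulKf. Qed.

Section Atoms.
Variables (n m : nat) (lam : n.-tuple nat) (X : cartan_type).
Hypothesis lam_part : sorted geq lam.
Hypothesis m_ge : (head 0%N lam + n <= m)%N.

Lemma zvar_neq (i j : 'I_n) : i != j -> zvar i != zvar j.
Proof.
apply: contraNneq => /eqP; rewrite /zvar tofrac_eq => /eqP /(congr1 (mcoeff U_(i))).
by rewrite !mcoeffXU eqxx eq_sym; case: eqP.
Qed.

Lemma zvar_neq_const (i : 'I_n) (b : {mpoly int[n]}) : mcoeff U_(i) b = 0 -> zvar i != FracField.tofrac b.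
Proof.
move=> b0; apply/eqP => /eqP; rewrite /zvar tofrac_eq => /eqP /(congr1 (mcoeff U_(i))).
by rewrite mcoeffXU eqxx b0.
Qed.

Lemma mcoeff_U_one (i : 'I_n) : mcoeff U_(i) (1 : {mpoly int[n]}) = 0.
Proof. by rewrite mcoeff1 mnm1_eq0. Qed.

Lemma zvar_sub1 (i : 'I_n) : zvar i - 1 != 0.
Proof.
rewrite subr_eq0; have := zvar_neq_const (mcoeff_U_one i).
by rewrite tofrac1.
Qed.

Lemma zvar_add1 (i : 'I_n) : zvar i + 1 != 0.
Proof.
rewrite -[1]opprK subr_eq0.
have := @zvar_neq_const i (-1) _; rewrite mcoeffN mcoeff_U_one oppr0 => /(_ erefl).
by rewrite tofracN tofrac1.
Qed.

Lemma zvar_sqr1 (i : 'I_n) : zvar i ^+ 2 - 1 != 0.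
Proof. by rewrite subr_sqr_1 mulf_neq0 ?zvar_sub1 ?zvar_add1. Qed.

(** Substitution is a morphism, so it acts on the weights of the states. *)
Lemma subst_partition_fn (i : 'I_n) w :
  subst (refl_vars i) (partition_fn m lam (xparam n X) (@zvar n) (exit_spins w)) =
  partition_fn m lam (xparam n X) (refl_vars i) (exit_spins w).
Proof.
have vI := @refl_vars_indep n i; have [sg sgE] := subst_rmorphism vI.
rewrite -sgE !partition_fn_states // rmorph_sum; apply: eq_bigr => s _.
apply: state_weight_morph => [|j]; last by rewrite sgE subst_zvar.
by rewrite /xparam; case: X; rewrite ?rmorph1 ?rmorph0.
Qed.

Lemma spin_code_exit (u : {perm letter n}) j :
  spin_code (exit_spins u j) = (color_pos (u^-1%g (j, false))).+1.
Proof.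
rewrite /exit_spins /spin_code /color_pos /bar; case: (u^-1%g _) => [k b] /=.
by have := ltn_ord k; case: b => /=; lia.
Qed.

(** By [reduced_cons] each letter of the word puts the exits in the order that
    [partition_fn_swap] or [partition_fn_reflect] requires. *)
Theorem atom_partition_function (s : seq 'I_n) (w : {perm letter n}) :
  reduced_word w s -> atom X lam s = partition_fn m lam (xparam n X) (@zvar n) (exit_spins w).
Proof.
elim: s w => [|i s IH] w red.
  have -> : w = 1%g by case: red => <-.
  by rewrite partition_fn_one.
have [ew redu asc] := reduced_cons red; set u := word_perm s in ew redu asc.
have -> : atom X lam (i :: s) = atom_op X i (atom X lam s) by [].
rewrite (IH u redu) /atom_op subst_partition_fn.
have exw j : exit_spins w j = Some (bar ((u^-1)%g (refl i (j, false)))).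
  by rewrite /exit_spins ew invMg reflV permM.
have z0 := @zvar_neq0 n.
case: ifP asc => hi asc.
  apply: div_cancel.
    have /zvar_neq : i != ordS i by rewrite -val_eqE /= modn_small //; lia.
    by apply: contraNneq => /eqP; rewrite subr_eq0 => /eqP e; apply/eqP; rewrite -[LHS](mulfVK (z0 (ordS i))) e mul1r.
  have lt : (spin_code (exit_spins u i) < spin_code (exit_spins u (ordS i)))%N by rewrite !spin_code_exit ltnS.
  apply: (@partition_fn_swap n m lam (ratfun n) (xparam n X) (@zvar n) (refl_vars i) (exit_spins u) (exit_spins w) i hi) => // j.
    by rewrite /refl_vars hi.
  by rewrite exw reflE_lt.
have hi' : ~~ (i.+1 < n)%N by rewrite hi.
have [k ek] : exists k, (u^-1)%g (i, false) = (k, false).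
  by move: asc; case: (u^-1%g _) => [k []] // _; exists k.
have /WP ub := W_inv (word_perm_W s).
have key D : D != 0 -> D * (1 + xparam n X * zvar i) = zvar i ^+ 2 - 1 ->
    (partition_fn m lam (xparam n X) (@zvar n) (exit_spins u) - partition_fn m lam (xparam n X) (refl_vars i) (exit_spins u)) / D =
    partition_fn m lam (xparam n X) (@zvar n) (exit_spins w).
  move=> D0 HD; apply: div_cancel => //.
  apply: (@partition_fn_reflect n m lam (ratfun n) (xparam n X) (@zvar n) (refl_vars i) (exit_spins u) (exit_spins w) i k D) => //.
  - by move=> j ji; rewrite /refl_vars hi (negPf ji).
  - by rewrite /refl_vars hi eqxx.
  - by move=> j ji; rewrite exw reflE_last // (negPf ji).
  - by rewrite /exit_spins ek.
  - by rewrite exw reflE_last // eqxx -[(i, ~~ false)]/(bar (i, false)) ub ek.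
  exact: zvar_sqr1.
case: X key => key; apply: key.
- exact: zvar_sub1.
- by rewrite /xparam mul1r subr_sqr_1 [1 + _]addrC.
- exact: zvar_sqr1.
by rewrite /xparam mul0r addr0 mulr1.
Qed.
End Atoms.

Theorem theorem5p5 (n : nat) (lam : n.-tuple nat) (X : cartan_type) (m : nat)
    (n_ge1 : (1 <= n)%N) (lam_part : sorted geq lam)
    (m_ge : (head 0%N lam + n <= m)%N) :
  (forall T : filling lam, T \in tableaux lam X ->
     exists! w : {perm letter n}, is_key m T w) /\
  right_key_map X (key (lam := lam) m).
Proof.
have keyE (T : filling lam) w : is_key m T w = king_key m (fill_infty T) w by [].
have ex1 (T : filling lam) : T \in tableaux lam X -> exists! w : {perm letter n}, is_key m T w.
  case/tableauxP => U [R [k h _ ->]].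
  have [w [kw un]] := king_key_unique lam_part m_ge k.
  by exists w; split=> [|w']; rewrite keyE fill_inftyK //; apply: un.
have keyP (T : filling lam) w : T \in tableaux lam X -> (key m T == w) = is_key m T w.
  move=> /ex1 [w0 [k0 un]]; rewrite /key.
  have -> : [pick w1 | is_key m T w1] = Some w0.
    by case: pickP => [w1 /un ->|/(_ w0)]; rewrite ?k0.
  by apply/eqP/idP => [<- //|/un].
split=> //; split.
- apply/setP => T; apply/idP/bigcupP => [TT|[w _]]; last by rewrite inE => /andP [].
  have [w0 [k0 _]] := ex1 T TT; exists w0; first by case/andP: k0.
  by rewrite inE TT keyP.
- move=> w w' _ _ ne; rewrite -setI_eq0; apply/eqP/setP => T; rewrite !inE.
  by apply/negP => /andP [/andP [_ /eqP e] /andP [_ /eqP e']]; rewrite -e e' eqxx in ne.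
move=> w wW s red; rewrite (atom_partition_function X lam_part m_ge red) partition_fn_states //.
have -> : \sum_(T in [set T0 in tableaux lam X | key m T0 == w]) zwt T =
   \sum_(T in tableaux lam X | king_key m (fill_infty T) w) zwt T.
  by apply: eq_bigl => T; rewrite inE; case TT : (T \in _) => //=; rewrite keyP.
rewrite (tableau_weight_sum X (fun U => king_key m U w)) (king_key_sum lam_part m_ge _ wW).
apply: eq_bigr => s0 a.
apply: (state_weightE lam_part m_ge a (state_king lam_part m_ge a) (state_edges lam_part m_ge a)).
exact: zvar_neq0.
Qed.
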